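(* Let $n \geq 1$. The image $B_n$ of $\Psi_n: \mathrm{U}(W_{\geq -1}) \rightarrow T_n$ is a non-Noetherian ring of Gelfand–Kirillov dimension $n+2$ which is birational to $T_n$.
   Context: Let $\Bbbk$ be a field of characteristic $0$; all algebras are unital $\Bbbk$-algebras and $\otimes=\otimes_\Bbbk$. The one-sided Witt algebra is the Lie algebra $W_{\geq -1}=\Bbbk[t]\partial$, $\partial=\frac{d}{dt}$, with bracket $[f\partial,g\partial]=(fg'-f'g)\partial$. It has basis $e_i=t^{i+1}\partial$ ($i\geq -1$). For $n\ge -1$ let $W_{\geq n}=\mathrm{span}_\Bbbk\{e_i\mid i\geq n\}$. For $n\geq 0$ let $\mathfrak g_n=W_{\geq 0}/W_{\geq n}$, with basis $v_i=e_i+W_{\geq n}$, $0\leq i\leq n-1$. $\mathrm U(\cdot)$ denotes the universal enveloping algebra. $A_1$ is the first Weyl algebra, generated by $t,\partial$ with $\partial t-t\partial=1$, and $T_n=A_1\otimes \mathrm U(\mathfrak g_n)$. The $n$th orbit homomorphism is the algebra homomorphism $\Psi_n:\mathrm U(W_{\geq -1})\to T_n$ determined by $\Psi_n(f\partial)=f\partial+\sum_{i=0}^{n-1}\frac{f^{(i+1)}}{(i+1)!}v_i$ for $f\in\Bbbk[t]$, and $B_n=\Psi_n(\mathrm U(W_{\geq -1}))$. Noetherian means left and right Noetherian. The statement that the subring $B_n\subseteq T_n$ is birational to $T_n$ means that $B_n$ and $T_n$ (which are left and right Ore domains) have the same ring of quotients, i.e. $Q(B_n)=Q(T_n)$ inside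 $Q(T_n)$. *)

(* Defs.v *)
From HB Require Import structures.
From mathcomp Require Import all_boot all_order all_algebra.
From mathcomp Require Import generic_quotient ring_quotient sesquilinear.
From mathcomp Require Import boolp classical_sets reals ereal topology normedtype
  sequences exp.
From mathcomp Require Import ring.

Set Implicit Arguments.
Unset Strict Implicit.
Unset Printing Implicit Defensive.

Import Order.TTheory GRing.Theory Num.Theory.

Local Open Scope ring_scope.
Local Open Scope quotient_scope.
Local Open Scope classical_set_scope.

Section Linear.
Variables (k : fieldType) (V : lmodType k).

Definition lin_span (S : set V) : set V :=
  [set v | exists2 s : seq (k * V), (forall p, p \in s -> S p.2) &
           v = \sum_(p <- s) p.1 *: p.2].

Definition lin_indep (s : seq V) : Prop :=
  forall c : 'I_(size s) -> k,
    \sum_(i < size s) c i *: s`_i = 0 -> forall i, c i = 0.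

(* The dimension of the subspace S, in [0, +oo]. *)
Definition lin_dim (R : realType) (S : set V) : \bar R :=
  ereal_sup [set ((size s)%:R)%:E | s in
    [set s : seq V | lin_indep s /\ (forall v, v \in s -> S v)]].

Lemma lin_span_sub (S : set V) v : S v -> lin_span S v.
Proof.
move=> Sv; exists [:: (1, v)]; last by rewrite big_seq1 scale1r.
by move=> p; rewrite inE => /eqP->.
Qed.

Lemma lin_span0 (S : set V) : lin_span S 0.
Proof. by exists [::]; rewrite ?big_nil. Qed.

Lemma lin_spanP (S : set V) a u v :
  lin_span S u -> lin_span S v -> lin_span S (a *: u + v).
Proof.
move=> [s Ss ->] [s' Ss' ->].
exists ([seq (a * p.1, p.2) | p <- s] ++ s').
  move=> p; rewrite mem_cat => /orP[/mapP[q /Ss Sq ->] //|/Ss' //].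
rewrite big_cat big_map scaler_sumr; congr (_ + _).
by apply: eq_bigr => p _; rewrite scalerA.
Qed.

Lemma lin_span_min (S M : set V) : M 0 ->
  (forall a u v, M u -> M v -> M (a *: u + v)) ->
  S `<=` M -> lin_span S `<=` M.
Proof.
move=> M0 Ml SM v [s Ss ->]; elim: s Ss => [|p s IH] Ss.
  by rewrite big_nil.
rewrite big_cons; apply: Ml; first by apply/SM/Ss; rewrite inE eqxx.
by apply: IH => q qs; apply: Ss; rewrite inE qs orbT.
Qed.

Lemma lin_span_submod (S : set V) : submod_closed [pred v | `[< lin_span S v >]].
Proof.
split=> [|a u v]; first exact/asboolP/lin_span0.
by move=> /asboolP Su /asboolP Sv; apply/asboolP/lin_spanP.
Qed.

End Linear.

Section GelfandKirillov.
Variables (R : realType) (k : fieldType) (A : algType k).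

Fixpoint subspace_pow (V : set A) (m : nat) : set A :=
  if m is m'.+1
  then lin_span [set x * y | x in subspace_pow V m' & y in V]
  else lin_span [set 1].

Definition subspace_filt (V : set A) (m : nat) : set A :=
  lin_span (\bigcup_(i in [set i : nat | (i <= m)%N]) subspace_pow V i).

(* sup over finite-dimensional V of limsup_m log_m dim (k + V + ... + V^m) *)
Definition GKdim : \bar R :=
  ereal_sup [set limn_esup (fun m : nat =>
      (ln (fine (lin_dim R (subspace_filt (lin_span [set` s]) m)))
         / ln (m%:R))%:E) | s in [set: seq A]].

End GelfandKirillov.

Section Rings.
Variable R : nzRingType.

Definition is_left_ideal (I : set R) : Prop :=
  [/\ I 0, forall x y, I x -> I y -> I (x + y) & forall a x, I x -> I (a * x)].

Definition is_right_ideal (I : set R) : Prop :=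
  [/\ I 0, forall x y, I x -> I y -> I (x + y) & forall a x, I x -> I (x * a)].

Definition acc (P : set R -> Prop) : Prop :=
  forall I : nat -> set R, (forall i, P (I i)) ->
    (forall i, I i `<=` I i.+1) ->
    exists N, forall i, (N <= i)%N -> I i = I N.

Definition noetherian : Prop := acc is_left_ideal /\ acc is_right_ideal.

Definition is_domain : Prop := forall x y : R, x * y = 0 -> x = 0 \/ y = 0.

Definition right_ore : Prop := forall a b : R, a != 0 -> b != 0 ->
  exists x y, a * x = b * y /\ a * x != 0.

Definition left_ore : Prop := forall a b : R, a != 0 -> b != 0 ->
  exists x y, x * a = y * b /\ x * a != 0.

Definition ore_domain : Prop := [/\ is_domain, right_ore & left_ore].

Definition regular_elt (s : R) : Prop := GRing.lreg s /\ GRing.rreg s.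

Definition is_ring_of_quotients (Q : unitRingType) (i : R -> Q) : Prop :=
  [/\ injective i,
      forall s, regular_elt s -> i s \is a GRing.unit,
      forall q, exists a s, regular_elt s /\ q = i a * (i s)^-1 &
      forall q, exists a s, regular_elt s /\ q = (i s)^-1 * i a].

End Rings.

(* For a subring j : B -> T of T, Q(B) = Q(T) inside Q(T).  By Ore's theorem   *)
(* Q(T) exists once T is an Ore domain, and it is unique up to isomorphism.   *)
Definition birational (B T : nzRingType) (j : {rmorphism B -> T}) : Prop :=
  [/\ injective j, ore_domain B, ore_domain T &
      forall (Q : unitRingType) (i : {rmorphism T -> Q}),
        is_ring_of_quotients i -> is_ring_of_quotients (i \o j)].

Section Image.
Variables (k : fieldType) (A B : algType k) (f : {lrmorphism A -> B}).

Definition in_image : {pred B} := [pred y | `[< exists x, f x = y >]].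

Lemma in_image_subalg : GRing.subalg_closed in_image.
Proof.
split=> [|a u v|u v].
- by apply/asboolP; exists 1; rewrite rmorph1.
- move=> /asboolP[x <-] /asboolP[y <-]; apply/asboolP.
  by exists (a *: x + y); rewrite linearP.
- move=> /asboolP[x <-] /asboolP[y <-]; apply/asboolP.
  by exists (x * y); rewrite rmorphM.
Qed.

HB.instance Definition _ := GRing.isSubalgClosed.Build k B in_image
  (GRing.subalg_closed_semi in_image_subalg).

Definition image_alg : Type := {y : B | in_image y}.

HB.instance Definition _ := SubType.on image_alg.
HB.instance Definition _ := [Choice of image_alg by <:].
HB.instance Definition _ := [SubChoice_isSubAlgebra of image_alg by <:].

Definition image_val (y : image_alg) : B := val y.
Lemma image_val_linear : linear image_val.
Proof. exact: linearP. Qed.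
Lemma image_val_monoid_morphism : monoid_morphism image_val.
Proof. exact: (conj (rmorph1 val) (rmorphM val)). Qed.
HB.instance Definition _ :=
  GRing.isLinear.Build k image_alg B _ image_val image_val_linear.
HB.instance Definition _ :=
  GRing.isMonoidMorphism.Build image_alg B image_val image_val_monoid_morphism.

Definition image_incl : {lrmorphism image_alg -> B} := image_val.

End Image.

Section Terms.
Variables (k : fieldType) (X : Type).

Inductive aterm :=
  | AGen of X
  | ACst of k
  | AAdd of aterm & aterm
  | AMul of aterm & aterm.

Definition AOpp t := AMul (ACst (-1)) t.
Definition ASub t u := AAdd t (AOpp u).

(* Smallest congruence containing rel and the axioms of unital k-algebras. *)
Inductive acong (rel : aterm -> aterm -> Prop) : aterm -> aterm -> Prop :=
  | acong_rel t u : rel t u -> acong rel t u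
  | acong_refl t : acong rel t t
  | acong_sym t u : acong rel t u -> acong rel u t
  | acong_trans t u w : acong rel t u -> acong rel u w -> acong rel t w
  | acong_add t t' u u' :
      acong rel t t' -> acong rel u u' -> acong rel (AAdd t u) (AAdd t' u')
  | acong_mul t t' u u' :
      acong rel t t' -> acong rel u u' -> acong rel (AMul t u) (AMul t' u')
  | acong_addA t u w : acong rel (AAdd t (AAdd u w)) (AAdd (AAdd t u) w)
  | acong_addC t u : acong rel (AAdd t u) (AAdd u t)
  | acong_add0 t : acong rel (AAdd (ACst 0) t) t
  | acong_mulA t u w : acong rel (AMul t (AMul u w)) (AMul (AMul t u) w)
  | acong_mul1 t : acong rel (AMul (ACst 1) t) t
  | acong_mul0 t : acong rel (AMul (ACst 0) t) (ACst 0)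
  | acong_mulDl t u w :
      acong rel (AMul (AAdd t u) w) (AAdd (AMul t w) (AMul u w))
  | acong_mulDr t u w :
      acong rel (AMul t (AAdd u w)) (AAdd (AMul t u) (AMul t w))
  | acong_cstD a b : acong rel (ACst (a + b)) (AAdd (ACst a) (ACst b))
  | acong_cstM a b : acong rel (ACst (a * b)) (AMul (ACst a) (ACst b))
  | acong_cstC a t : acong rel (AMul (ACst a) t) (AMul t (ACst a)).

Fixpoint aeval (A : algType k) (g : X -> A) (t : aterm) : A :=
  match t with
  | AGen x => g x
  | ACst c => c%:A
  | AAdd t u => aeval g t + aeval g u
  | AMul t u => aeval g t * aeval g u
  end.

Lemma aeval_cong rel (A : algType k) (g : X -> A) :
  (forall t u, rel t u -> aeval g t = aeval g u) ->
  forall t u, acong rel t u -> aeval g t = aeval g u.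
Proof.
move=> hg t u; elim => {t u} //=.
- by move=> t u w _ -> _ ->.
- by move=> t t' u u' _ -> _ ->.
- by move=> t t' u u' _ -> _ ->.
- by move=> t u w; rewrite addrA.
- by move=> t u; rewrite addrC.
- by move=> t; rewrite scale0r add0r.
- by move=> t u w; rewrite mulrA.
- by move=> t; rewrite scale1r mul1r.
- by move=> t; rewrite scale0r mul0r.
- by move=> t u w; rewrite mulrDl.
- by move=> t u w; rewrite mulrDr.
- by move=> a b; rewrite scalerDl.
- by move=> a b; rewrite mulr_algl scalerA.
- by move=> a t; rewrite mulr_algl mulr_algr.
Qed.

Fixpoint aact (V : lmodType k) (g : X -> V -> V) (t : aterm) (v : V) : V :=
  match t with
  | AGen x => g x v
  | ACst c => c *: v
  | AAdd t u => aact g t v + aact g u v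
  | AMul t u => aact g t (aact g u v)
  end.

Lemma aact_linear (V : lmodType k) (g : X -> V -> V) :
  (forall x, linear (g x)) -> forall t, linear (aact g t).
Proof.
move=> gl; elim=> [x|c|t iht u ihu|t iht u ihu] a v w /=.
- exact: gl.
- by rewrite scalerDr !scalerA mulrC.
- by rewrite iht ihu scalerDr addrACA.
- by rewrite ihu iht.
Qed.

Lemma aact_cong rel (V : lmodType k) (g : X -> V -> V) :
  (forall x, linear (g x)) ->
  (forall t u, rel t u -> forall v, aact g t v = aact g u v) ->
  forall t u, acong rel t u -> forall v, aact g t v = aact g u v.
Proof.
move=> gl hg t u; elim => {t u} //=.
- by move=> t u w _ e _ e' v; rewrite e e'.
- by move=> t t' u u' _ e _ e' v; rewrite e e'.
- by move=> t t' u u' _ e _ e' v; rewrite e e'.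
- by move=> t u w v; rewrite addrA.
- by move=> t u v; rewrite addrC.
- by move=> t v; rewrite scale0r add0r.
- by move=> t v; rewrite scale1r.
- by move=> t v; rewrite !scale0r.
- by move=> t u w v; have := aact_linear gl t 1 (aact g u v) (aact g w v);
    rewrite !scale1r.
- by move=> a b v; rewrite scalerDl.
- by move=> a b v; rewrite scalerA.
- move=> a t v; have l := aact_linear gl t.
  have l0 : aact g t 0 = 0.
    by have := l (-1) 0 0; rewrite !scaleN1r oppr0 addr0 addNr.
  by have := l a v 0; rewrite !addr0 l0 addr0.
Qed.

Record presentation := Presentation {
  prel : aterm -> aterm -> Prop;
  prel_consistent : ~ acong prel (ACst 1) (ACst 0) }.

Lemma aact_consistent rel (V : lmodType k) (g : X -> V -> V) (v0 : V) :
  v0 != 0 -> (forall x, linear (g x)) ->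
  (forall t u, rel t u -> forall v, aact g t v = aact g u v) ->
  ~ acong rel (ACst 1) (ACst 0).
Proof.
move=> v0N0 gl hg /(aact_cong gl hg)/(_ v0)/=.
by rewrite scale1r scale0r; apply/eqP.
Qed.

End Terms.

Section PresentedAlgebra.
Variables (k : fieldType) (X : Type) (P : presentation k X).

Let term := {classic aterm k X}.

Definition pcong (t u : term) : bool := `[< acong (@prel _ _ P) t u >].

Lemma pcong_equiv : equiv_class_of pcong.
Proof.
split=> [t|t u|u t w].
- by apply/asboolP; exact: acong_refl.
- by apply/asboolP/asboolP; exact: acong_sym.
- by move=> /asboolP tu /asboolP uw; apply/asboolP; exact: acong_trans tu uw.
Qed.
Canonical pcong_equivRel := EquivRelPack pcong_equiv.

Definition palg : Type := {eq_quot pcong}.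
HB.instance Definition _ := Choice.copy palg {eq_quot pcong}.

Definition pclass (t : aterm k X) : palg := \pi_{eq_quot pcong} (t : term).
Definition prepr (x : palg) : aterm k X := repr (x : {eq_quot pcong}).

Lemma pclassP t u : pclass t = pclass u <-> acong (@prel _ _ P) t u.
Proof.
rewrite /pclass; split; first by move/eqquotP/asboolP.
by move=> tu; apply/eqquotP/asboolP.
Qed.

Lemma preprK x : pclass (prepr x) = x.
Proof. exact: reprK. Qed.

Lemma preprP t : acong (@prel _ _ P) (prepr (pclass t)) t.
Proof. by apply/pclassP; rewrite preprK. Qed.

Definition padd x y := pclass (AAdd (prepr x) (prepr y)).
Definition pmul x y := pclass (AMul (prepr x) (prepr y)).
Definition popp x := pclass (AOpp (prepr x)).
Definition pscale c x := pclass (AMul (ACst X c) (prepr x)).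

Lemma paddE t u : padd (pclass t) (pclass u) = pclass (AAdd t u).
Proof. by apply/pclassP; apply: acong_add; exact: preprP. Qed.
Lemma pmulE t u : pmul (pclass t) (pclass u) = pclass (AMul t u).
Proof. by apply/pclassP; apply: acong_mul; exact: preprP. Qed.
Lemma poppE t : popp (pclass t) = pclass (AOpp t).
Proof. by apply/pclassP; apply: acong_mul; [exact: acong_refl|exact: preprP]. Qed.
Lemma pscaleE c t : pscale c (pclass t) = pclass (AMul (ACst X c) t).
Proof. by apply/pclassP; apply: acong_mul; [exact: acong_refl|exact: preprP]. Qed.

Lemma paddA : associative padd.
Proof.
move=> x y z; rewrite -(preprK x) -(preprK y) -(preprK z) !paddE.
exact/pclassP/acong_addA.
Qed.
Lemma paddC : commutative padd.
Proof.
move=> x y; rewrite -(preprK x) -(preprK y) !paddE.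
exact/pclassP/acong_addC.
Qed.
Lemma padd0 : left_id (pclass (ACst X 0)) padd.
Proof. by move=> x; rewrite -(preprK x) !paddE; exact/pclassP/acong_add0. Qed.
Lemma paddN : left_inverse (pclass (ACst X 0)) popp padd.
Proof.
move=> x; rewrite -(preprK x) poppE paddE; apply/pclassP.
set t := prepr x.
apply: (acong_trans (u := AMul (AAdd (ACst X (-1)) (ACst X 1)) t)).
  apply: acong_sym; apply: acong_trans (acong_mulDl _ _ _ _) _.
  by apply: acong_add; [exact: acong_refl|exact: acong_mul1].
apply: (acong_trans (u := AMul (ACst X 0) t)); last exact: acong_mul0.
apply: acong_mul; last exact: acong_refl.
by apply: acong_sym; rewrite -[0](addNr 1); exact: acong_cstD.
Qed.
HB.instance Definition _ := GRing.isZmodule.Build palg paddA paddC padd0 paddN.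

Lemma pmulA : associative pmul.
Proof.
move=> x y z; rewrite -(preprK x) -(preprK y) -(preprK z) !pmulE.
exact/pclassP/acong_mulA.
Qed.
Lemma pmul1l : left_id (pclass (ACst X 1)) pmul.
Proof. by move=> x; rewrite -(preprK x) !pmulE; exact/pclassP/acong_mul1. Qed.
Lemma pmul1r : right_id (pclass (ACst X 1)) pmul.
Proof.
move=> x; rewrite -(preprK x) !pmulE; apply/pclassP.
exact: acong_trans (acong_sym (acong_cstC _ _ _)) (acong_mul1 _ _).
Qed.
Lemma pmulDl : left_distributive pmul +%R.
Proof.
move=> x y z; rewrite -(preprK x) -(preprK y) -(preprK z).
rewrite -![_ + _]/(padd _ _) !(paddE, pmulE).
exact/pclassP/acong_mulDl.
Qed.
Lemma pmulDr : right_distributive pmul +%R.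
Proof.
move=> x y z; rewrite -(preprK x) -(preprK y) -(preprK z).
rewrite -![_ + _]/(padd _ _) !(paddE, pmulE).
exact/pclassP/acong_mulDr.
Qed.
Lemma pone_neq0 : pclass (ACst X 1) != 0.
Proof. by apply/eqP => /pclassP /prel_consistent. Qed.
HB.instance Definition _ := GRing.Zmodule_isNzRing.Build palg
  pmulA pmul1l pmul1r pmulDl pmulDr pone_neq0.

Lemma pscaleA a b x : pscale a (pscale b x) = pscale (a * b) x.
Proof.
rewrite -(preprK x) !pscaleE; apply/pclassP.
apply: acong_trans (acong_mulA _ _ _ _) _.
by apply: acong_mul; [apply/acong_sym/acong_cstM|exact: acong_refl].
Qed.
Lemma pscale1 : left_id 1 pscale.
Proof. by move=> x; rewrite -(preprK x) pscaleE; exact/pclassP/acong_mul1. Qed.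
Lemma pscaleDr : right_distributive pscale +%R.
Proof.
move=> a x y; rewrite -(preprK x) -(preprK y).
rewrite -![_ + _]/(padd _ _) !(paddE, pscaleE).
exact/pclassP/acong_mulDr.
Qed.
Lemma pscaleDl x : {morph pscale^~ x : a b / a + b}.
Proof.
move=> a b; rewrite -(preprK x) -![_ + _ in RHS]/(padd _ _) !(paddE, pscaleE).
apply/pclassP/(acong_trans _ (acong_mulDl _ _ _ _)).
by apply: acong_mul; [exact: acong_cstD|exact: acong_refl].
Qed.
HB.instance Definition _ := GRing.Zmodule_isLmodule.Build k palg
  pscaleA pscale1 pscaleDr pscaleDl.

Lemma pscaleAl (a : k) (x y : palg) : a *: (x * y) = (a *: x) * y.
Proof.
rewrite -(preprK x) -(preprK y) -![_ * _]/(pmul _ _) -![_ *: _]/(pscale _ _).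
by rewrite !(pmulE, pscaleE); exact/pclassP/acong_mulA.
Qed.
HB.instance Definition _ := GRing.Lmodule_isLalgebra.Build k palg pscaleAl.

Lemma pscaleAr (a : k) (x y : palg) : a *: (x * y) = x * (a *: y).
Proof.
rewrite -(preprK x) -(preprK y) -![_ * _]/(pmul _ _) -![_ *: _]/(pscale _ _).
rewrite !(pmulE, pscaleE); apply/pclassP.
apply: acong_trans (acong_mulA _ _ _ _) _.
apply: acong_trans _ (acong_sym (acong_mulA _ _ _ _)).
by apply: acong_mul; [exact: acong_cstC|exact: acong_refl].
Qed.
HB.instance Definition _ := GRing.Lalgebra_isAlgebra.Build k palg pscaleAr.

Definition pgen (x : X) : palg := pclass (AGen k x).

Lemma pclass_eval t : aeval pgen t = pclass t.
Proof.
elim: t => [x|c|t iht u ihu|t iht u ihu] //=.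
- rewrite -[_ *: _]/(pscale _ _) -[1]/(pclass _) pscaleE; apply/pclassP.
  exact: acong_trans (acong_cstC _ _ _) (acong_mul1 _ _).
- by rewrite iht ihu; exact: paddE.
- by rewrite iht ihu; exact: pmulE.
Qed.

Lemma pgen_rel t u : prel P t u -> aeval pgen t = aeval pgen u.
Proof. by move=> tu; rewrite !pclass_eval; apply/pclassP/acong_rel. Qed.

Section Lift.
Variables (A : algType k) (g : X -> A).
Hypothesis hg : forall t u, prel P t u -> aeval g t = aeval g u.

Definition plift (_ : forall t u, prel P t u -> aeval g t = aeval g u)
  (x : palg) : A := aeval g (prepr x).

Local Notation lft := (plift hg).

Lemma pliftE t : lft (pclass t) = aeval g t.
Proof. exact: aeval_cong hg _ _ (preprP t). Qed.

Lemma plift_gen x : lft (pgen x) = g x.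
Proof. exact: pliftE. Qed.

Lemma plift_linear : linear lft.
Proof.
move=> a x y; rewrite -(preprK x) -(preprK y).
rewrite -[_ + _ in LHS]/(padd _ _) -[_ *: _ in LHS]/(pscale _ _).
by rewrite pscaleE paddE !pliftE /= mulr_algl.
Qed.

Lemma plift_monoid_morphism : monoid_morphism lft.
Proof.
split; first by rewrite -[1]/(pclass _) pliftE /= scale1r.
move=> x y; rewrite -(preprK x) -(preprK y) -[_ * _ in LHS]/(pmul _ _).
by rewrite pmulE !pliftE.
Qed.

HB.instance Definition _ := GRing.isLinear.Build k palg A _ lft plift_linear.
HB.instance Definition _ :=
  GRing.isMonoidMorphism.Build palg A lft plift_monoid_morphism.

Definition palg_lift : {lrmorphism palg -> A} := lft.

End Lift.

Lemma palg_lift_unique (A : algType k) (f f' : {lrmorphism palg -> A}) :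
  (forall x, f (pgen x) = f' (pgen x)) -> f =1 f'.
Proof.
move=> ff' x; rewrite -(preprK x) -pclass_eval.
elim: (prepr x) => [y|c|t iht u ihu|t iht u ihu] //=.
- by rewrite !linearZ /= !rmorph1.
- by rewrite !linearD /= iht ihu.
- by rewrite !rmorphM /= iht ihu.
Qed.

End PresentedAlgebra.

Section Functional.
Variables (k : fieldType) (V : lmodType k) (e : V).
Hypothesis eN0 : e != 0.

Lemma functional_exists : exists2 f : V -> k, linear_for *%R f & f e = 1.
Proof.
pose P (M : set V) :=
  ~ M e /\ forall a u v, M u -> M v -> M (a *: u + v).
have [F FP Ftot|M [[Me Mlin] Mmax]] := @Zorn_bigcup V P.
  split=> [[M FM Me]|a u v [M FM Mu] [N FN Nv]]; first exact: (FP _ FM).1.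
  have [MN|NM] := Ftot _ _ FM FN.
    by exists N => //; apply: (FP _ FN).2 => //; exact: MN.
  by exists M => //; apply: (FP _ FM).2 => //; exact: NM.
have M0 : M 0.
  apply: contrapT => M0; apply: (Mmax [set 0]).
    split; last by move=> /(_ 0 erefl).
    move=> u Mu; exfalso; apply: M0.
    by have := Mlin (-1) u u Mu Mu; rewrite scaleN1r addNr.
  split=> [/eqP|a u v -> ->]; first by rewrite (negPf eN0).
  by rewrite scaler0 addr0.
have MZ a u : M u -> M (a *: u) by move=> Mu; rewrite -[_ *: _]addr0; exact: Mlin.
have MD u v : M u -> M v -> M (u + v).
  by move=> Mu Mv; rewrite -[u]scale1r; exact: Mlin.
have MB u v : M u -> M v -> M (u - v).
  by move=> Mu Mv; rewrite -scaleN1r; apply: MD => //; exact: MZ.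
have /choice[f fP] v : exists c, M (v - c *: e).
  have [Mv|Mv] := pselect (M v); first by exists 0; rewrite scale0r subr0.
  pose N := [set w | exists2 c, True & M (w - c *: v)].
  have : ~ P N.
    apply: Mmax; split=> [w Mw|NM]; first by exists 0 => //; rewrite scale0r subr0.
    by apply: Mv; apply: NM; exists 1 => //; rewrite scale1r subrr.
  have Nlin a u w : N u -> N w -> N (a *: u + w).
    move=> [c _ Mc] [d _ Md]; exists (a * c + d) => //.
    have -> : a *: u + w - (a * c + d) *: v = a *: (u - c *: v) + (w - d *: v).
      by rewrite scalerBr scalerDl scalerA opprD addrACA.
    exact: Mlin.
  move=> nPN; have [c _ Mc] : N e.
    by apply: contrapT => Ne; apply: nPN; split.
  have c0 : c != 0.
    by apply/eqP => c0; apply: Me; move: Mc; rewrite c0 scale0r subr0.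
  exists c^-1.
  have -> : v - c^-1 *: e = - c^-1 *: (e - c *: v).
    by rewrite scalerBr !scaleNr scalerA mulVf // scale1r opprK addrC.
  exact: MZ.
have funiq v c : M (v - c *: e) -> f v = c.
  move=> Mc; apply: contrapT => /eqP; rewrite -subr_eq0 => d0.
  apply: Me; rewrite -[e](scale1r) -(mulVf d0) -scalerA; apply: MZ.
  have -> : (f v - c) *: e = (v - c *: e) - (v - f v *: e).
    by rewrite scalerBl opprB [RHS]addrC subrKA.
  exact: MB.
exists f; last by apply: funiq; rewrite scale1r subrr.
move=> a u v; apply: funiq.
have -> : a *: u + v - (a * f u + f v) *: e
          = a *: (u - f u *: e) + (v - f v *: e).
  by rewrite scalerBr scalerDl scalerA opprD addrACA.
exact: Mlin.
Qed.

End Functional.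

Section Tensor.
Variables (k : fieldType) (A B : algType k).

Definition is_bilinear (V : lmodType k) (f : A -> B -> V) : Prop :=
  (forall b, linear (f^~ b)) /\ (forall a, linear (f a)).

(* A list [:: (a_1, b_1); ...] stands for the sum of the a_i (x) b_i.  Two     *)
(* lists are identified when every bilinear map agrees on them; tens_lift and *)
(* tens_span below give the universal property.                               *)
Definition tens_eval (V : lmodType k) (f : A -> B -> V) (s : seq (A * B)) : V :=
  \sum_(p <- s) f p.1 p.2.

Definition tens_eq (s s' : seq (A * B)) : bool :=
  `[< forall (V : lmodType k) (f : A -> B -> V), is_bilinear f ->
      tens_eval f s = tens_eval f s' >].

Lemma tens_eq_equiv : equiv_class_of tens_eq.
Proof.
split=> [s|s t|r s t].
- by apply/asboolP.
- by apply/asboolP/asboolP => st V f fb; rewrite st.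
- move=> /asboolP rs /asboolP st; apply/asboolP => V f fb.
  by rewrite rs // st.
Qed.
Canonical tens_equivRel := EquivRelPack tens_eq_equiv.

Definition tens : Type := {eq_quot tens_eq}.
HB.instance Definition _ := Choice.copy tens {eq_quot tens_eq}.

Definition tclass (s : seq (A * B)) : tens := \pi_{eq_quot tens_eq} s.
Definition trepr (x : tens) : seq (A * B) := repr (x : {eq_quot tens_eq}).

Lemma tclassP s s' : tclass s = tclass s' <->
  forall (V : lmodType k) (f : A -> B -> V), is_bilinear f ->
    tens_eval f s = tens_eval f s'.
Proof.
rewrite /tclass; split; first by move/eqquotP/asboolP.
by move=> ss'; apply/eqquotP/asboolP.
Qed.

Lemma treprK x : tclass (trepr x) = x.
Proof. exact: reprK. Qed.

Lemma treprP s (V : lmodType k) (f : A -> B -> V) : is_bilinear f ->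
  tens_eval f (trepr (tclass s)) = tens_eval f s.
Proof. by move=> fb; have /tclassP := treprK (tclass s); exact. Qed.

Definition tmulseq (s s' : seq (A * B)) : seq (A * B) :=
  [seq (p.1 * q.1, p.2 * q.2) | p <- s, q <- s'].
Definition tscaleseq (c : k) (s : seq (A * B)) : seq (A * B) :=
  [seq (c *: p.1, p.2) | p <- s].

Definition tadd x y := tclass (trepr x ++ trepr y).
Definition tscale c x := tclass (tscaleseq c (trepr x)).
Definition topp x := tscale (-1) x.
Definition tmul x y := tclass (tmulseq (trepr x) (trepr y)).

Section Eval.
Variables (V : lmodType k) (f : A -> B -> V).
Hypothesis fb : is_bilinear f.

Lemma bilin0l b : f 0 b = 0.
Proof. by have := fb.1 b (-1) 0 0; rewrite !scaleN1r oppr0 addr0 addNr. Qed.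
Lemma bilin0r a : f a 0 = 0.
Proof. by have := fb.2 a (-1) 0 0; rewrite !scaleN1r oppr0 addr0 addNr. Qed.
Lemma bilinDl a a' b : f (a + a') b = f a b + f a' b.
Proof. by have := fb.1 b 1 a a'; rewrite !scale1r. Qed.
Lemma bilinDr a b b' : f a (b + b') = f a b + f a b'.
Proof. by have := fb.2 a 1 b b'; rewrite !scale1r. Qed.
Lemma bilinZl c a b : f (c *: a) b = c *: f a b.
Proof. by have := fb.1 b c a 0; rewrite !addr0 bilin0l addr0. Qed.
Lemma bilinZr c a b : f a (c *: b) = c *: f a b.
Proof. by have := fb.2 a c b 0; rewrite !addr0 bilin0r addr0. Qed.

Lemma tens_eval_cat s s' :
  tens_eval f (s ++ s') = tens_eval f s + tens_eval f s'.
Proof. by rewrite /tens_eval big_cat. Qed.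

Lemma tens_eval_scale c s : tens_eval f (tscaleseq c s) = c *: tens_eval f s.
Proof.
rewrite /tens_eval big_map scaler_sumr; apply: eq_bigr => p _ /=.
exact: bilinZl.
Qed.

Lemma tens_eval_mul s s' : tens_eval f (tmulseq s s') =
  \sum_(p <- s) \sum_(q <- s') f (p.1 * q.1) (p.2 * q.2).
Proof. by rewrite /tens_eval big_allpairs_dep. Qed.

Lemma bilin_mull (p : A * B) : is_bilinear (fun a b => f (p.1 * a) (p.2 * b)).
Proof.
split=> [b|a] c u v.
- by rewrite mulrDr -scalerAr bilinDl bilinZl.
- by rewrite mulrDr -scalerAr bilinDr bilinZr.
Qed.
Lemma bilin_mulr (p : A * B) : is_bilinear (fun a b => f (a * p.1) (b * p.2)).
Proof.
split=> [b|a] c u v.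
- by rewrite mulrDl -scalerAl bilinDl bilinZl.
- by rewrite mulrDl -scalerAl bilinDr bilinZr.
Qed.

End Eval.

Lemma taddE s s' : tadd (tclass s) (tclass s') = tclass (s ++ s').
Proof. by apply/tclassP => V f fb; rewrite !tens_eval_cat !treprP. Qed.
Lemma tscaleE c s : tscale c (tclass s) = tclass (tscaleseq c s).
Proof. by apply/tclassP => V f fb; rewrite !tens_eval_scale // treprP. Qed.
Lemma tmulE s s' : tmul (tclass s) (tclass s') = tclass (tmulseq s s').
Proof.
apply/tclassP => V f fb; rewrite !tens_eval_mul //.
under eq_bigr => p _.
  rewrite -[\sum_(q <- _) _]/(tens_eval (fun a b => f (p.1 * a) (p.2 * b)) _).
  rewrite treprP; last exact: bilin_mull.
  over.
rewrite exchange_big [RHS]exchange_big /=; apply: eq_bigr => q _.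
rewrite -[LHS]/(tens_eval (fun a b => f (a * q.1) (b * q.2)) _).
by rewrite treprP //; exact: bilin_mulr.
Qed.

Lemma taddA : associative tadd.
Proof.
move=> x y z; rewrite -(treprK x) -(treprK y) -(treprK z) !taddE.
by rewrite catA.
Qed.
Lemma taddC : commutative tadd.
Proof.
move=> x y; rewrite -(treprK x) -(treprK y) !taddE.
by apply/tclassP => V f fb; rewrite !tens_eval_cat addrC.
Qed.
Lemma tadd0 : left_id (tclass [::]) tadd.
Proof. by move=> x; rewrite -(treprK x) !taddE. Qed.
Lemma taddN : left_inverse (tclass [::]) topp tadd.
Proof.
move=> x; rewrite -(treprK x) /topp tscaleE taddE.
apply/tclassP => V f fb; rewrite tens_eval_cat tens_eval_scale // scaleN1r.
by rewrite addNr /tens_eval big_nil.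
Qed.
HB.instance Definition _ := GRing.isZmodule.Build tens taddA taddC tadd0 taddN.

Lemma tmulA : associative tmul.
Proof.
move=> x y z; rewrite -(treprK x) -(treprK y) -(treprK z) !tmulE.
apply/tclassP => V f fb; rewrite /tens_eval !big_allpairs_dep /=.
apply: eq_bigr => p _; rewrite big_allpairs_dep; apply: eq_bigr => q _ /=.
by apply: eq_bigr => r _; rewrite !mulrA.
Qed.
Lemma tmul1l : left_id (tclass [:: (1, 1)]) tmul.
Proof.
move=> x; rewrite -(treprK x) tmulE; apply/tclassP => V f fb.
rewrite tens_eval_mul // big_seq1; apply: eq_bigr => p _.
by rewrite !mul1r.
Qed.
Lemma tmul1r : right_id (tclass [:: (1, 1)]) tmul.
Proof.
move=> x; rewrite -(treprK x) tmulE; apply/tclassP => V f fb.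
rewrite tens_eval_mul //; apply: eq_bigr => p _.
by rewrite big_seq1 !mulr1.
Qed.
Lemma tmulDl : left_distributive tmul +%R.
Proof.
move=> x y z; rewrite -(treprK x) -(treprK y) -(treprK z).
rewrite -![_ + _]/(tadd _ _) !(taddE, tmulE); apply/tclassP => V f fb.
by rewrite !(tens_eval_mul, tens_eval_cat) // big_cat.
Qed.
Lemma tmulDr : right_distributive tmul +%R.
Proof.
move=> x y z; rewrite -(treprK x) -(treprK y) -(treprK z).
rewrite -![_ + _]/(tadd _ _) !(taddE, tmulE); apply/tclassP => V f fb.
rewrite !(tens_eval_mul, tens_eval_cat) // -big_split /=.
by apply: eq_bigr => p _; rewrite big_cat.
Qed.

Lemma tone_neq0 : tclass [:: (1, 1)] != 0.
Proof.
have [h hlin h1] := functional_exists (oner_neq0 A).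
apply/eqP => /tclassP /(_ _ (fun (a : A) (b : B) => h a *: b)).
rewrite /tens_eval big_nil big_seq1 /= h1 scale1r => H.
suff : (1 : B) = 0 by apply/eqP/oner_neq0.
apply: H; split=> [b|a] c u v.
- by rewrite hlin scalerDl scalerA.
- by rewrite scalerDr !scalerA mulrC.
Qed.
HB.instance Definition _ := GRing.Zmodule_isNzRing.Build tens
  tmulA tmul1l tmul1r tmulDl tmulDr tone_neq0.

Lemma tscaleA a b x : tscale a (tscale b x) = tscale (a * b) x.
Proof.
rewrite -(treprK x) !tscaleE; apply/tclassP => V f fb.
by rewrite !tens_eval_scale // scalerA.
Qed.
Lemma tscale1 : left_id 1 tscale.
Proof.
move=> x; rewrite -(treprK x) tscaleE; apply/tclassP => V f fb.
by rewrite tens_eval_scale // scale1r.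
Qed.
Lemma tscaleDr : right_distributive tscale +%R.
Proof.
move=> a x y; rewrite -(treprK x) -(treprK y).
rewrite -![_ + _]/(tadd _ _) !(taddE, tscaleE); apply/tclassP => V f fb.
by rewrite !(tens_eval_scale, tens_eval_cat) // scalerDr.
Qed.
Lemma tscaleDl x : {morph tscale^~ x : a b / a + b}.
Proof.
move=> a b; rewrite -(treprK x) -![_ + _ in RHS]/(tadd _ _) !(taddE, tscaleE).
apply/tclassP => V f fb.
by rewrite !(tens_eval_scale, tens_eval_cat) // scalerDl.
Qed.
HB.instance Definition _ := GRing.Zmodule_isLmodule.Build k tens
  tscaleA tscale1 tscaleDr tscaleDl.

Lemma tscaleAl (a : k) (x y : tens) : a *: (x * y) = (a *: x) * y.
Proof.
rewrite -(treprK x) -(treprK y) -![_ * _]/(tmul _ _) -![_ *: _]/(tscale _ _).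
rewrite !(tmulE, tscaleE); apply/tclassP => V f fb.
rewrite tens_eval_scale // !tens_eval_mul // big_map scaler_sumr.
apply: eq_bigr => p _; rewrite scaler_sumr; apply: eq_bigr => q _ /=.
by rewrite -scalerAl bilinZl.
Qed.
HB.instance Definition _ := GRing.Lmodule_isLalgebra.Build k tens tscaleAl.

Lemma tscaleAr (a : k) (x y : tens) : a *: (x * y) = x * (a *: y).
Proof.
rewrite -(treprK x) -(treprK y) -![_ * _]/(tmul _ _) -![_ *: _]/(tscale _ _).
rewrite !(tmulE, tscaleE); apply/tclassP => V f fb.
rewrite tens_eval_scale // !tens_eval_mul // scaler_sumr.
apply: eq_bigr => p _; rewrite big_map scaler_sumr; apply: eq_bigr => q _ /=.
by rewrite -scalerAr bilinZl.
Qed.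
HB.instance Definition _ := GRing.Lalgebra_isAlgebra.Build k tens tscaleAr.

Definition ten (a : A) (b : B) : tens := tclass [:: (a, b)].

Lemma ten_bilinear : is_bilinear ten.
Proof.
split=> [b|a] c u v.
- rewrite -[_ + _ in RHS]/(tadd _ _) -[_ *: _ in RHS]/(tscale _ _).
  rewrite /ten tscaleE taddE; apply/tclassP => V f fb.
  rewrite tens_eval_cat tens_eval_scale // /tens_eval !big_seq1 /=.
  by rewrite bilinDl ?bilinZl.
- rewrite -[_ + _ in RHS]/(tadd _ _) -[_ *: _ in RHS]/(tscale _ _).
  rewrite /ten tscaleE taddE; apply/tclassP => V f fb.
  rewrite tens_eval_cat tens_eval_scale // /tens_eval !big_seq1 /=.
  by rewrite bilinDr ?bilinZr.
Qed.

Lemma tenM a a' b b' : ten a b * ten a' b' = ten (a * a') (b * b').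
Proof. by rewrite -[LHS]/(tmul _ _) tmulE. Qed.

Lemma ten1 : ten 1 1 = 1.
Proof. by []. Qed.

Lemma tens_span x : exists s : seq (A * B), x = \sum_(p <- s) ten p.1 p.2.
Proof.
exists (trepr x); rewrite -[LHS]treprK; elim: (trepr x) => [|p s IH].
  by rewrite big_nil.
rewrite big_cons -IH -[RHS]/(tadd _ _) taddE; congr tclass.
by case: p.
Qed.

Definition tens_lift (V : lmodType k) (f : A -> B -> V) (x : tens) : V :=
  tens_eval f (trepr x).

Lemma tens_liftE (V : lmodType k) (f : A -> B -> V) a b : is_bilinear f ->
  tens_lift f (ten a b) = f a b.
Proof. by move=> fb; rewrite /tens_lift treprP // /tens_eval big_seq1. Qed.

Lemma tens_lift_linear (V : lmodType k) (f : A -> B -> V) : is_bilinear f ->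
  linear (tens_lift f).
Proof.
move=> fb c x y; rewrite -(treprK x) -(treprK y).
rewrite -[_ + _ in LHS]/(tadd _ _) -[_ *: _ in LHS]/(tscale _ _).
rewrite tscaleE taddE /tens_lift !treprP // tens_eval_cat.
by rewrite tens_eval_scale.
Qed.

End Tensor.

HB.mixin Record isLie (k : fieldType) L of GRing.Lmodule k L := {
  lie : L -> L -> L;
  lie_linearl : forall y, linear (lie^~ y);
  lie_linearr : forall x, linear (lie x);
  liexx : forall x, lie x x = 0;
  lie_jacobi : forall x y z,
    lie x (lie y z) + lie y (lie z x) + lie z (lie x y) = 0
}.
#[short(type="lieAlgType")]
HB.structure Definition LieAlgebra (k : fieldType) :=
  {L of isLie k L & GRing.Lmodule k L}.

Section LieTheory.
Variables (k : fieldType) (L : lieAlgType k).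
Implicit Types x y z : L.

Lemma lieDl x x' y : lie (x + x') y = lie x y + lie x' y.
Proof. by have := lie_linearl y 1 x x'; rewrite !scale1r. Qed.
Lemma lieDr x y y' : lie x (y + y') = lie x y + lie x y'.
Proof. by have := lie_linearr x 1 y y'; rewrite !scale1r. Qed.
Lemma lieC x y : lie x y = - lie y x.
Proof.
apply/eqP; rewrite -addr_eq0; apply/eqP.
by have := liexx (x + y); rewrite lieDl !lieDr !liexx add0r addr0.
Qed.
Lemma lie0r x : lie x 0 = 0.
Proof. by apply: (addrI (lie x 0)); rewrite -lieDr !addr0. Qed.
Lemma lieZr c x y : lie x (c *: y) = c *: lie x y.
Proof. by have := lie_linearr x c y 0; rewrite !addr0 lie0r addr0. Qed.

Lemma lieNr x y : lie x (- y) = - lie x y.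
Proof. by rewrite -scaleN1r lieZr scaleN1r. Qed.
Lemma lieNl x y : lie (- x) y = - lie x y.
Proof. by rewrite lieC lieNr -lieC. Qed.

Record lieSubalg := LieSubalg {
  lsub_pred :> {pred L};
  lsub_submod : submod_closed lsub_pred;
  lsub_lie : {in lsub_pred &, forall x y, lie x y \in lsub_pred} }.

Record lieIdeal := LieIdeal {
  lid_pred :> {pred L};
  lid_submod : submod_closed lid_pred;
  lid_lie : forall x y, y \in lid_pred -> lie x y \in lid_pred }.

End LieTheory.

Section SubLie.
Variables (k : fieldType) (L : lieAlgType k) (S : lieSubalg L).

HB.instance Definition _ := GRing.isSubmodClosed.Build k L (lsub_pred S)
  (GRing.submod_closed_semi (lsub_submod S)).

Definition subLie : Type := {x : L | x \in lsub_pred S}.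
HB.instance Definition _ := SubType.on subLie.
HB.instance Definition _ := [Choice of subLie by <:].
HB.instance Definition _ := [SubChoice_isSubLmodule of subLie by <:].

Definition sub_lie (x y : subLie) : subLie :=
  Sub (lie (val x) (val y)) (lsub_lie (valP x) (valP y)).

Lemma sub_lie_linearl y : linear (sub_lie^~ y).
Proof.
move=> a u v; apply: val_inj; rewrite !(linearP, SubK) /=.
exact: lie_linearl.
Qed.
Lemma sub_lie_linearr x : linear (sub_lie x).
Proof.
move=> a u v; apply: val_inj; rewrite !(linearP, SubK) /=.
exact: lie_linearr.
Qed.
Lemma sub_liexx x : sub_lie x x = 0.
Proof. by apply: val_inj; rewrite SubK liexx raddf0. Qed.
Lemma sub_jacobi x y z :
  sub_lie x (sub_lie y z) + sub_lie y (sub_lie z x) + sub_lie z (sub_lie x y) = 0.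
Proof. by apply: val_inj; exact: (lie_jacobi (val x) (val y) (val z)). Qed.
HB.instance Definition _ := isLie.Build k subLie
  sub_lie_linearl sub_lie_linearr sub_liexx sub_jacobi.

End SubLie.

Section QuotLie.
Variables (k : fieldType) (L : lieAlgType k) (I : lieIdeal L).

HB.instance Definition _ := GRing.isSubmodClosed.Build k L (lid_pred I)
  (GRing.submod_closed_semi (lid_submod I)).

Definition quotLie : Type := Quotient.quot (lid_pred I).
HB.instance Definition _ := GRing.Zmodule.copy quotLie (Quotient.quot (lid_pred I)).

Definition qclass (x : L) : quotLie := \pi_(Quotient.quot (lid_pred I)) x.
Definition qrepr (x : quotLie) : L := repr (x : Quotient.quot (lid_pred I)).

Lemma qreprK x : qclass (qrepr x) = x.
Proof. exact: reprK. Qed.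

Lemma qclassP x y : qclass x = qclass y <-> x - y \in lid_pred I.
Proof.
rewrite Quotient.idealrBE.
by split=> [/eqP|/eqP].
Qed.

Lemma qclassD : {morph qclass : x y / x + y}.
Proof. by move=> x y; rewrite /qclass; exact: Quotient.pi_add. Qed.

Lemma qclass0 : qclass 0 = 0.
Proof. by apply: (addrI (qclass 0)); rewrite -qclassD !addr0. Qed.

Lemma lid_lier x y : x \in lid_pred I -> lie x y \in lid_pred I.
Proof. by move=> xI; rewrite lieC rpredN lid_lie. Qed.

Definition qscale (c : k) (x : quotLie) : quotLie := qclass (c *: qrepr x).
Definition qlie (x y : quotLie) : quotLie := qclass (lie (qrepr x) (qrepr y)).

Lemma qreprP x : qrepr (qclass x) - x \in lid_pred I.
Proof. by apply/qclassP; rewrite qreprK. Qed.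

Lemma qscaleE c x : qscale c (qclass x) = qclass (c *: x).
Proof. by apply/qclassP; rewrite -scalerBr rpredZ // qreprP. Qed.

Lemma qlieE x y : qlie (qclass x) (qclass y) = qclass (lie x y).
Proof.
apply/qclassP; set x' := qrepr _; set y' := qrepr _.
have -> : lie x' y' - lie x y = lie (x' - x) y' + lie x (y' - y).
  by rewrite lieDl lieNl lieDr lieNr addrA subrK.
by rewrite rpredD //; [apply/lid_lier/qreprP|apply/lid_lie/qreprP].
Qed.

Lemma qscaleA a b x : qscale a (qscale b x) = qscale (a * b) x.
Proof. by rewrite -(qreprK x) !qscaleE scalerA. Qed.
Lemma qscale1 : left_id 1 qscale.
Proof. by move=> x; rewrite -(qreprK x) qscaleE scale1r. Qed.
Lemma qscaleDr : right_distributive qscale +%R.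
Proof.
move=> a x y; rewrite -(qreprK x) -(qreprK y).
by rewrite -qclassD !qscaleE -qclassD scalerDr.
Qed.
Lemma qscaleDl x : {morph qscale^~ x : a b / a + b}.
Proof.
by move=> a b; rewrite -(qreprK x) !qscaleE -qclassD scalerDl.
Qed.
HB.instance Definition _ := GRing.Zmodule_isLmodule.Build k quotLie
  qscaleA qscale1 qscaleDr qscaleDl.

Lemma qclass_linear : linear qclass.
Proof. by move=> a x y; rewrite qclassD -qscaleE. Qed.

Lemma qlie_linearl y : linear (qlie^~ y).
Proof.
move=> a u v; rewrite -(qreprK y) -(qreprK u) -(qreprK v).
rewrite -![_ *: _]/(qscale _ _) qscaleE -qclassD !qlieE.
by rewrite lie_linearl qclass_linear.
Qed.
Lemma qlie_linearr x : linear (qlie x).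
Proof.
move=> a u v; rewrite -(qreprK x) -(qreprK u) -(qreprK v).
rewrite -![_ *: _]/(qscale _ _) qscaleE -qclassD !qlieE.
by rewrite lie_linearr qclass_linear.
Qed.
Lemma qliexx x : qlie x x = 0.
Proof. by rewrite -(qreprK x) qlieE liexx qclass0. Qed.
Lemma qjacobi x y z :
  qlie x (qlie y z) + qlie y (qlie z x) + qlie z (qlie x y) = 0.
Proof.
rewrite -(qreprK x) -(qreprK y) -(qreprK z) !qlieE -!qclassD.
by rewrite lie_jacobi qclass0.
Qed.
HB.instance Definition _ := isLie.Build k quotLie
  qlie_linearl qlie_linearr qliexx qjacobi.

End QuotLie.

Section Enveloping.
Variables (k : fieldType) (L : lieAlgType k).

Inductive env_rel : aterm k L -> aterm k L -> Prop :=
  | env_add x y : env_rel (AGen k (x + y)) (AAdd (AGen k x) (AGen k y))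
  | env_scale c x : env_rel (AGen k (c *: x)) (AMul (ACst L c) (AGen k x))
  | env_lie x y : env_rel (AGen k (lie x y))
      (ASub (AMul (AGen k x) (AGen k y)) (AMul (AGen k y) (AGen k x))).

Lemma env_consistent : ~ acong env_rel (ACst L 1) (ACst L 0).
Proof.
apply: (@aact_consistent _ _ _ (k^o) (fun _ _ => 0) 1 (oner_neq0 k)).
  by move=> x a u v; rewrite scaler0 addr0.
by move=> t u [] * /=; rewrite ?addr0 ?scaler0 ?addr0.
Qed.

Definition env_pres := Presentation env_consistent.

Definition env : Type := palg env_pres.
HB.instance Definition _ := GRing.Algebra.copy env (palg env_pres).

Definition env_in (x : L) : env := pgen env_pres x.

Lemma env_in_linear : linear env_in.
Proof.
move=> a x y; rewrite /env_in.
have /= -> := pgen_rel (P := env_pres) (env_add (a *: x) y).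
have /= -> := pgen_rel (P := env_pres) (env_scale a x).
by rewrite mulr_algl.
Qed.

Lemma env_in_lie x y :
  env_in (lie x y) = env_in x * env_in y - env_in y * env_in x.
Proof.
rewrite /env_in; have /= -> := pgen_rel (P := env_pres) (env_lie x y).
by rewrite scaleN1r mulN1r.
Qed.

Section Lift.
Variables (A : algType k) (f : L -> A).
Hypothesis flin : linear f.
Hypothesis flie : forall x y, f (lie x y) = f x * f y - f y * f x.

Lemma env_lift_rel t u : env_rel t u -> aeval f t = aeval f u.
Proof.
case=> [x y|c x|x y] /=.
- by have := flin 1 x y; rewrite !scale1r.
- rewrite mulr_algl; have := flin c x 0.
  have f0 : f 0 = 0.
    by have := flin (-1) 0 0; rewrite !scaleN1r oppr0 addr0 addNr.
  by rewrite f0 !addr0.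
- by rewrite flie scaleN1r mulN1r.
Qed.

Definition env_lift : {lrmorphism env -> A} :=
  palg_lift (P := env_pres) env_lift_rel.

Lemma env_liftE x : env_lift (env_in x) = f x.
Proof. exact: (plift_gen (P := env_pres) env_lift_rel). Qed.

End Lift.

Lemma env_lift_unique (A : algType k) (f f' : {lrmorphism env -> A}) :
  (forall x, f (env_in x) = f' (env_in x)) -> f =1 f'.
Proof. exact: palg_lift_unique. Qed.

End Enveloping.

Section Weyl.
Variable k : fieldType.

Inductive weyl_gen := GenT | GenD.

Inductive weyl_rel : aterm k weyl_gen -> aterm k weyl_gen -> Prop :=
  | weyl_comm : weyl_rel
      (ASub (AMul (AGen k GenD) (AGen k GenT)) (AMul (AGen k GenT) (AGen k GenD)))
      (ACst weyl_gen 1).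

Lemma weyl_consistent :
  ~ acong weyl_rel (ACst weyl_gen 1) (ACst weyl_gen 0).
Proof.
apply: (@aact_consistent _ _ _ {poly k}
  (fun x p => if x is GenT then 'X * p else p^`()) 1 (oner_neq0 _)).
  case=> a p q; first by rewrite mulrDr scalerAr.
  exact: linearP.
move=> t u [] p /=.
by rewrite scale1r scaleN1r derivM derivX mul1r addrK.
Qed.

Definition weyl_pres := Presentation weyl_consistent.

Definition weyl : Type := palg weyl_pres.
HB.instance Definition _ := GRing.Algebra.copy weyl (palg weyl_pres).

Definition weyl_t : weyl := pgen weyl_pres GenT.
Definition weyl_d : weyl := pgen weyl_pres GenD.

Lemma weyl_comm_td : weyl_d * weyl_t - weyl_t * weyl_d = 1.
Proof.
have /= := pgen_rel (P := weyl_pres) weyl_comm.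
by rewrite scale1r scaleN1r mulN1r.
Qed.

Definition weyl_poly (f : {poly k}) : weyl := horner_alg weyl_t f.

HB.instance Definition _ := GRing.RMorphism.copy weyl_poly (horner_alg weyl_t).

Lemma weyl_poly_scalable : scalable weyl_poly.
Proof.
move=> c f; rewrite -mul_polyC rmorphM /= {1}/weyl_poly horner_algC.
by rewrite mulr_algl.
Qed.
HB.instance Definition _ :=
  GRing.isScalable.Build k {poly k} weyl *:%R weyl_poly weyl_poly_scalable.


End Weyl.

Section Witt.
Variable k : fieldType.

(* W_{>= -1} = k[t]d/dt; the polynomial f stands for the vector field f d/dt. *)
Definition witt : Type := {poly k}.
HB.instance Definition _ := GRing.Lmodule.copy witt {poly k}.

Definition witt_lie (f g : witt) : witt :=
  (f : {poly k}) * (g : {poly k})^`() - (f : {poly k})^`() * (g : {poly k}).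

Lemma witt_linearl (g : witt) : linear (witt_lie^~ g).
Proof.
move=> a u v; rewrite /witt_lie linearP /= !mulrDl -!scalerAl scalerBr.
by rewrite opprD addrACA.
Qed.
Lemma witt_linearr (f : witt) : linear (witt_lie f).
Proof.
move=> a u v; rewrite /witt_lie linearP /= !mulrDr -!scalerAr scalerBr.
by rewrite opprD addrACA.
Qed.
Lemma witt_liexx (f : witt) : witt_lie f f = 0.
Proof. by rewrite /witt_lie mulrC subrr. Qed.
Lemma witt_jacobi (f g h : witt) : witt_lie f (witt_lie g h) +
  witt_lie g (witt_lie h f) + witt_lie h (witt_lie f g) = 0.
Proof.
rewrite /witt_lie !derivB !derivM.
move: (f : {poly k}) (g : {poly k}) (h : {poly k}) => {f g h} f g h.
have -> : (0 : witt) = (0 : {poly k}) by [].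
change (@GRing.add witt) with (@GRing.add {poly k}).
ring.
Qed.
HB.instance Definition _ := isLie.Build k witt
  witt_linearl witt_linearr witt_liexx witt_jacobi.

Definition witt_e (i : nat) : witt := 'X^(i.+1).

(* W_{>= n} for n >= 0 *)
Definition witt_ge (n : nat) : {pred witt} :=
  [pred f | `[< lin_span [set witt_e i | i in [set i | (n <= i)%N]] f >]].

Lemma witt_geP n (f : witt) :
  reflect (forall j, (j <= n)%N -> (f : {poly k})`_j = 0) (f \in witt_ge n).
Proof.
apply: (iffP idP) => [/asboolP|f0]; last apply/asboolP.
  move: f; apply: lin_span_min.
  - by move=> j _; rewrite coef0.
  - by move=> a u v hu hv j jn; rewrite coefD coefZ hu // hv // mulr0 addr0.
  - move=> _ [i /= ni <-] j jn; rewrite coefXn; case: eqP => // e.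
    by move: jn; rewrite e ltnNge ni.
exists [seq ((f : {poly k})`_i.+1, witt_e i) | i <- iota n (size (f : {poly k}))].
  move=> p /mapP[i]; rewrite mem_iota => /andP[ni _] -> /=.
  by exists i.
rewrite big_map; apply/polyP => j; rewrite coef_sum.
have [jn|nj] := leqP j n.
  rewrite f0 // big1_seq // => i; rewrite mem_iota => /andP[_ /andP[ni _]] /=.
  rewrite coefZ coefXn; case: eqP => [e|_]; last by rewrite mulr0.
  by move: jn; rewrite e ltnNge ni.
case: j nj => // j; rewrite ltnS => nj.
have [jlt|jge] := ltnP j (n + size (f : {poly k})); last first.
  rewrite nth_default ?(leq_trans _ (leqW jge)) ?leq_addl //.
  rewrite big1_seq // => i; rewrite mem_iota => /andP[_ /andP[ni il]] /=.
  rewrite coefZ coefXn eqSS; case: eqP => [e|_]; last by rewrite mulr0.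
  by move: il; rewrite -e ltnNge jge.
rewrite (bigD1_seq j) ?iota_uniq ?mem_iota ?nj ?jlt //=.
rewrite coefZ coefXn eqxx mulr1 big1 ?addr0 // => i ij.
by rewrite coefZ coefXn eqSS eq_sym (negPf ij) mulr0.
Qed.

Lemma witt_ge_submod n : submod_closed (witt_ge n).
Proof. exact: lin_span_submod. Qed.

Lemma witt_lie_ge n (f g : witt) :
  f \in witt_ge 0 -> g \in witt_ge n -> lie f g \in witt_ge n.
Proof.
move=> /witt_geP f0 /witt_geP g0; apply/witt_geP => j jn.
rewrite -[lie f g]/(witt_lie f g) /witt_lie coefB !coefM.
rewrite !big1 ?subr0 // => -[i /= ij] _.
  by rewrite (g0 (j - i)%N) ?mulr0 // (leq_trans (leq_subr _ _)).
rewrite ltnS in ij; case: i ij => [|i] ij; first by rewrite f0 // mul0r.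
rewrite coef_deriv g0 ?mul0rn ?mulr0 //.
by rewrite -subSn // subSS (leq_trans (leq_subr _ _)).
Qed.

Definition witt0_subalg : lieSubalg witt :=
  LieSubalg (witt_ge_submod 0) (@witt_lie_ge 0).

Definition witt0 : lieAlgType k := subLie witt0_subalg.

Definition witt0_ge (n : nat) : {pred witt0} := [pred f | val f \in witt_ge n].

Lemma witt0_ge_submod n : submod_closed (witt0_ge n).
Proof.
have [h0 hl] := witt_ge_submod n; split=> [|a u v hu hv]; first exact: h0.
exact: hl.
Qed.

Lemma witt0_ge_lie n (f g : witt0) : g \in witt0_ge n -> lie f g \in witt0_ge n.
Proof. by move=> gn; apply: witt_lie_ge gn; exact: valP. Qed.

Definition witt0_ideal n : lieIdeal witt0 :=
  LieIdeal (witt0_ge_submod n) (@witt0_ge_lie n).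

Definition gn (n : nat) : lieAlgType k := quotLie (witt0_ideal n).

Lemma witt_e_ge0 i : witt_e i \in witt_ge 0.
Proof. by apply/witt_geP => -[|//] _; rewrite coefXn. Qed.

Definition gn_v (n i : nat) : gn n :=
  qclass (witt0_ideal n) (Sub (witt_e i) (witt_e_ge0 i)).

Lemma gn_v0 n i : (n <= i)%N -> gn_v n i = 0.
Proof.
move=> ni; rewrite /gn_v -(qclass0 (witt0_ideal n)); apply/qclassP.
rewrite subr0; apply/witt_geP => j jn; rewrite SubK coefXn.
by case: eqP => // e; move: jn; rewrite e ltnNge ni.
Qed.

Lemma gn_vlie n i j :
  lie (gn_v n i) (gn_v n j) = (j%:R - i%:R) *: gn_v n (i + j).
Proof.
rewrite -[LHS]/(qlie _ _) qlieE -[RHS]/(qscale _ _) qscaleE.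
congr qclass; apply: val_inj.
rewrite -[LHS]/(witt_lie (witt_e i) (witt_e j)) /witt_lie /witt_e.
rewrite -[RHS]/((j%:R - i%:R) *: 'X^((i + j).+1) : {poly k}) !derivXn /=.
rewrite mulrnAr mulrnAl -!exprD addSn addnS scalerBl !scaler_nat !mulrS.
by rewrite opprD addrACA subrr add0r.
Qed.

End Witt.

Section WeylPoly.
Variable k : fieldType.

Lemma weyl_polyM (f g : {poly k}) : weyl_poly (f * g) = weyl_poly f * weyl_poly g.
Proof. exact: rmorphM. Qed.

Lemma weyl_polyC (f g : {poly k}) :
  weyl_poly f * weyl_poly g = weyl_poly g * weyl_poly f.
Proof. by rewrite -!weyl_polyM mulrC. Qed.

Lemma weyl_poly_linear : linear (@weyl_poly k).
Proof. exact: linearP. Qed.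

Lemma weyl_d_poly (f : {poly k}) :
  weyl_d k * weyl_poly f = weyl_poly f * weyl_d k + weyl_poly f^`().
Proof.
have wX : weyl_poly 'X = weyl_t k by rewrite /weyl_poly horner_algX.
have wC (c : k) : weyl_poly c%:P = c%:A by rewrite /weyl_poly horner_algC.
have dt : weyl_d k * weyl_t k = weyl_t k * weyl_d k + 1.
  by rewrite -weyl_comm_td addrC subrK.
have wD (p q : {poly k}) : weyl_poly (p + q) = weyl_poly p + weyl_poly q.
  exact: rmorphD.
elim/poly_ind: f => [|f c IH].
  by rewrite deriv0 !rmorph0 mulr0 mul0r addr0.
rewrite derivMXaddC !wD !weyl_polyM wX wC.
rewrite mulrDr mulr_algr mulrA IH !mulrDl mulr_algl.
rewrite -(mulrA (weyl_poly f)) dt mulrDr mulr1 !mulrA.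
by rewrite -!addrA; congr (_ + _); rewrite [RHS]addrC addrA.
Qed.

End WeylPoly.

Section NDeriv.
Variable k : fieldType.
Implicit Types p q f g : {poly k}.

Lemma nderivnMX m p : (p * 'X)^`N(m.+1) = p^`N(m) + p^`N(m.+1) * 'X.
Proof. by have := nderivnMXaddC m p 0; rewrite addr0. Qed.

Lemma nderivnM m f g :
  (f * g)^`N(m) = \sum_(i < m.+1) f^`N(i) * g^`N(m - i).
Proof.
elim/poly_ind: f m => [|f c IH] m.
  rewrite mul0r linear0 big1 // => i _.
  by rewrite linear0 mul0r.
rewrite mulrDl mulrAC linearD /= mul_polyC linearZ /=.
case: m => [|m].
  rewrite big_ord1 !nderivn0 mulrDl mulrAC.
  by rewrite mul_polyC.
have E0 : (f * 'X + c%:P)^`N(0) = f * 'X + c%:P by rewrite nderivn0.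
rewrite nderivnMX !IH [in RHS]big_ord_recl /= E0 subn0.
rewrite [X in _ + X * _]big_ord_recl nderivn0 subn0 /=.
under [in RHS]eq_bigr => i _.
  rewrite /bump leq0n add1n nderivnMXaddC subSS mulrDl [_ * 'X * _]mulrAC.
  over.
under [X in _ + (_ + X) * _]eq_bigr => i _ do rewrite /bump leq0n add1n subSS.
rewrite big_split /= -mulr_suml -mul_polyC.
ring.
Qed.

Lemma nderivn_deriv m g : (g^`())^`N(m) = g^`N(m.+1) *+ m.+1.
Proof.
apply/polyP => i; rewrite coefMn !coef_nderivn coef_deriv addSn -!mulrnA.
by congr (_ *+ _); rewrite [RHS]mulnC -mul_bin_diag.
Qed.

Lemma deriv_nderivn m g : (g^`N(m))^`() = g^`N(m.+1) *+ m.+1.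
Proof.
apply/polyP => i; rewrite coefMn coef_deriv !coef_nderivn addSn addnS -!mulrnA.
congr (_ *+ _); rewrite [RHS]mulnC mul_bin_left mulnC; congr (_ * _)%N.
by rewrite subSn ?leq_addr // addKn.
Qed.

Lemma nderivn_witt m f g : (f * g^`() - f^`() * g)^`N(m.+1) =
  f * (g^`N(m.+1))^`() - (f^`N(m.+1))^`() * g +
  \sum_(i < m.+1) ((m - i)%:R - i%:R) *: (f^`N(i.+1) * g^`N((m - i).+1)).
Proof.
rewrite linearB /= !nderivnM big_ord_recl /= nderivn0 subn0.
rewrite [in X in _ - X]big_ord_recr /= subnn nderivn0.
rewrite !nderivn_deriv !deriv_nderivn.
set S3 := \sum_(i < _) _ *: _; set S1 := \sum_(i < _) _; set S2 := \sum_(i < _) _.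
have -> : S3 = S1 - S2.
  rewrite /S1 /S2 /S3 -sumrB; apply: eq_bigr => i _.
  have im : (i <= m)%N by rewrite -ltnS.
  rewrite /bump leq0n add1n subSS !nderivn_deriv subSn //.
  rewrite mulrnAr mulrnAl scalerBl !scaler_nat !mulrS opprD addrACA subrr.
  by rewrite add0r.
move: (f^`N(m.+2) *+ m.+2) (g^`N(m.+2) *+ m.+2) S1 S2 => A B x y.
by rewrite [y + _]addrC opprD addrACA.
Qed.

Lemma nderivn_fact m f :
  [pchar k] =i pred0 -> f^`N(m) = (m`!)%:R^-1 *: f^`(m).
Proof.
move=> char0; rewrite nderivn_def -scaler_nat scalerA mulVf ?scale1r //.
by move/pcharf0P: char0 => ->; rewrite -lt0n fact_gt0.
Qed.

End NDeriv.

Section Orbit.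
Variables (k : fieldType) (n : nat).

Definition orbit_target : algType k := tens (weyl k) (env (gn k n)).

(* In characteristic 0, f^`N(i.+1) is f^(i+1) / (i+1)!: see nderivn_fact. *)
Definition orbit_fun (f : witt k) : orbit_target :=
  ten (weyl_poly f * weyl_d k) 1 +
  \sum_(i < n) ten (weyl_poly ((f : {poly k})^`N(i.+1))) (env_in (gn_v k n i)).

Lemma orbit_fun_linear : linear orbit_fun.
Proof.
move=> c f g; rewrite /orbit_fun linearP /= mulrDl -scalerAl.
rewrite (ten_bilinear _ _).1 scalerDr -addrACA; congr (_ + _).
rewrite scaler_sumr -big_split /=; apply: eq_bigr => i _.
by rewrite !linearP /= (ten_bilinear _ _).1.
Qed.

Let w (p : {poly k}) : orbit_target := ten (weyl_poly p) 1.
Let d : orbit_target := ten (weyl_d k) 1.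
Let V (i : nat) : orbit_target := ten 1 (env_in (gn_v k n i)).
Let D (m : nat) (f : {poly k}) : {poly k} := f^`N(m).

Let wD p q : w (p + q) = w p + w q.
Proof.
by have := (ten_bilinear (weyl k) (env (gn k n))).1 1 1 (weyl_poly p)
   (weyl_poly q); rewrite !scale1r -rmorphD.
Qed.
Let wM p q : w (p * q) = w p * w q.
Proof. by rewrite /w tenM mul1r rmorphM. Qed.
Let wC p q : w p * w q = w q * w p.
Proof. by rewrite -!wM mulrC. Qed.
Let dw p : d * w p = w p * d + w p^`().
Proof.
rewrite /d /w !tenM !mul1r weyl_d_poly.
by have := (ten_bilinear (weyl k) (env (gn k n))).1 1 1
  (weyl_poly p * weyl_d k) (weyl_poly p^`()); rewrite !scale1r.
Qed.
Let wV p i : w p * V i = V i * w p.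
Proof. by rewrite /w /V !tenM !mul1r !mulr1. Qed.
Let dV i : d * V i = V i * d.
Proof. by rewrite /d /V !tenM !mul1r !mulr1. Qed.
Let V0 i : (n <= i)%N -> V i = 0.
Proof.
move=> ni; rewrite /V gn_v0 //.
have -> : env_in (0 : gn k n) = 0.
  have := @env_in_linear _ (gn k n) (-1) 0 0.
  by rewrite !scaleN1r oppr0 addr0 addNr.
exact: bilin0r (ten_bilinear _ _) _.
Qed.
Let VV i j : V i * V j - V j * V i = (j%:R - i%:R) *: V (i + j).
Proof.
have T := ten_bilinear (weyl k) (env (gn k n)).
rewrite /V !tenM mul1r -(bilinZr T) -scaleN1r -(bilinZr T) -(bilinDr T).
congr ten; rewrite scaleN1r -env_in_lie gn_vlie.
have := @env_in_linear _ (gn k n) (j%:R - i%:R) (gn_v k n (i + j)) 0.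
have -> : env_in (0 : gn k n) = 0.
  have := @env_in_linear _ (gn k n) (-1) 0 0.
  by rewrite !scaleN1r oppr0 addr0 addNr.
by rewrite !addr0.
Qed.

Let triangular (F : nat -> nat -> orbit_target) :
  (forall i j, (n <= i + j)%N -> F i j = 0) ->
  \sum_(i < n) \sum_(j < n) F i j =
  \sum_(m < n) \sum_(i < m.+1) F i (m - i)%N.
Proof.
move=> F0.
have -> : \sum_(i < n) \sum_(j < n) F i j =
          \sum_(0 <= i < n) \sum_(i <= m < n) F i (m - i)%N.
  rewrite big_mkord; apply: eq_bigr => i _.
  rewrite -[X in bigop.index_iota X]add0n.
  rewrite (big_addn 0 n i) -(big_mkord xpredT (fun j => F i j)).
  rewrite (@big_cat_nat _ _ _ (n - i)) ?leq_subr //=.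
  rewrite [X in _ + X]big_nat_cond [X in _ + X]big1 ?addr0.
    by apply: eq_bigr => j _; rewrite addnK.
  by move=> j /andP[/andP[nij _] _]; rewrite F0 // -leq_subLR.
rewrite big_mkord.
under eq_bigr => i _ do rewrite big_geq_mkord.
rewrite (exchange_big_dep xpredT) //=; apply: eq_bigr => m _.
by rewrite (big_ord_widen n (fun i => F i (m - i)%N)).
Qed.

Lemma orbit_fun_lie f g :
  orbit_fun (lie f g) =
  orbit_fun f * orbit_fun g - orbit_fun g * orbit_fun f.
Proof.
have E h : orbit_fun h = w h * d + \sum_(i < n) w (D i.+1 h) * V i.
  rewrite /orbit_fun /w /d /V tenM mul1r; congr (_ + _).
  by apply: eq_bigr => i _; rewrite tenM mul1r mulr1.
have cdd p q : w p * d * (w q * d) = w p * w q * d * d + w p * w q^`() * d.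
  by rewrite -mulrA (mulrA d) dw mulrDl mulrDr !mulrA.
have cdV p q i : w p * d * (w q * V i) =
    w q * V i * (w p * d) + w p * w q^`() * V i.
  rewrite -mulrA (mulrA d) dw mulrDl mulrDr !mulrA; congr (_ + _).
  rewrite -[w q * V i * w p]mulrA -wV mulrA -[w q * w p * V i * d]mulrA.
  by rewrite -dV !mulrA (wC q).
have cVV p q i j : w p * V i * (w q * V j) - w q * V j * (w p * V i) =
    w p * w q * ((j%:R - i%:R) *: V (i + j)).
  rewrite -VV mulrBr !mulrA -[w p * V i * w q]mulrA -wV.
  by rewrite -[w q * V j * w p]mulrA -wV !mulrA (wC q).
have wl : linear w.
  move=> c p q; rewrite /w linearP /=.
  exact: (ten_bilinear (weyl k) (env (gn k n))).1.
have w0 : w 0 = 0.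
  by have := wl (-1) 0 0; rewrite !scaleN1r oppr0 addr0 addNr.
have wZ c p : w (c *: p) = c *: w p by have := wl c p 0; rewrite w0 !addr0.
have wB p q : w (p - q) = w p - w q by rewrite wD -scaleN1r wZ scaleN1r.
have wsum (m : nat) (F : 'I_m -> {poly k}) :
    w (\sum_(i < m) F i) = \sum_(i < m) w (F i).
  exact: (big_morph w wD w0).
have aux (a b c e a' b' c' e' : orbit_target) :
    a + b + (c + e) - (a' + b' + (c' + e')) =
    (a - a') + ((b - c') - (b' - c) + (e - e')).
  have sub (x y z t : orbit_target) : x + y - (z + t) = (x - z) + (y - t).
    by rewrite opprD addrACA.
  by rewrite !sub opprK [- c' + c]addrC !addrA.
rewrite !E !mulrDl !mulrDr aux.
have -> : w f * d * (w g * d) - w g * d * (w f * d) = w (lie f g) * d.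
  rewrite !cdd (wC g f) opprD addrACA subrr add0r -mulrBl -!wM -wB.
  by rewrite [g * _]mulrC.
congr (_ + _).
have cS p (q : nat -> {poly k}) :
    w p * d * (\sum_(i < n) w (q i) * V i) -
    (\sum_(i < n) w (q i) * V i) * (w p * d) =
    \sum_(i < n) w (p * (q i)^`()) * V i.
  rewrite mulr_sumr mulr_suml -sumrB; apply: eq_bigr => i _.
  by rewrite cdV addrC addrA addNr add0r wM.
rewrite (cS f (fun i => D i.+1 g)) (cS g (fun i => D i.+1 f)).
have -> : (\sum_(i < n) w (D i.+1 f) * V i) * (\sum_(i < n) w (D i.+1 g) * V i) -
  (\sum_(i < n) w (D i.+1 g) * V i) * (\sum_(i < n) w (D i.+1 f) * V i) =
  \sum_(i < n) \sum_(j < n)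
    w (D i.+1 f) * w (D j.+1 g) * ((j%:R - i%:R) *: V (i + j)).
  rewrite mulr_suml [X in _ - X]mulr_sumr -sumrB; apply: eq_bigr => i _.
  rewrite mulr_sumr mulr_suml -sumrB; apply: eq_bigr => j _.
  exact: cVV.
rewrite (triangular (F := fun i j =>
  w (D i.+1 f) * w (D j.+1 g) * ((j%:R - i%:R) *: V (i + j)))); last first.
  by move=> i j nij; rewrite V0 // scaler0 mulr0.
rewrite -sumrB -big_split /=; apply: eq_bigr => m _.
rewrite -[lie f g]/(f * g^`() - f^`() * g : {poly k}) {1}/D nderivn_witt.
rewrite wD wB wsum mulrDl mulrBl [g * _]mulrC; congr (_ + _).
rewrite mulr_suml; apply: eq_bigr => i _.
by rewrite wZ wM subnKC -?scalerAr -?scalerAl // -ltnS.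
Qed.

Definition orbit_hom : {lrmorphism env (witt k) -> orbit_target} :=
  env_lift orbit_fun_linear orbit_fun_lie.

Lemma orbit_homE f : orbit_hom (env_in f) = orbit_fun f.
Proof. exact: env_liftE. Qed.

Definition orbit_image : algType k := image_alg orbit_hom.

End Orbit.

(* Main.v *)
Require Import Defs.
From HB Require Import structures.
From mathcomp Require Import all_boot all_order all_algebra.
From mathcomp Require Import boolp classical_sets reals ereal.
From mathcomp Require Import topology normedtype sequences exp.
From mathcomp Require Import ring zify.
From mathcomp Require Import -(notations) mpoly.

Set Implicit Arguments.
Unset Strict Implicit.
Unset Printing Implicit Defensive.

Import Order.TTheory GRing.Theory Num.Theory.

Local Open Scope ring_scope.

(** Everything is read off the filtration of T_n by degree in the n + 2
    generators t, d, v_0, ..., v_(n-1).  These commute up to terms of degree at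
    most one, so reordering a product only costs terms of lower degree
    ([word_perm], [orderedM]); once the ordered monomials are known to be
    independent ([tgen_pbw]), the associated graded algebra is a polynomial
    ring in n + 2 variables.  Independence is tested on modules: the Weyl
    algebra acts on k[t], and the Lie algebra g_n acts on the coordinate ring
    of (n-jets of) reparametrizations by vector fields that are, at the
    identity jet, the partial derivatives up to sign ([jet_fields_const]).

    Three things follow formally for T_n and for any subalgebra B.  Leading
    forms multiply, so T_n is a domain.  A domain of polynomial growth is an
    Ore domain, since two nonzero principal one-sided ideals with zero
    intersection would force exponential growth ([pbw_images_meet]).  Finally
    GKdim B <= n + 2, with equality as soon as the generators of T_n have a
    common denominator b in B: the products of M factors b or b g_i have
    symbols beta^M x^m, where beta is the symbol of b, and are therefore
    independent for distinct monomials x^m of degree at most M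
    ([bword_indep]).

    What has to be proved about B_n is thus that T_n consists of left and of
    right fractions of B_n.  Regard the product Psi (f d) Psi (g d) as a
    bidifferential operator in f(x) g(y), restricted to the diagonal x = y, of
    order at most n in each of f and g (n + 1 in g for the term where d
    differentiates it).  Replacing f(x) g(y) by u(x) (x - y)^(2n) keeps the
    terms of total order 2n only, whence an element z, a nonzero multiple of
    v_(n-1)^2 (plus a multiple of v_0 if n = 1), with u(t) z in B_n for every
    polynomial u ([denominator]).  So t = (t z) z^-1 is a fraction, and then so
    is every v_i by triangularity of the formula for Psi
    ([image_generates]).

    For the failure of the chain condition, let T_n act on
    k[t] (x) k[eps]/(eps^2) with v_0 acting as eps and the other v_i as zero.
    Then Psi (f d) = f d + f' eps kills 1 modulo eps, so elements of B_n map 1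
    to a constant modulo eps.  Among the elements of B_n acting as eps times
    an operator on k[t], those that send 1 into a given subspace hence form a
    right ideal, and the previous construction with (x - y)^2 produces
    multiplication by 2 u eps for all u: the right ideals obtained from
    polynomials of bounded degree increase strictly ([eps_ideal_strict]). *)

Local Notation msize p := (mmeasure mdeg p).

(** * Linear independence *)

Section LinearAlgebra.
Variables (k : fieldType) (V : lmodType k).

Lemma lin_spanD (S : set V) u v : lin_span S u -> lin_span S v -> lin_span S (u + v).
Proof. by move=> Su Sv; rewrite -[u]scale1r; exact: lin_spanP. Qed.

Lemma lin_spanZ (S : set V) a u : lin_span S u -> lin_span S (a *: u).
Proof.
by move=> Su; rewrite -[_ *: _]addr0; apply: lin_spanP => //; exact: lin_span0.
Qed.

Lemma lin_span_sum (S : set V) I (r : seq I) (P : pred I) (F : I -> V) :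
  (forall i, P i -> lin_span S (F i)) -> lin_span S (\sum_(i <- r | P i) F i).
Proof.
move=> SF; elim/big_ind: _ => //; first exact: lin_span0.
by move=> u v; exact: lin_spanD.
Qed.

Lemma sub_lin_span (S S' : set V) : (S `<=` S')%classic ->
  (lin_span S `<=` lin_span S')%classic.
Proof. by move=> SS' v [s Ss ->]; exists s => // p /Ss /SS'. Qed.

(** Coefficients indexed by natural numbers are easier to split over a
    concatenation than those indexed by ordinals. *)
Lemma lin_indepP (s : seq V) : lin_indep s <->
  forall c : nat -> k, \sum_(i < size s) c i *: s`_i = 0 ->
    forall i, (i < size s)%N -> c i = 0.
Proof.
split=> [h c c0 i il|h c c0 i].
  exact: (h (fun i => c i) c0 (Ordinal il)).
pose d j := if insub j is Some i' then c i' else 0.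
have dE (j : 'I_(size s)) : d j = c j by rewrite /d valK.
rewrite -dE; apply: h => //; rewrite -[RHS]c0.
by apply: eq_bigr => j _; rewrite dE.
Qed.

Lemma indep_size_leq_card (I : finType) (e : I -> V) (s : seq V) :
  lin_indep s ->
  (forall v, v \in s -> exists c : I -> k, v = \sum_i c i *: e i) ->
  (size s <= #|I|)%N.
Proof.
move=> sI se; rewrite leqNgt; apply/negP => sz.
have /choice[c cE] : forall j : 'I_(size s), exists c : I -> k,
    s`_j = \sum_i c i *: e i by move=> j; apply: se; exact: mem_nth.
pose M : 'M[k]_(size s, #|I|) := \matrix_(j, i) c j (enum_val i).
have /rowV0Pn[v vM v0] : kermx M != 0.
  rewrite -mxrank_eq0 mxrank_ker -lt0n subn_gt0.
  exact: leq_ltn_trans (rank_leq_col _) sz.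
have v00 : forall j, v 0 j = 0.
  apply: sI; under eq_bigr => j _ do rewrite cE scaler_sumr.
  rewrite exchange_big big1 // => i _.
  under eq_bigr => j _ do rewrite scalerA.
  rewrite -scaler_suml; have /matrixP/(_ 0 (enum_rank i)) := sub_kermxP vM.
  rewrite !mxE => vMi; under eq_bigr => j _.
    rewrite (_ : c j i = M j (enum_rank i)); last by rewrite mxE enum_rankK.
    over.
  by rewrite vMi scale0r.
by case/eqP: v0; apply/rowP => j; rewrite v00 mxE.
Qed.

(** The doubling step in the growth argument for the Ore condition. *)
Lemma indep_double (s : seq V) (phi psi : V -> V) (P : V -> Prop) :
  linear phi -> linear psi ->
  P 0 -> (forall a u v, P u -> P v -> P (a *: u + v)) ->
  (forall x y, P x -> P y -> phi x = psi y -> x = 0 /\ y = 0) ->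
  (forall v, v \in s -> P v) ->
  lin_indep s -> lin_indep (map phi s ++ map psi s).
Proof.
move=> phil psil P0 Pl disj sP /lin_indepP sI; apply/lin_indepP => c.
have lin0 (f : V -> V) : linear f -> f 0 = 0.
  by move=> fl; have := fl (-1) 0 0; rewrite !scaleN1r oppr0 addr0 addNr.
have lsum (f : V -> V) (fl : linear f) d : \sum_(i < size s) d i *: (map f s)`_i
    = f (\sum_(i < size s) d i *: s`_i).
  rewrite (big_morph f (id1 := 0) (op1 := +%R)); last exact: lin0.
    apply: eq_bigr => i _; rewrite (nth_map 0) //.
    by have := fl (d i) s`_i 0; rewrite (lin0 _ fl) !addr0.
  by move=> u v; have := fl 1 u v; rewrite !scale1r.
have Psum d : P (\sum_(i < size s) d i *: s`_i).
  elim/big_ind: _ => //; first by move=> u v Pu Pv; rewrite -[u]scale1r; apply: Pl.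
  by move=> i _; rewrite -[_ *: _]addr0; apply: Pl => //; apply/sP/mem_nth.
rewrite size_cat !size_map big_split_ord /= => c0.
have : phi (\sum_(i < size s) c i *: s`_i) =
       psi (- (\sum_(i < size s) c (size s + i)%N *: s`_i)).
  have -> : forall x, psi (- x) = - psi x.
    by move=> x; have := psil (-1) x 0; rewrite (lin0 _ psil) !addr0 !scaleN1r.
  rewrite -(lsum _ phil) -(lsum _ psil (fun i => c (size s + i)%N)).
  apply/eqP; rewrite -addr_eq0 -[X in _ == X]c0; apply/eqP; congr (_ + _).
    by apply: eq_bigr => i _; rewrite nth_cat size_map ltn_ord.
  apply: eq_bigr => i _; rewrite nth_cat size_map.
  by rewrite ltnNge leq_addr /= addKn.
move/disj => []; [exact: Psum| |].
  by rewrite -scaleN1r -[_ *: _]addr0; apply: Pl => //;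
    exact: (Psum (fun i => c (size s + i)%N)).
move=> e1 /eqP; rewrite oppr_eq0 => /eqP e2 i il.
have [ilt|ige] := ltnP i (size s); first exact: sI e1 _ ilt.
rewrite -(subnKC ige); apply: (sI (fun j => c (size s + j)%N)) => //.
by rewrite ltn_subLR.
Qed.

End LinearAlgebra.

(** * Almost commuting generators *)

Section AlmostCommuting.
Variables (k : fieldType) (A : algType k) (N : nat) (g : 'I_N -> A).

Definition word (s : seq 'I_N) : A := \prod_(i <- s) g i.

(** The strict bound makes [filt 0] vanish and indexes [filt] like the size of
    a polynomial, which avoids a special case for lower order terms in degree
    zero. *)
Definition filt (d : nat) : set A :=
  lin_span [set word s | s in [set s : seq 'I_N | (size s < d)%N]].

Lemma filt_word s d : (size s < d)%N -> filt d (word s).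
Proof. by move=> sd; apply: lin_span_sub; exists s. Qed.

Lemma filt_mono d e : (d <= e)%N -> (filt d `<=` filt e)%classic.
Proof.
move=> de; apply: sub_lin_span => _ [s /= sd <-]; exists s => //=.
exact: leq_trans sd de.
Qed.

Lemma filtM d e x y : filt d.+1 x -> filt e y -> filt (d + e) (x * y).
Proof.
move=> Fx Fy; move: x Fx; apply: lin_span_min => [|a u v Fu Fv|_ [s /= sd <-]].
- by rewrite mul0r; exact: lin_span0.
- by rewrite mulrDl -scalerAl; exact: lin_spanP.
move: y Fy; apply: lin_span_min => [|a u v Fu Fv|_ [s' /= se <-]].
- by rewrite mulr0; exact: lin_span0.
- by rewrite mulrDr -scalerAr; exact: lin_spanP.
rewrite /word -big_cat; apply: filt_word; rewrite size_cat.
by rewrite -addnS leq_add.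
Qed.

Lemma filtMr d e x y : filt d x -> filt e.+1 y -> filt (d + e) (x * y).
Proof.
case: d => [|d] Fx Fy; last by rewrite addSnnS; exact: filtM.
have x0 : x = 0.
  move: x Fx; apply: (lin_span_min (M := fun x => x = 0)) => // [a u v -> ->|_ [s]//].
  by rewrite scaler0 addr0.
by rewrite x0 mul0r; exact: lin_span0.
Qed.

Lemma filt1 d : filt d.+1 1.
Proof. have -> : 1 = word [::] by rewrite /word big_nil.
exact: filt_word. Qed.

Lemma filt_gen i : filt 2 (g i).
Proof. have -> : g i = word [:: i] by rewrite /word big_seq1.
exact: filt_word. Qed.

Hypothesis gcomm : forall i j, filt 2 (g i * g j - g j * g i).

(** Commuting with a word of length l is a derivation, and each factor it
    meets is replaced by something of degree at most one. *)
Lemma commutator_word i s :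
  filt (size s).+1 (g i * word s - word s * g i).
Proof.
elim: s => [|j s IH]; first by rewrite /word big_nil mulr1 mul1r subrr; exact: lin_span0.
have -> : word (j :: s) = g j * word s by rewrite /word big_cons.
have -> : g i * (g j * word s) - g j * word s * g i =
   (g i * g j - g j * g i) * word s + g j * (g i * word s - word s * g i).
  by rewrite mulrBl mulrBr !mulrA addrA subrK.
by apply: lin_spanD; apply: (@filtM 1) => //; [exact: filt_word|exact: filt_gen].
Qed.

(** Moving one letter to its place costs a commutator with the letters it
    crosses; induction on the word does the rest. *)
Lemma word_perm s s' : perm_eq s s' -> filt (size s) (word s - word s').
Proof.
elim: s s' => [|i s IH] s' ss'.
  by rewrite perm_sym in ss'; rewrite (perm_nilP ss') subrr; exact: lin_span0.
have is' : i \in s' by rewrite -(perm_mem ss') mem_head.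
case/splitPr: is' ss' => [s1 s2] ss'.
have ss12 : perm_eq s (s1 ++ s2).
  by rewrite -(perm_cons i) (perm_trans ss') // -cat1s perm_catCA.
have -> : word (i :: s) - word (s1 ++ i :: s2) =
    g i * (word s - word (s1 ++ s2)) + (g i * word s1 - word s1 * g i) * word s2.
  rewrite /word !big_cons !big_cat big_cons /= mulrBr mulrBl !mulrA.
  by rewrite addrA subrK.
apply: lin_spanD.
  exact: (@filtM 1) (filt_gen _) (IH _ ss12).
rewrite /= (perm_size ss12) size_cat -addSn.
exact: filtMr (commutator_word _ _) (filt_word _).
Qed.

(** * Ordered monomials *)

(** The PBW map.  It is only linear: [mmap] respects products when the
    generators commute. *)
Definition ordered (p : mpoly N k) : A := mmap (in_alg A) g p.

Lemma ordered_linear : linear ordered.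
Proof. by move=> c p q; rewrite /ordered mmapD mmapZ /= mulr_algl. Qed.
HB.instance Definition _ :=
  GRing.isLinear.Build k (mpoly N k) A _ ordered ordered_linear.

Definition mnm_seq (m : multinom N) : seq 'I_N :=
  flatten [seq nseq (m i) i | i <- enum 'I_N].

Lemma count_mnm_seq (m : multinom N) i : count_mem i (mnm_seq m) = m i.
Proof.
rewrite count_flatten -map_comp sumnE big_map big_enum /=.
rewrite (bigD1 i) //= count_nseq /= eqxx mul1n big1 ?addn0 // => j ji.
by rewrite count_nseq /= (negPf ji).
Qed.

Lemma size_mnm_seq (m : multinom N) : size (mnm_seq m) = mdeg m.
Proof.
rewrite size_flatten /shape -map_comp sumnE big_map big_enum mdegE /=.
by apply: eq_bigr => i _; rewrite size_nseq.
Qed.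

Lemma ordered_mpolyX m : ordered (mpolyX k m) = word (mnm_seq m).
Proof.
rewrite /ordered mmapX /mmap1 /word big_flatten big_map enumT.
rewrite [index_enum _]unlock; apply: eq_bigr => i _.
by rewrite big_nseq -Monoid.iteropE.
Qed.

Lemma ordered_mpolyX_perm (m : multinom N) (s : seq 'I_N) :
  (forall i, m i = count_mem i s) ->
  filt (mdeg m) (ordered (mpolyX k m) - word s).
Proof.
move=> ms; rewrite ordered_mpolyX -size_mnm_seq; apply: word_perm.
by apply/allP => i _ /=; rewrite count_mnm_seq ms.
Qed.

Lemma filt_ordered d p : (msize p <= d)%N -> filt d (ordered p).
Proof.
move=> pd; rewrite (mpolyE p) linear_sum /= big_seq; apply: lin_span_sum => m mp.
rewrite linearZ /=; apply: lin_spanZ; rewrite ordered_mpolyX; apply: filt_word.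
by rewrite size_mnm_seq (leq_trans _ pd) // msize_mdeg_lt.
Qed.

(** Spanning half of PBW: a word equals the ordered monomial with the same
    letters up to shorter words, which are handled by induction. *)
Lemma orderedP d x : filt d x -> exists2 p, (msize p <= d)%N & x = ordered p.
Proof.
elim: d x => [|d IH] x.
  move: x; apply: lin_span_min => [|a u v [p p0 ->] [q q0 ->]|_ [s]//].
    by exists 0; rewrite ?mmeasure0 ?linear0.
  exists (a *: p + q); last by rewrite linearP.
  by move: p0 q0; rewrite !leqn0 !msize_poly_eq0 => /eqP-> /eqP->; rewrite scaler0 addr0.
move: x; apply: lin_span_min => [|a u v [p pd ->] [q qd ->]|_ [s /= sd <-]].
- by exists 0; rewrite ?mmeasure0 ?linear0.
- exists (a *: p + q); last by rewrite linearP.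
  rewrite (leq_trans (msizeD_le _ _)) // geq_max qd andbT.
  exact: leq_trans (mmeasureZ_le _ _ _) pd.
pose m := Multinom [tuple count_mem i s | i < N].
have mE i : m i = count_mem i s by rewrite mnmE.
have mdegm : mdeg m = size s.
  rewrite mdegE -(sum1_size s) (eq_bigr (fun i => count_mem i s)) //.
  under eq_bigr => i _ do rewrite -sum1_count big_mkcond.
  rewrite exchange_big /=; apply: eq_bigr => j _.
  by rewrite -big_mkcond (big_pred1 j) // => i; rewrite /= eq_sym.
have [q qd eq] : exists2 q, (msize q <= d)%N & word s - ordered (mpolyX k m) = ordered q.
  apply: IH; rewrite -opprB -scaleN1r; apply: lin_spanZ.
  by apply: filt_mono (ordered_mpolyX_perm mE); rewrite mdegm.
exists (q + mpolyX k m); last by rewrite linearD /= -eq subrK.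
rewrite (leq_trans (msizeD_le _ _)) // geq_max (leq_trans qd (leqnSn _)) /=.
by rewrite msizeX mdegm.
Qed.

(** Reordering a product of ordered monomials only costs terms of lower
    degree, so that the associated graded algebra is commutative. *)
Lemma orderedM d e p q : (msize p <= d.+1)%N -> (msize q <= e.+1)%N ->
  filt (d + e) (ordered p * ordered q - ordered (p * q)).
Proof.
move=> pd qe.
have -> : ordered (p * q) = \sum_(m <- msupp p) \sum_(m' <- msupp q)
    (mcoeff m p * mcoeff m' q) *: ordered (mpolyX k (mnm_add m m')).
  rewrite mpolyME big_allpairs /= linear_sum; apply: eq_bigr => m _.
  by rewrite linear_sum; apply: eq_bigr => m' _; rewrite linearZ.
have -> : ordered p * ordered q = \sum_(m <- msupp p) \sum_(m' <- msupp q)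
    (mcoeff m p * mcoeff m' q) *: (ordered (mpolyX k m) * ordered (mpolyX k m')).
  rewrite {1}(mpolyE p) linear_sum mulr_suml; apply: eq_bigr => m _ /=.
  rewrite {1}(mpolyE q) linear_sum mulr_sumr; apply: eq_bigr => m' _ /=.
  by rewrite !linearZ /= -scalerAl -scalerAr scalerA.
rewrite -sumrB big_seq; apply: lin_span_sum => m mp.
rewrite -sumrB big_seq; apply: lin_span_sum => m' mq.
rewrite -scalerBr; apply: lin_spanZ; rewrite -opprB -scaleN1r; apply: lin_spanZ.
rewrite [X in _ - X](_ : _ = word (mnm_seq m ++ mnm_seq m')); last first.
  by rewrite !ordered_mpolyX /word big_cat.
apply: (filt_mono (d := mdeg (mnm_add m m'))).
  rewrite mdegD leq_add // -ltnS.
    exact: leq_trans (msize_mdeg_lt mp) pd.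
  exact: leq_trans (msize_mdeg_lt mq) qe.
by apply: ordered_mpolyX_perm => i; rewrite count_cat !count_mnm_seq mnmDE.
Qed.

End AlmostCommuting.

(** * Algebras with a PBW basis *)

Lemma exp2_gt_poly d N : exists j, ((1 + d * j) ^ N < 2 ^ j)%N.
Proof.
(* With j = 2 ^ i the claim reduces to N * (d + i) < 2 ^ i, and i = 2 * h
   with h = N * (d + 2) is large enough because h < 2 ^ h. *)
pose h := (N * (d + 2))%N; pose i := (2 * h)%N; exists (2 ^ i)%N.
apply: (@leq_ltn_trans (2 ^ (N * (d + i)))%N).
  rewrite (mulnC N) expnM; have [->|N0] := posnP N; first by rewrite !expn0.
  rewrite leq_exp2r // expnD.
  apply: (@leq_trans ((1 + d) * 2 ^ i)%N).
    by rewrite mulnDl mul1n leq_add2r expn_gt0.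
  by rewrite leq_mul2r add1n ltn_expl ?orbT.
rewrite ltn_exp2l // {2}/i (mulnC 2) expnM.
have hlt : (h < 2 ^ h)%N by rewrite ltn_expl.
apply: (@leq_trans (h.+1 ^ 2)%N); last by rewrite leq_exp2r.
rewrite /h; nia.
Qed.

Section PBW.
Variables (k : fieldType) (A : algType k) (N : nat) (g : 'I_N -> A).
Hypothesis gcomm : forall i j, filt g 2 (g i * g j - g j * g i).
Hypothesis ggen : forall x, exists d, filt g d x.
Hypothesis pbw : forall p, ordered g p = 0 -> p = 0.

(** The homogeneous part of degree [d] of [p] is the class of [x] in the
    associated graded algebra; keeping the lower terms of [p] spares a
    projection. *)
Definition symbol d (x : A) p : Prop :=
  (msize p <= d.+1)%N /\ filt g d (x - ordered g p).

Lemma symbol_filt d x p : symbol d x p -> filt g d.+1 x.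
Proof.
move=> [pd xp]; rewrite -(subrK (ordered g p) x); apply: lin_spanD.
  exact: filt_mono xp.
exact: filt_ordered.
Qed.

Lemma symbol_ordered d p : (msize p <= d.+1)%N -> symbol d (ordered g p) p.
Proof. by move=> pd; split=> //; rewrite subrr; exact: lin_span0. Qed.

Lemma symbolM d e x y p q : symbol d x p -> symbol e y q ->
  symbol (d + e) (x * y) (p * q).
Proof.
move=> sx sy; have [pd xp] := sx; have [qe yq] := sy; split.
  have [->|p0] := eqVneq p 0; first by rewrite mul0r mmeasure0.
  have [->|q0] := eqVneq q 0; first by rewrite mulr0 mmeasure0.
  by rewrite msizeM //; move: (msize p) (msize q) pd qe => a c; lia.
have -> : x * y - ordered g (p * q) = (x - ordered g p) * y +
    (ordered g p * (y - ordered g q) +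
     (ordered g p * ordered g q - ordered g (p * q))).
  by rewrite mulrBl mulrBr addrA subrKA addrA subrK.
apply: lin_spanD; first exact: filtMr xp (symbol_filt sy).
apply: lin_spanD; last exact: orderedM.
by apply: filtM => //; exact: filt_ordered.
Qed.

Lemma symbol1 : symbol 0 1 1.
Proof.
have {1}<- : ordered g 1 = 1.
  by rewrite -mpolyX0 /ordered mmapX mmap11.
by apply: symbol_ordered; rewrite mmeasure1.
Qed.

Lemma symbolX d x p m : symbol d x p -> symbol (d * m) (x ^+ m) (p ^+ m).
Proof.
move=> xp; elim: m => [|m IH]; first by rewrite !expr0 muln0; exact: symbol1.
by rewrite !exprS mulnS; exact: symbolM.
Qed.

Lemma symbol_prod I (r : seq I) (d : I -> nat) x p :
  (forall i, symbol (d i) (x i) (p i)) ->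
  symbol (\sum_(i <- r) d i) (\prod_(i <- r) x i) (\prod_(i <- r) p i).
Proof.
move=> xp; elim: r => [|i r IH]; first by rewrite !big_nil; exact: symbol1.
by rewrite !big_cons; exact: symbolM.
Qed.

(** This is where the independence of ordered monomials enters: a nonzero
    leading form cannot be absorbed by terms of lower degree. *)
Lemma symbol_neq0 d x p : symbol d x p -> msize p = d.+1 -> x != 0.
Proof.
move=> [_ xp] pd; apply/eqP => x0; move: xp; rewrite x0 sub0r => /orderedP.
case=> // q qd /eqP; rewrite eq_sym -subr_eq0 opprK -linearD => /eqP/pbw /eqP.
rewrite addr_eq0 => /eqP qp; move: qd; rewrite qp mmeasureN pd.
by rewrite ltnn.
Qed.

Lemma pbw_ordered x : x != 0 -> exists d p, msize p = d.+1 /\ x = ordered g p.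
Proof.
move=> x0; have [d /orderedP[//|p _ xp]] := ggen x.
exists (msize p).-1, p; split=> //; rewrite prednK // lt0n msize_poly_eq0.
by apply/eqP => p0; move: x0; rewrite xp p0 linear0 eqxx.
Qed.

Lemma pbw_domain : is_domain A.
Proof.
move=> x y xy; have [->|x0] := eqVneq x 0; first by left.
have [->|y0] := eqVneq y 0; first by right.
have [d [p [pd xp]]] := pbw_ordered x0; have [e [q [qe yq]]] := pbw_ordered y0.
suff : x * y != 0 by rewrite xy eqxx.
apply: (@symbol_neq0 (d + e) _ (p * q)).
  by rewrite xp yq; apply: symbolM; apply: symbol_ordered; rewrite ?pd ?qe.
rewrite msizeM -?msize_poly_eq0 ?pd ?qe //; lia.
Qed.

(** A monomial of degree below [d] has all its [N] exponents below [d]. *)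
Lemma pbw_indep_size d (s : seq A) : lin_indep s ->
  (forall v, v \in s -> filt g d v) -> (size s <= d ^ N)%N.
Proof.
move=> sI sd; apply: (@leq_trans #|{: bmultinom N d}|).
  apply: (indep_size_leq_card (e := fun m : bmultinom N d => mmap1 g m) sI).
  move=> v /sd /orderedP[//|p pd ->]; exists (fun m : bmultinom N d => mcoeff m p).
  rewrite /ordered (mmapE d) //; apply: eq_bigr => m _.
  by rewrite /= mulr_algl.
have mlt (m : bmultinom N d) i : (m i < d)%N.
  apply: leq_ltn_trans (bmdeg m); rewrite mdegE (bigD1 i) //=; exact: leq_addr.
pose f (m : bmultinom N d) : {ffun 'I_N -> 'I_d} := [ffun i => Ordinal (mlt m i)].
have finj : injective f.
  move=> m m' /ffunP mm'; apply/val_inj/mnmP => i.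
  by have := mm' i; rewrite !ffunE => /(congr1 val).
by rewrite (leq_trans (leq_card f finj)) // card_ffun !card_ord.
Qed.

(** * The Ore condition from polynomial growth *)

(** If the images of two injective degree-bounded maps of a subspace into
    itself met in zero only, iterating them would double dimensions, against
    the polynomial growth of the filtration. *)
Lemma pbw_images_meet (P : A -> Prop) (phi psi : A -> A) d :
  linear phi -> linear psi ->
  (forall x, phi x = 0 -> x = 0) -> (forall x, psi x = 0 -> x = 0) ->
  P 1 -> P 0 -> (forall a u v, P u -> P v -> P (a *: u + v)) ->
  (forall x, P x -> P (phi x)) -> (forall x, P x -> P (psi x)) ->
  (forall m x, filt g m.+1 x -> filt g (m.+1 + d) (phi x)) ->
  (forall m x, filt g m.+1 x -> filt g (m.+1 + d) (psi x)) ->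
  exists x y, [/\ P x, P y, phi x = psi y & phi x != 0].
Proof.
move=> phil psil phi0 psi0 P1 P0 Pl Pphi Ppsi dphi dpsi.
apply: contrapT => nex.
have disj x y : P x -> P y -> phi x = psi y -> x = 0 /\ y = 0.
  move=> Px Py xy; have x0 : phi x = 0.
    by apply: contrapT => /eqP x0; apply: nex; exists x, y.
  by split; [exact: phi0|apply: psi0; rewrite -xy].
have grow j : exists s : seq A, [/\ size s = (2 ^ j)%N, lin_indep s &
    forall v, v \in s -> P v /\ filt g (1 + d * j) v].
  elim: j => [|j [s [ss sI sP]]].
    exists [:: 1]; split=> // [|v]; last first.
      by rewrite inE => /eqP->; split=> //; rewrite muln0; exact: filt1.
    apply/lin_indepP => c /=; rewrite big_ord1 /= => /eqP.
    by rewrite scaler_eq0 oner_eq0 orbF => /eqP c0 [].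
  exists (map phi s ++ map psi s); split.
  - by rewrite size_cat !size_map ss expnS mul2n addnn.
  - by apply: (indep_double phil psil P0 Pl disj) => // v /sP[].
  move=> v; rewrite mem_cat mulnS addnCA addnC.
  by case/orP => /mapP[u /sP[Pu Fu] ->]; split; auto.
have [j jlt] := exp2_gt_poly d N; have [s [ss sI sP]] := grow j.
have := pbw_indep_size sI (fun v vs => (sP v vs).2).
by rewrite ss leqNgt jlt.
Qed.

(** * Words with a common denominator *)

Variables (b : A) (M : nat).
Hypothesis b0 : b != 0.

(** The powers of [b] at the end pad every word to exactly [M] factors, each
    equal to [b] or to some [b * g i]. *)
Definition bword (m : multinom N) : A :=
  (\prod_(i < N) (b * g i) ^+ m i) * b ^+ (M - mdeg m).

(** The symbol of [bword m] is the monomial [m] times a power of the symbol of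
    [b] that does not depend on [m]. *)
Lemma bword_indep (ms : seq (multinom N)) : uniq ms ->
  (forall m, m \in ms -> (mdeg m <= M)%N) -> lin_indep [seq bword m | m <- ms].
Proof.
move=> msU msM; have [d [beta [bd bE]]] := pbw_ordered b0.
have beta0 : beta != 0 by rewrite -msize_poly_eq0 bd.
have sgen i : symbol 1 (g i) (mpolyX k (mnm1 i)).
  have -> : g i = ordered g (mpolyX k (mnm1 i)) by rewrite /ordered mmapX mmap1U.
  by apply: symbol_ordered; rewrite msizeX mdeg1.
have sb : symbol d b beta by rewrite bE; apply: symbol_ordered; rewrite bd.
have sw m : (mdeg m <= M)%N ->
    symbol (d * M + mdeg m) (bword m) (beta ^+ M * mpolyX k m).
  move=> mM; have -> : beta ^+ M * mpolyX k m =
    (\prod_(i < N) (beta * mpolyX k (mnm1 i)) ^+ m i) * beta ^+ (M - mdeg m).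
    under eq_bigr => i _ do rewrite exprMn.
    rewrite big_split /= -mpolyXE_id prodrXr -mdegE.
    by rewrite mulrAC -exprD subnKC.
  have -> : (d * M + mdeg m =
      \sum_(i < N) ((d + 1) * m i) + d * (M - mdeg m))%N.
    by rewrite -big_distrr /= -mdegE; nia.
  apply: symbolM; last exact: symbolX.
  by apply: symbol_prod => i; apply: symbolX; apply: symbolM.
apply/lin_indepP => c; rewrite size_map => c0.
pose P : mpoly N k := \sum_(i < size ms) c i *: mpolyX k (nth (@mnm0 N) ms i).
have Pc i : (i < size ms)%N -> mcoeff (nth (@mnm0 N) ms i) P = c i.
  move=> il; rewrite raddf_sum /= (bigD1 (Ordinal il)) //= big1 ?addr0.
    by rewrite mcoeffZ mcoeffX eqxx mulr1.
  move=> j ji; rewrite mcoeffZ mcoeffX nth_uniq //.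
  by rewrite -val_eqE in ji; rewrite (negPf ji) mulr0.
suff P0 : P = 0 by move=> i il; rewrite -(Pc i il) P0 mcoeff0.
apply/eqP; apply: contraT => P0.
pose D := (msize P).-1; have PD : msize P = D.+1.
  by rewrite /D prednK // lt0n msize_poly_eq0.
have bM : msize (beta ^+ M) = (d * M).+1.
  elim: (M) => [|m IH]; first by rewrite expr0 mmeasure1 muln0.
  rewrite exprS msizeM // ?expf_neq0 // bd IH mulnS; lia.
suff : (0 : A) != 0 by rewrite eqxx.
(* If P is nonzero of degree D, the combination has a nonzero symbol in degree
   d * M + D: the words with m of degree above D have coefficient zero. *)
apply: (@symbol_neq0 (d * M + D) _ (beta ^+ M * P)); last first.
  by rewrite msizeM ?expf_neq0 // bM PD; lia.
split; first by rewrite msizeM ?expf_neq0 // bM PD; lia.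
rewrite -[X in X - _]c0 /P mulr_sumr (linear_sum (ordered g)) -sumrB.
apply: lin_span_sum => i _ /=.
rewrite (nth_map (@mnm0 N)) // -scalerAr linearZ /= -scalerBr.
have [->|ci0] := eqVneq (c i) 0; first by rewrite scale0r; exact: lin_span0.
apply: lin_spanZ.
have mM : (mdeg (nth (@mnm0 N) ms i) <= M)%N by apply: msM; exact: mem_nth.
apply: filt_mono (sw _ mM).2; rewrite leq_add2l -ltnS -PD.
by apply: msize_mdeg_lt; rewrite mcoeff_msupp Pc.
Qed.

End PBW.

(** * Gelfand-Kirillov dimension *)

Section Growth.
Variable R : realType.

Lemma limn_esup_le (u : nat -> \bar R) (a : \bar R) :
  (exists M, forall m, (M <= m)%N -> (u m <= a)%E) -> (limn_esup u <= a)%E.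
Proof.
move=> [M uM]; rewrite /limn_esup limf_esupE.
apply: (@le_trans _ _ (ereal_sup [set u m | m in [set m | (M <= m)%N]]%classic)).
  by apply: ereal_inf_lbound; exists [set m | (M <= m)%N]%classic => //; exists M.
by apply: ge_ereal_sup => _ [m /= Mm <-]; exact: uM.
Qed.

Lemma limn_esup_ge (u : nat -> \bar R) (a : \bar R) :
  (exists M, forall m, (M <= m)%N -> (a <= u m)%E) -> (a <= limn_esup u)%E.
Proof.
move=> [M uM]; rewrite /limn_esup limf_esupE.
apply: le_ereal_inf_tmp => _ [V [M' _ VM'] <-].
apply: le_trans (uM (maxn M M') (leq_maxl _ _)) _.
by apply: ereal_sup_ubound; exists (maxn M M') => //; apply: VM'; exact: leq_maxr.
Qed.

Lemma ln_nat_large (K : R) : exists M, forall m, (M <= m)%N -> K <= ln (m%:R : R).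
Proof.
exists (Num.truncn (expR K)).+1 => m Mm.
have Km : expR K <= m%:R.
  apply: (@le_trans _ _ (Num.truncn (expR K)).+1%:R); last by rewrite ler_nat.
  exact/ltW/truncnS_gt.
rewrite -[K]expRK ler_ln ?posrE ?expR_gt0 //.
exact: lt_le_trans (expR_gt0 _) Km.
Qed.

(** In the exponent log_m of the growth a constant factor in front of m ^ N
    becomes a term C / ln m, which tends to zero. *)
Lemma ln_growth_le (D : nat -> R) d N :
  (forall m, 1 <= D m <= ((d * m + 1) ^ N)%:R) ->
  (limn_esup (fun m => (ln (D m) / ln (m%:R : R))%:E) <= (N%:R : R)%:E)%E.
Proof.
move=> DP; apply/lee_addgt0Pr => e e0; apply: limn_esup_le.
pose C : R := N%:R * ln d.+1%:R.
have [M MP] := ln_nat_large (Num.max 1 (C / e)).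
exists (maxn M 1) => m; rewrite geq_max => /andP[Mm m1].
have := MP m Mm; rewrite ge_max => /andP[ln1 lnC].
have lnm0 : 0 < ln (m%:R : R) by apply: lt_le_trans ln1.
have /andP[D1 Dd] := DP m.
rewrite -EFinD lee_fin ler_pdivrMr // mulrDl.
have : ln (D m) <= N%:R * ln m%:R + C.
  rewrite /C -mulrDr -lnM ?posrE ?ltr0n // -natrM mulr_natl -lnXn ?ltr0n ?muln_gt0 ?m1 //.
  rewrite ler_ln ?posrE ?exprn_gt0 ?ltr0n ?muln_gt0 ?m1 //.
    apply: le_trans Dd _; rewrite -natrX ler_nat.
    have [->|N0] := posnP N; first by rewrite !expn0.
    by rewrite leq_exp2r // mulnS addnC mulnC leq_add2r.
  exact: lt_le_trans D1.
move=> h; apply: le_trans h _; rewrite lerD2l.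
by move: lnC; rewrite ler_pdivrMr // mulrC.
Qed.

Lemma ln_growth_ge (D : nat -> R) N : (0 < N)%N ->
  (forall m, ((m %/ N).+1 ^ N)%:R <= D m) ->
  ((N%:R : R)%:E <= limn_esup (fun m => (ln (D m) / ln (m%:R : R))%:E))%E.
Proof.
move=> N0 DP; apply/lee_subgt0Pr => e e0; apply: limn_esup_ge.
pose C : R := N%:R * ln N%:R.
have [M MP] := ln_nat_large (Num.max 1 (C / e)).
exists (maxn M 1) => m; rewrite geq_max => /andP[Mm m1].
have := MP m Mm; rewrite ge_max => /andP[ln1 lnC].
have lnm0 : 0 < ln (m%:R : R) by apply: lt_le_trans ln1.
rewrite -EFinB lee_fin ler_pdivlMr // mulrBl.
suff : N%:R * ln m%:R <= ln (D m) + C.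
  move=> h; rewrite lerBlDr; apply: le_trans h _; rewrite lerD2l.
  by move: lnC; rewrite ler_pdivrMr // mulrC.
have D0 : 0 < D m by apply: lt_le_trans (DP m); rewrite ltr0n expn_gt0.
rewrite /C !mulr_natl -!lnXn ?ltr0n // -lnM ?posrE ?exprn_gt0 ?ltr0n //.
rewrite ler_ln ?posrE ?mulr_gt0 ?exprn_gt0 ?ltr0n //.
apply: (@le_trans _ _ (((m %/ N).+1 ^ N)%:R * N%:R ^+ N)); last first.
  by rewrite ler_pM2r ?exprn_gt0 ?ltr0n.
rewrite -!natrX -natrM ler_nat -expnMn leq_exp2r // ltnW // mulnC.
by rewrite [X in (_ < X)%N]mulnC ltn_ceil.
Qed.

End Growth.

Section GKSubalgebra.
Variables (R : realType) (k : fieldType) (A B : algType k) (j : {lrmorphism B -> A}).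
Variables (N : nat) (g : 'I_N -> A).
Hypothesis N0 : (0 < N)%N.
Hypothesis gcomm : forall i j, filt g 2 (g i * g j - g j * g i).
Hypothesis ggen : forall x, exists d, filt g d x.
Hypothesis pbw : forall p, ordered g p = 0 -> p = 0.
Hypothesis jinj : injective j.

Lemma lin_indep_map (s : seq B) : lin_indep (map j s) <-> lin_indep s.
Proof.
have E c : \sum_(i < size s) c i *: (map j s)`_i = j (\sum_(i < size s) c i *: s`_i).
  by rewrite linear_sum; apply: eq_bigr => i _; rewrite linearZ /= (nth_map 0).
split=> /lin_indepP sI; apply/lin_indepP => c; rewrite ?size_map.
  by move=> c0; have := sI c; rewrite size_map; apply; rewrite E c0 linear0.
by rewrite E => h; apply: sI; apply: jinj; rewrite h linear0.
Qed.

Lemma lin_dim_le (S : set B) d : (forall x, S x -> filt g d (j x)) ->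
  (lin_dim R S <= ((d ^ N)%:R : R)%:E)%E.
Proof.
move=> Sd; apply: ge_ereal_sup => _ [s [sI sS] <-]; rewrite lee_fin ler_nat.
rewrite -(size_map j); apply: (pbw_indep_size gcomm); first exact/lin_indep_map.
by move=> _ /mapP[v /sS/Sd ? ->].
Qed.

Lemma lin_dim_ge (S : set B) (s : seq B) :
  lin_indep s -> (forall v, v \in s -> S v) ->
  (((size s)%:R : R)%:E <= lin_dim R S)%E.
Proof. by move=> sI sS; apply: ereal_sup_ubound; exists s. Qed.

Lemma subspace_powM (V : set B) a c x y :
  subspace_pow V a x -> subspace_pow V c y -> subspace_pow V (a + c) (x * y).
Proof.
move=> Vx; elim: c y => [|c IH] y.
  rewrite addn0; move: y; apply: lin_span_min => [|e u v Vu Vv|_ ->].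
  - by rewrite mulr0; case: a {Vx} => [|a]; exact: lin_span0.
  - by rewrite mulrDr -scalerAr; case: a {Vx} Vu Vv => [|a]; exact: lin_spanP.
  - by rewrite mulr1.
rewrite addnS; move: y; apply: lin_span_min => [|e u v Vu Vv|_ [u Vu [v Vv <-]]].
- by rewrite mulr0; exact: lin_span0.
- by rewrite mulrDr -scalerAr; exact: lin_spanP.
by rewrite mulrA; apply: lin_span_sub; exists (x * u); [exact: IH|exists v].
Qed.

Lemma subspace_pow0 (V : set B) : subspace_pow V 0 1.
Proof. exact: lin_span_sub. Qed.

Lemma subspace_powX (V : set B) a x m :
  subspace_pow V a x -> subspace_pow V (a * m) (x ^+ m).
Proof.
move=> Vx; elim: m => [|m IH]; first by rewrite muln0; exact: subspace_pow0.
by rewrite exprS mulnS; exact: subspace_powM.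
Qed.

Lemma subspace_pow_gen (V : set B) v : V v -> subspace_pow V 1 v.
Proof.
move=> Vv; apply: lin_span_sub; exists 1; first exact: subspace_pow0.
by exists v; rewrite ?mul1r.
Qed.

Lemma subspace_filt_filt (s : seq B) : exists d, forall m x,
  subspace_filt (lin_span [set` s]) m x -> filt g (d * m + 1) (j x).
Proof.
have [d sd] : exists d, forall v, v \in s -> filt g d.+1 (j v).
  elim: s => [|v s [d IH]]; first by exists 0%N.
  have [e ve] := ggen (j v); exists (maxn d e) => u; rewrite inE => /orP[/eqP->|us].
    by apply: filt_mono ve; rewrite leqW // leq_maxr.
  by apply: filt_mono (IH _ us); rewrite ltnS leq_maxl.
exists d => m x.
have jspan (S : set B) e : (forall y, S y -> filt g e (j y)) ->
    forall y, lin_span S y -> filt g e (j y).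
  move=> Se; apply: lin_span_min => //; first by rewrite linear0; exact: lin_span0.
  by move=> a u v fu fv; rewrite linearP; exact: lin_spanP.
have powd i y : subspace_pow (lin_span [set` s]) i y -> filt g (d * i).+1 (j y).
  elim: i y => [|i IH]; first by apply: (jspan) => _ ->; rewrite rmorph1; exact: filt1.
  apply: (jspan) => _ [u /IH fu [v sv <-]]; rewrite rmorphM mulnSr -addnS.
  by apply: filtM fu _; apply: jspan sv => w; exact: sd.
rewrite addn1; apply: (jspan) => y [i /= im /powd]; apply: filt_mono.
by rewrite ltnS leq_mul2l im orbT.
Qed.

Let dim (s : seq B) m : R := fine (lin_dim R (subspace_filt (lin_span [set` s]) m)).

Lemma subspace_filt_dim_fin s m :
  (lin_dim R (subspace_filt (lin_span [set` s]) m) = (dim s m)%:E)%E.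
Proof.
have [d sd] := subspace_filt_filt s.
rewrite /dim fineK // fin_real //; apply/andP; split.
  apply: lt_le_trans (lin_dim_ge (s := [::]) _ _); rewrite ?ltNyr //.
  by apply/lin_indepP.
exact: le_lt_trans (lin_dim_le (sd m)) (ltry _).
Qed.

Lemma GKdim_le : (GKdim R B <= (N%:R : R)%:E)%E.
Proof.
apply: ge_ereal_sup => _ [s _ <-]; have [d sd] := subspace_filt_filt s.
apply: (ln_growth_le (D := dim s) (d := d)) => m.
rewrite -!lee_fin -!subspace_filt_dim_fin (lin_dim_le (sd m)) andbT.
apply: (lin_dim_ge (s := [:: 1])) => [|v].
  apply/lin_indepP => c /=; rewrite big_ord1 /= => /eqP.
  by rewrite scaler_eq0 oner_eq0 orbF => /eqP c0 [].
rewrite inE => /eqP->; apply: lin_span_sub; exists 0%N => //.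
exact: subspace_pow0.
Qed.

(** A common denominator [b] of the generators makes the subalgebra as large
    as the whole algebra: the words in [b] and the [b * g i] grow fast enough. *)
Lemma GKdim_ge (b : B) (c : 'I_N -> B) : b != 0 ->
  (forall i, j (c i) = j b * g i) -> ((N%:R : R)%:E <= GKdim R B)%E.
Proof.
move=> b0 cE; pose s := b :: codom c.
apply: le_trans (ereal_sup_ubound _); last by exists s.
apply: (ln_growth_ge (D := dim s)) => // m.
rewrite -lee_fin -subspace_filt_dim_fin.
pose mon (f : {ffun 'I_N -> 'I_(m %/ N).+1}) := Multinom [tuple f i : nat | i < N].
have monE f i : mon f i = f i by rewrite mnmE.
have mon_inj : injective mon.
  by move=> f f' /mnmP ff'; apply/ffunP => i; apply/val_inj; move: (ff' i); rewrite !monE.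
have mon_deg f : (mdeg (mon f) <= m)%N.
  rewrite mdegE; apply: (@leq_trans (\sum_(i < N) m %/ N)%N).
    by apply: leq_sum => i _; rewrite monE -ltnS.
  by rewrite sum_nat_const card_ord mulnC leq_trunc_div.
pose w (e : multinom N) : B := (\prod_(i < N) c i ^+ e i) * b ^+ (m - mdeg e).
have jw e : j (w e) = bword g (j b) m e.
  rewrite rmorphM rmorph_prod rmorphXn /bword; congr (_ * _).
  by apply: eq_bigr => i _; rewrite rmorphXn /= cE.
pose ms := codom mon.
have -> : ((m %/ N).+1 ^ N)%N = size [seq w e | e <- ms].
  by rewrite size_map size_codom card_ffun !card_ord.
apply: lin_dim_ge.
  apply/lin_indep_map; rewrite -map_comp (eq_map (g := bword g (j b) m)) //.
  apply: (bword_indep gcomm ggen pbw).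
  - by rewrite -(inj_eq jinj) linear0 in b0.
  - by rewrite /ms codomE map_inj_uniq ?enum_uniq.
  - by move=> _ /codomP[f ->].
move=> _ /mapP[e /codomP[f ->] ->].
apply: lin_span_sub; exists m => //=.
have Vs v : v \in s -> subspace_pow (lin_span [set` s]) 1 v.
  by move=> vs; apply/subspace_pow_gen/lin_span_sub.
rewrite /w -{1}(subnKC (mon_deg f)); apply: subspace_powM; last first.
  by rewrite -{1}[(m - _)%N]mul1n; apply/subspace_powX/Vs; rewrite mem_head.
rewrite mdegE; elim/big_rec2: _ => [|i e' x _ IH]; first exact: subspace_pow0.
apply: subspace_powM IH; rewrite -{1}[mon f i]mul1n; apply/subspace_powX/Vs.
by rewrite inE codom_f orbT.
Qed.

End GKSubalgebra.

(** * Ore domains and fractions *)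

Section OreSubalgebra.
Variables (k : fieldType) (A B : algType k) (j : {lrmorphism B -> A}).
Variables (N : nat) (g : 'I_N -> A).
Hypothesis gcomm : forall i j, filt g 2 (g i * g j - g j * g i).
Hypothesis ggen : forall x, exists d, filt g d x.
Hypothesis pbw : forall p, ordered g p = 0 -> p = 0.
Hypothesis jinj : injective j.

Lemma sub_domain : is_domain B.
Proof.
move=> x y xy; have : j x * j y = 0 by rewrite -rmorphM xy rmorph0.
by case/(pbw_domain gcomm ggen pbw) => h; [left|right]; apply: jinj; rewrite h rmorph0.
Qed.

Let P (x : A) := exists y, j y = x.
Let P1 : P 1. Proof. by exists 1; rewrite rmorph1. Qed.
Let P0 : P 0. Proof. by exists 0; rewrite rmorph0. Qed.
Let Pl a u v : P u -> P v -> P (a *: u + v).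
Proof. by move=> [x <-] [y <-]; exists (a *: x + y); rewrite linearP. Qed.

Let filt_pair (a b : B) : exists d, filt g d.+1 (j a) /\ filt g d.+1 (j b).
Proof.
have [d ad] := ggen (j a); have [e be] := ggen (j b); exists (maxn d e).
split; [apply: filt_mono ad|apply: filt_mono be]; rewrite leqW //.
  exact: leq_maxl.
exact: leq_maxr.
Qed.

Let jneq0 a : a != 0 -> j a != 0.
Proof. by rewrite -(inj_eq jinj) rmorph0. Qed.

(** The Ore condition is inherited by every subalgebra, since the argument
    only uses the growth of the filtration induced on it. *)
Lemma sub_right_ore : right_ore B.
Proof.
move=> a b a0 b0; have [d [ad bd]] := filt_pair a b.
have mull (c : A) : linear ( *%R c) by move=> e u v; rewrite mulrDr scalerAr.
have dom (c : B) (x : A) : c != 0 -> j c * x = 0 -> x = 0.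
  move=> /jneq0 c0 /(pbw_domain gcomm ggen pbw)[] // e.
  by rewrite e eqxx in c0.
have [||||x [y [[x' <-] [y' <-] xy n0]]] :=
  @pbw_images_meet _ _ _ _ gcomm P _ _ d (mull (j a)) (mull (j b)) 
    (dom a ^~ a0) (dom b ^~ b0) P1 P0 Pl.
- by move=> _ [x <-]; exists (a * x); rewrite rmorphM.
- by move=> _ [x <-]; exists (b * x); rewrite rmorphM.
- by move=> m x mx; rewrite addnC; exact: filtM.
- by move=> m x mx; rewrite addnC; exact: filtM.
exists x', y'; split; first by apply: jinj; rewrite !rmorphM.
by rewrite -(inj_eq jinj) rmorphM rmorph0.
Qed.

Lemma sub_left_ore : left_ore B.
Proof.
move=> a b a0 b0; have [d [ad bd]] := filt_pair a b.
have mulr (c : A) : linear ( *%R^~ c) by move=> e u v; rewrite mulrDl scalerAl.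
have dom (c : B) (x : A) : c != 0 -> x * j c = 0 -> x = 0.
  move=> /jneq0 c0 /(pbw_domain gcomm ggen pbw)[] // e.
  by rewrite e eqxx in c0.
have [||||x [y [[x' <-] [y' <-] xy n0]]] :=
  @pbw_images_meet _ _ _ _ gcomm P _ _ d (mulr (j a)) (mulr (j b)) 
    (dom a ^~ a0) (dom b ^~ b0) P1 P0 Pl.
- by move=> _ [x <-]; exists (x * a); rewrite rmorphM.
- by move=> _ [x <-]; exists (x * b); rewrite rmorphM.
- by move=> m x mx; rewrite addSnnS; exact: filtM.
- by move=> m x mx; rewrite addSnnS; exact: filtM.
exists x', y'; split; first by apply: jinj; rewrite !rmorphM.
by rewrite -(inj_eq jinj) rmorphM rmorph0.
Qed.

Lemma sub_ore_domain : ore_domain B.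
Proof. by split; [exact: sub_domain|exact: sub_right_ore|exact: sub_left_ore]. Qed.

End OreSubalgebra.

Section RightFractions.
Variables (A B : nzRingType) (j : B -> A).
Hypothesis jD : {morph j : x y / x + y}.
Hypothesis jM : {morph j : x y / x * y}.
Hypothesis j1 : j 1 = 1.
Hypothesis jinj : injective j.
Hypothesis domB : is_domain B.
Hypothesis oreB : right_ore B.

Definition right_fraction (x : A) : Prop :=
  exists b c : B, b != 0 /\ x * j b = j c.

Lemma right_fraction_sub y : right_fraction (j y).
Proof. by exists 1, y; rewrite oner_neq0 j1 mulr1. Qed.

(** Iterating the Ore condition gives common denominators. *)
Lemma right_fraction_common (l : seq A) :
  (forall x, x \in l -> right_fraction x) ->
  exists2 b : B, b != 0 & forall x, x \in l -> exists c, x * j b = j c.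
Proof.
elim: l => [|x l IH] lS; first by exists 1; rewrite ?oner_neq0.
have [|b b0 bl] := IH; first by move=> y yl; apply: lS; rewrite inE yl orbT.
have [b1 [c1 [b10 xb1]]] := lS x (mem_head _ _).
have [u [v [uv n0]]] := oreB b0 b10; exists (b * u) => // y.
rewrite inE => /orP[/eqP->|/bl[c yc]].
  by exists (c1 * v); rewrite uv !jM mulrA xb1.
by exists (c * u); rewrite !jM mulrA yc.
Qed.

Lemma right_fractionD x y :
  right_fraction x -> right_fraction y -> right_fraction (x + y).
Proof.
move=> Sx Sy; have [|b b0 h] := @right_fraction_common [:: x; y].
  by move=> z; rewrite !inE => /orP[]/eqP->.
have [c xc] := h x (mem_head _ _).
have [|d yd] := h y; first by rewrite !inE eqxx orbT.
by exists b, (c + d); rewrite mulrDl xc yd jD.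
Qed.

Lemma right_fractionM x y :
  right_fraction x -> right_fraction y -> right_fraction (x * y).
Proof.
move=> [b [c [b0 xb]]] [b' [c' [b'0 yb]]].
have [c'0|c'0] := eqVneq c' 0.
  exists b', (c * 0); split=> //; rewrite -mulrA yb c'0.
  have j0 : j 0 = 0 by apply: (addrI (j 0)); rewrite -jD !addr0.
  by rewrite mulr0 j0 mulr0.
have [u [v [uv n0]]] := oreB b0 c'0; exists (b' * v), (c * u); split.
  by apply/eqP => /domB[] e; [rewrite e eqxx in b'0|rewrite uv e mulr0 eqxx in n0].
by rewrite !jM !mulrA -(mulrA x) yb -mulrA -jM -uv jM mulrA xb.
Qed.

End RightFractions.

Section Fractions.
Variables (A B : nzRingType) (j : {rmorphism B -> A}).
Hypothesis jinj : injective j.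
Hypothesis domA : is_domain A.
Hypothesis oreB : ore_domain B.

(** Left fractions are right fractions for the opposite multiplications. *)
Definition left_fraction (x : A) : Prop := @right_fraction A^c B^c j x.

Let domBc : is_domain B^c.
Proof. by case: oreB => d _ _ x y /d[]; [right|left]. Qed.
Let oreBc : right_ore B^c. Proof. by case: oreB. Qed.
Let jMc : {morph (j : B^c -> A^c) : x y / x * y}.
Proof. by move=> x y; exact: (rmorphM j y x). Qed.

Lemma left_fractionD x y :
  left_fraction x -> left_fraction y -> left_fraction (x + y).
Proof. exact: (@right_fractionD A^c B^c j (rmorphD j) jMc oreBc). Qed.

Lemma left_fractionM x y :
  left_fraction x -> left_fraction y -> left_fraction (x * y).
Proof.
move=> Sx Sy; exact: (@right_fractionM A^c B^c j (rmorphD j) jMc domBc oreBc _ _ Sy Sx).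
Qed.

Lemma left_fraction_sub y : left_fraction (j y).
Proof. exact: (@right_fraction_sub A^c B^c j (rmorph1 j)). Qed.

Lemma left_fraction_common (l : seq A) :
  (forall x, x \in l -> left_fraction x) ->
  exists2 b : B, b != 0 & forall x, x \in l -> exists c, j b * x = j c.
Proof. exact: (@right_fraction_common A^c B^c j jMc oreBc). Qed.

Lemma regular_neq0 (D : nzRingType) (s : D) :
  is_domain D -> regular_elt s <-> s != 0.
Proof.
move=> domD; split=> [[sl _]|s0].
  apply/eqP => s0; have /sl/eqP : s * 1 = s * 0 by rewrite s0 !mul0r.
  by rewrite oner_eq0.
split=> x y /eqP; rewrite -subr_eq0.
  by rewrite -mulrBr => /eqP/domD[/eqP|/eqP]; rewrite ?(negPf s0) // subr_eq0 => /eqP.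
by rewrite -mulrBl => /eqP/domD[/eqP|/eqP]; rewrite ?(negPf s0) // subr_eq0 => /eqP.
Qed.

(** Denominators are cleared in the numerator and in the denominator of a
    quotient at once, by a common factor from the subring. *)
Lemma fractions_quotients (Q : unitRingType) (i : {rmorphism A -> Q}) :
  (forall x, right_fraction j x) -> (forall x, left_fraction x) ->
  is_ring_of_quotients i -> is_ring_of_quotients (i \o j).
Proof.
move=> SR SL [iinj ireg ir il]; have [domB orB olB] := oreB.
have unitj s : s != 0 -> i (j s) \is a GRing.unit.
  move=> s0; apply/ireg/regular_neq0 => //.
  by rewrite -(rmorph0 j) (inj_eq jinj).
split.
- exact: inj_comp.
- by move=> s /(regular_neq0 _ domB); exact: unitj.
- move=> q; have [a [s [/(regular_neq0 _ domA) s0 ->]]] := ir q.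
  have [|b b0 h] := right_fraction_common (rmorphM j) orB (l := [:: a; s]).
    by move=> x _; exact: SR.
  have [c ac] := h a (mem_head _ _).
  have [|d sd] := h s; first by rewrite !inE eqxx orbT.
  have d0 : d != 0.
    apply/eqP => d0; move: sd; rewrite d0 rmorph0 => /domA[/eqP|/eqP].
      by rewrite (negPf s0).
    by rewrite -(rmorph0 j) (inj_eq jinj) (negPf b0).
  exists c, d; split; first exact/regular_neq0.
  have bu := unitj _ b0.
  have su : i s \is a GRing.unit by apply/ireg/regular_neq0.
  by rewrite /= -ac -sd !rmorphM invrM // mulrA mulrK.
- move=> q; have [a [s [/(regular_neq0 _ domA) s0 ->]]] := il q.
  have [|b b0 h] := left_fraction_common (l := [:: a; s]).
    by move=> x _; exact: SL.
  have [c ac] := h a (mem_head _ _).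
  have [|d sd] := h s; first by rewrite !inE eqxx orbT.
  have d0 : d != 0.
    apply/eqP => d0; move: sd; rewrite d0 rmorph0 => /domA[/eqP|/eqP].
      by rewrite -(rmorph0 j) (inj_eq jinj) (negPf b0).
    by rewrite (negPf s0).
  exists c, d; split; first exact/regular_neq0.
  have bu := unitj _ b0.
  have su : i s \is a GRing.unit by apply/ireg/regular_neq0.
  by rewrite /= -ac -sd !rmorphM invrM // -mulrA mulKr.
Qed.

End Fractions.

(** * Representations of the orbit target *)

Section Endo.
Variables (k : fieldType) (V : lmodType k) (v0 : V).

Record endo_map := EndoMap { endo_fun :> V -> V; endo_linear : linear endo_fun }.

Lemma endo_ext (f g : endo_map) : f =1 g -> f = g.
Proof.
case: f g => [f fl] [g gl] /= /funext fg; subst g.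
by congr EndoMap; exact: Prop_irrelevance.
Qed.

Lemma endo0_linear : linear (fun _ : V => 0 : V).
Proof. by move=> a u v; rewrite scaler0 addr0. Qed.
Lemma endoD_linear (f g : endo_map) : linear (fun v => f v + g v).
Proof. by move=> a u v; rewrite !endo_linear scalerDr addrACA. Qed.
Lemma endoN_linear (f : endo_map) : linear (fun v => - f v).
Proof. by move=> a u v; rewrite !endo_linear opprD scalerN. Qed.
Lemma endo1_linear : linear (fun v : V => v). Proof. by []. Qed.
Lemma endoM_linear (f g : endo_map) : linear (fun v => f (g v)).
Proof. by move=> a u v; rewrite !endo_linear. Qed.
Lemma endoZ_linear c (f : endo_map) : linear (fun v => c *: f v).
Proof. by move=> a u v; rewrite !endo_linear scalerDr !scalerA mulrC. Qed.

(** The proof that [V] is nonzero, needed for the ring of endomorphisms to be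
    nontrivial, is part of the type. *)
Definition endo (_ : v0 != 0) : Type := endo_map.

Section Structure.
Hypothesis v0N0 : v0 != 0.
Local Notation E := (endo v0N0).

HB.instance Definition _ := gen_eqMixin E.
HB.instance Definition _ := gen_choiceMixin E.

Let ext (f g : E) (h : forall v, (f : endo_map) v = (g : endo_map) v) : f = g.
Proof. exact: endo_ext. Qed.

Definition endo_zero : E := EndoMap endo0_linear.
Definition endo_add (f g : E) : E := EndoMap (endoD_linear f g).
Definition endo_opp (f : E) : E := EndoMap (endoN_linear f).
Definition endo_one : E := EndoMap endo1_linear.
Definition endo_mul (f g : E) : E := EndoMap (endoM_linear f g).
Definition endo_scale c (f : E) : E := EndoMap (endoZ_linear c f).

Lemma endo_addA : associative endo_add.
Proof. by move=> f g h; apply: ext => v /=; rewrite addrA. Qed.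
Lemma endo_addC : commutative endo_add.
Proof. by move=> f g; apply: ext => v /=; rewrite addrC. Qed.
Lemma endo_add0 : left_id endo_zero endo_add.
Proof. by move=> f; apply: ext => v /=; rewrite add0r. Qed.
Lemma endo_addN : left_inverse endo_zero endo_opp endo_add.
Proof. by move=> f; apply: ext => v /=; rewrite addNr. Qed.
HB.instance Definition _ :=
  GRing.isZmodule.Build E endo_addA endo_addC endo_add0 endo_addN.

Lemma endo_mulA : associative endo_mul.
Proof. by move=> f g h; apply: ext. Qed.
Lemma endo_mul1l : left_id endo_one endo_mul.
Proof. by move=> f; apply: ext. Qed.
Lemma endo_mul1r : right_id endo_one endo_mul.
Proof. by move=> f; apply: ext. Qed.
Lemma endo_mulDl : left_distributive endo_mul +%R.
Proof. by move=> f g h; apply: ext. Qed.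
Lemma endo_mulDr : right_distributive endo_mul +%R.
Proof.
move=> f g h; apply: ext => v /=.
by have := endo_linear f 1 ((g : endo_map) v) ((h : endo_map) v); rewrite !scale1r.
Qed.
Lemma endo_one_neq0 : endo_one != 0.
Proof.
by apply/eqP => /(congr1 (fun f : E => (f : endo_map) v0)) /eqP; apply/negP.
Qed.
HB.instance Definition _ := GRing.Zmodule_isNzRing.Build E
  endo_mulA endo_mul1l endo_mul1r endo_mulDl endo_mulDr endo_one_neq0.

Lemma endo_scaleA a b f : endo_scale a (endo_scale b f) = endo_scale (a * b) f.
Proof. by apply: ext => v /=; rewrite scalerA. Qed.
Lemma endo_scale1 : left_id 1 endo_scale.
Proof. by move=> f; apply: ext => v /=; rewrite scale1r. Qed.
Lemma endo_scaleDr : right_distributive endo_scale +%R.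
Proof. by move=> a f g; apply: ext => v /=; rewrite scalerDr. Qed.
Lemma endo_scaleDl f : {morph endo_scale^~ f : a b / a + b}.
Proof. by move=> a b; apply: ext => v /=; rewrite scalerDl. Qed.
HB.instance Definition _ := GRing.Zmodule_isLmodule.Build k E
  endo_scaleA endo_scale1 endo_scaleDr endo_scaleDl.

Lemma endo_scaleAl a (f g : E) : a *: (f * g) = (a *: f) * g.
Proof. exact: ext. Qed.
HB.instance Definition _ := GRing.Lmodule_isLalgebra.Build k E endo_scaleAl.
Lemma endo_scaleAr a (f g : E) : a *: (f * g) = f * (a *: g).
Proof.
apply: ext => v; have := endo_linear f a ((g : endo_map) v) 0.
have -> : (f : endo_map) 0 = 0.
  by have := endo_linear f (-1) 0 0; rewrite !scaleN1r oppr0 addr0 addNr.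
by rewrite !addr0 => e; exact: esym e.
Qed.
HB.instance Definition _ := GRing.Lalgebra_isAlgebra.Build k E endo_scaleAr.

Definition ev (v : V) (f : E) : V := (f : endo_map) v.

Lemma ev_linear v : linear (ev v). Proof. by []. Qed.
HB.instance Definition _ v := GRing.isLinear.Build k E V _ (ev v) (ev_linear v).

Lemma evM v f g : ev v (f * g) = ev (ev v g) f. Proof. by []. Qed.
Lemma ev1 v : ev v 1 = v. Proof. by []. Qed.

Lemma ev_linearr f : linear (ev^~ f). Proof. exact: endo_linear. Qed.

End Structure.
End Endo.

Section TensorHom.
Variables (k : fieldType) (A B E : algType k).
Variables (phi : {lrmorphism A -> E}) (psi : {lrmorphism B -> E}).

Definition tens_hom_fun (_ : forall a b, phi a * psi b = psi b * phi a) :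
    tens A B -> E :=
  tens_lift (fun a b => phi a * psi b).

Section Hom.
Hypothesis comm : forall a b, phi a * psi b = psi b * phi a.

Let bil : is_bilinear (fun a b => phi a * psi b).
Proof.
by split=> [b|a] c u v; rewrite linearP /= ?mulrDl ?mulrDr -?scalerAl -?scalerAr.
Qed.

Lemma tens_hom_ten a b : tens_hom_fun comm (ten a b) = phi a * psi b.
Proof. exact: tens_liftE. Qed.

Lemma tens_hom_linear : linear (tens_hom_fun comm).
Proof. exact: tens_lift_linear. Qed.
HB.instance Definition _ :=
  GRing.isLinear.Build k (tens A B) E _ (tens_hom_fun comm) tens_hom_linear.

Lemma tens_hom_monoid : monoid_morphism (tens_hom_fun comm).
Proof.
split=> [|x y]; first by rewrite -ten1 tens_hom_ten !rmorph1 mulr1.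
have [s ->] := tens_span x; have [s' ->] := tens_span y.
rewrite mulr_suml !linear_sum mulr_suml; apply: eq_bigr => p _.
rewrite mulr_sumr !linear_sum mulr_sumr; apply: eq_bigr => q _ /=.
rewrite tenM !tens_hom_ten !rmorphM /= -!mulrA; congr (_ * _).
by rewrite !mulrA; congr (_ * _); exact: comm.
Qed.
HB.instance Definition _ :=
  GRing.isMonoidMorphism.Build (tens A B) E (tens_hom_fun comm) tens_hom_monoid.

Definition tens_hom : {lrmorphism tens A B -> E} := tens_hom_fun comm.

End Hom.
End TensorHom.

Section WeylHom.
Variables (k : fieldType) (E : algType k) (t d : E).
Hypothesis dt : d * t - t * d = 1.

Lemma weyl_hom_rel u v : weyl_rel u v ->
  aeval (fun x => if x is GenT then t else d) u =
  aeval (fun x => if x is GenT then t else d) v.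
Proof. by case; rewrite /= scaleN1r mulN1r dt scale1r. Qed.

Definition weyl_hom : {lrmorphism weyl k -> E} :=
  palg_lift (P := weyl_pres k) weyl_hom_rel.

Lemma weyl_hom_t : weyl_hom (weyl_t k) = t.
Proof. exact: (plift_gen (P := weyl_pres k) weyl_hom_rel GenT). Qed.
Lemma weyl_hom_d : weyl_hom (weyl_d k) = d.
Proof. exact: (plift_gen (P := weyl_pres k) weyl_hom_rel GenD). Qed.

Lemma weyl_hom_poly p : weyl_hom (weyl_poly p) = horner_alg t p.
Proof.
elim/poly_ind: p => [|p c IH]; first by rewrite !rmorph0.
rewrite !(rmorphD, rmorphM) /= IH /weyl_poly !horner_algX !horner_algC weyl_hom_t.
by rewrite linearZ rmorph1.
Qed.

End WeylHom.

Lemma palg_ind (k : fieldType) X (P : presentation k X) (S : palg P -> Prop) :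
  (forall x, S (pgen P x)) -> (forall c, S c%:A) ->
  (forall x y, S x -> S y -> S (x + y)) ->
  (forall x y, S x -> S y -> S (x * y)) -> forall x, S x.
Proof.
move=> Sg Sc SD SM x; rewrite -(preprK x) -pclass_eval.
by elim: (prepr x) => //= [t St u Su|t St u Su]; [exact: SD|exact: SM].
Qed.

Section GnBasis.
Variables (k : fieldType) (n : nat).

Definition gn_coef (i : nat) (x : gn k n) : k :=
  (val (qrepr x) : {poly k})`_i.+1.

Lemma gn_coef_class i y : (i < n)%N ->
  gn_coef i (qclass (witt0_ideal k n) y) = (val y : {poly k})`_i.+1.
Proof.
move=> ni; apply/eqP; rewrite -subr_eq0 -coefB; apply/eqP.
have /witt_geP := @qreprP _ _ (witt0_ideal k n) y.
by move=> /(_ i.+1 ni); rewrite raddfB.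
Qed.

Lemma gn_coef_linear i : (i < n)%N -> forall c x y,
  gn_coef i (c *: x + y) = c * gn_coef i x + gn_coef i y.
Proof.
move=> ni c x y; rewrite -(qreprK x) -(qreprK y).
rewrite -qclass_linear !gn_coef_class //.
by rewrite linearP /= coefD coefZ.
Qed.

Lemma gn_coef_v i j : (i < n)%N -> gn_coef i (gn_v k n j) = (i == j)%:R.
Proof. by move=> ni; rewrite gn_coef_class // SubK coefXn eqSS. Qed.

Lemma gn_decomp x : x = \sum_(i < n) gn_coef i x *: gn_v k n i.
Proof.
have qsum (F : 'I_n -> witt0 k) :
    \sum_(i < n) qclass (witt0_ideal k n) (F i) = qclass (witt0_ideal k n) (\sum_i F i).
  rewrite (big_morph _ (@qclassD _ _ _) (qclass0 _)) //.
under eq_bigr => i _ do rewrite /gn_v -[_ *: _]/(qscale _ _) qscaleE.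
rewrite qsum -{1}(qreprK x); apply/qclassP; apply/witt_geP => j jn.
rewrite raddfB raddf_sum /= coefB coef_sum.
under eq_bigr => i _ do rewrite coefZ coefXn.
case: j jn => [|j] jn.
  rewrite big1 ?subr0 => [|i _]; last by rewrite mulr0.
  by have /witt_geP/(_ 0%N (leqnn _)) := valP (qrepr x).
rewrite (bigD1 (Ordinal jn)) //= eqxx mulr1 big1 ?addr0 ?subrr // => i ij.
by rewrite eqSS eq_sym -[j]/(val (Ordinal jn)) val_eqE (negPf ij) mulr0.
Qed.

Section Hom.
Variables (E : algType k) (D : nat -> E).
Hypothesis D0 : forall i, (n <= i)%N -> D i = 0.
Hypothesis DD : forall i j, (i < n)%N -> (j < n)%N ->
  D i * D j - D j * D i = (j%:R - i%:R) *: D (i + j)%N.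

Definition gn_map (x : gn k n) : E := \sum_(i < n) gn_coef i x *: D i.

Lemma gn_map_linear : linear gn_map.
Proof.
move=> c x y; rewrite /gn_map scaler_sumr -big_split; apply: eq_bigr => i _.
by rewrite gn_coef_linear // scalerDl scalerA.
Qed.
HB.instance Definition _ :=
  GRing.isLinear.Build k (gn k n) E _ gn_map gn_map_linear.

Lemma gn_map_v i : gn_map (gn_v k n i) = D i.
Proof.
have [ni|ni] := leqP n i; first by rewrite gn_v0 // linear0 D0.
rewrite /gn_map (bigD1 (Ordinal ni)) //= gn_coef_v // eqxx scale1r.
rewrite big1 ?addr0 // => j ji; rewrite gn_coef_v //.
by rewrite -[i]/(val (Ordinal ni)) val_eqE (negPf ji) scale0r.
Qed.

(** By bilinearity the bracket relations need checking on the basis only. *)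
Lemma gn_map_lie x y : gn_map (lie x y) = gn_map x * gn_map y - gn_map y * gn_map x.
Proof.
have lieZl c (u v : gn k n) : lie (c *: u) v = c *: lie u v.
  by rewrite lieC lieZr -scalerN -lieC.
have lsuml (F : 'I_n -> gn k n) v : lie (\sum_i F i) v = \sum_i lie (F i) v.
  rewrite (big_morph (lie^~ v) (id1 := 0) (op1 := +%R)) //.
    by move=> a b; rewrite lieDl.
  by rewrite lieC lie0r oppr0.
have lsumr (F : 'I_n -> gn k n) v : lie v (\sum_i F i) = \sum_i lie v (F i).
  rewrite (big_morph (lie v) (id1 := 0) (op1 := +%R)) ?lie0r //.
  by move=> a b; rewrite lieDr.
rewrite {1}(gn_decomp x) {1}(gn_decomp y) lsuml linear_sum.
rewrite /gn_map mulr_suml [X in _ - X]mulr_sumr -sumrB; apply: eq_bigr => i _ /=.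
rewrite lsumr linear_sum mulr_sumr mulr_suml -sumrB; apply: eq_bigr => j _ /=.
rewrite lieZl lieZr gn_vlie !linearZ -/gn_map /= gn_map_v -DD //.
rewrite -!scalerAl -!scalerAr !scalerA [gn_coef j y * _]mulrC.
by rewrite -scalerBr.
Qed.

Definition gn_hom : {lrmorphism env (gn k n) -> E} :=
  env_lift gn_map_linear gn_map_lie.

Lemma gn_hom_v i : gn_hom (env_in (gn_v k n i)) = D i.
Proof. by rewrite env_liftE gn_map_v. Qed.

End Hom.
End GnBasis.

(** * Poincare-Birkhoff-Witt for the jet algebra *)

Section JetAction.
Variables (k : fieldType) (n : nat).
Local Notation M := (mpoly n k).
Local Notation Xv j := (mpolyX k (mnm1 j)).

Definition vfield (c : 'I_n -> M) (p : M) : M := \sum_m c m * mderiv m p.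

Lemma vfield_linear c : linear (vfield c).
Proof.
move=> a p q; rewrite /vfield scaler_sumr -big_split; apply: eq_bigr => m _ /=.
by rewrite mderivD mderivZ mulrDr -scalerAr.
Qed.

(** The second derivatives cancel, so a commutator of vector fields is the
    vector field with the expected coefficients. *)
Lemma vfield_lie c d p : vfield c (vfield d p) - vfield d (vfield c p) =
  vfield (fun l => vfield c (d l) - vfield d (c l)) p.
Proof.
have E c' d' : vfield c' (vfield d' p) =
    \sum_m \sum_l c' m * d' l * mderiv m (mderiv l p) +
    vfield (fun l => vfield c' (d' l)) p.
  rewrite /vfield [in X in _ + X](eq_bigr (fun l =>
    \sum_m c' m * (mderiv m (d' l) * mderiv l p))); last first.
    by move=> l _; rewrite mulr_suml; apply: eq_bigr => m _; rewrite mulrA.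
  rewrite [X in _ + X]exchange_big -big_split; apply: eq_bigr => m _ /=.
  rewrite raddf_sum mulr_sumr -big_split; apply: eq_bigr => l _ /=.
  by rewrite mderivM mulrDr addrC mulrA.
rewrite !E exchange_big opprD addrACA /=.
set S1 := \sum_m _; set S2 := \sum_m _; have -> : S1 = S2.
  apply: eq_bigr => m _; apply: eq_bigr => l _.
  by rewrite mderiv_comm (mulrC (d m)).
rewrite subrr add0r /vfield -sumrB; apply: eq_bigr => l _.
by rewrite -mulrBl.
Qed.

(** The coordinates of the jets x |-> x + y_0 x + y_1 x^2 + ...: the point
    y = 0 is the jet of the identity. *)
Definition jet (j : nat) : M :=
  (j == 0%N)%:R + (if insub j is Some j' then Xv j' else 0).

Lemma vfield_jet c (l : 'I_n) : vfield c (jet l) = c l.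
Proof.
have dX (m : 'I_n) : mderiv m (jet l) = (m == l)%:R.
  rewrite /jet valK mderivD -mpolyC_nat mderivC add0r mderivX mnm1E.
  rewrite eq_sym; case: eqP => [->|_]; last by rewrite scale0r.
  rewrite scale1r (_ : mnm_sub _ _ = @mnm0 n) ?mpolyX0 //.
  by apply/mnmP => i; rewrite mnmBE mnm0E subnn.
rewrite /vfield (bigD1 l) //= dX eqxx mulr1 big1 ?addr0 // => m ml.
by rewrite dX (negPf ml) mulr0.
Qed.

Definition jet_coef (i : nat) (m : 'I_n) : M :=
  if (i <= m)%N then - ((m - i).+1%:R *: jet (m - i)) else 0.

(** Infinitesimal reparametrization of jets by x^(i+1) d/dx.  The sign in
    [jet_coef] turns the resulting right action into a left one. *)
Definition jet_field (i : nat) : M -> M := vfield (jet_coef i).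

(** Both sides have linear coefficients; with l = i + j + r the identity is
    (i + r + 1) - (j + r + 1) = i - j. *)
Lemma jet_field_lie i j p :
  jet_field i (jet_field j p) - jet_field j (jet_field i p) =
  (j%:R - i%:R) *: jet_field (i + j) p.
Proof.
rewrite vfield_lie /jet_field /vfield scaler_sumr; apply: eq_bigr => l _.
rewrite scalerAl -!/(vfield _ _); congr (_ * _).
have vjet a b : vfield (jet_coef a) (jet_coef b l) =
    if (a + b <= l)%N then
      ((l - b).+1%:R * (l - b - a).+1%:R) *: jet (l - b - a) else 0.
  have l0 c : vfield c 0 = 0.
    by rewrite /vfield big1 // => m _; rewrite raddf0 mulr0.
  rewrite {2}/jet_coef; case: leqP => [bl|lb]; last first.
    by rewrite l0 leqNgt (leq_trans lb) // leq_addl.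
  have := vfield_linear (jet_coef a) (- (l - b).+1%:R) (jet (l - b)) 0.
  rewrite l0 !addr0 scaleNr => ->.
  have lbn : (l - b < n)%N by apply: leq_ltn_trans (ltn_ord l); exact: leq_subr.
  rewrite -[jet (l - b)]/(jet (Ordinal lbn)) vfield_jet /jet_coef /=.
  rewrite leq_subRL // addnC; case: ifP => _; last by rewrite scaler0.
  by rewrite scalerN scaleNr opprK scalerA.
rewrite !vjet [(j + i)%N]addnC /jet_coef; case: ifP => [ijl|_]; last first.
  by rewrite subrr scaler0.
have E : (l = i + j + (l - (i + j)) :> nat)%N by lia.
have -> : (l - j - i = l - (i + j))%N by lia.
have -> : (l - i - j = l - (i + j))%N by lia.
have -> : ((l - j).+1 = (l - (i + j)).+1 + i)%N by lia.
have -> : ((l - i).+1 = (l - (i + j)).+1 + j)%N by lia.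
set r := (l - (i + j))%N.
rewrite -scalerBl scalerN -scaleNr scalerA; congr (_ *: _).
by rewrite !natrD; ring.
Qed.

Lemma jet_field0 i p : (n <= i)%N -> jet_field i p = 0.
Proof.
move=> ni; rewrite /jet_field /vfield big1 // => m _; rewrite /jet_coef leqNgt.
by rewrite (leq_trans (ltn_ord m) ni) mul0r.
Qed.

(** * Order of vanishing at the identity jet *)

Definition vanishes (r : nat) (p : M) : Prop :=
  forall m, (mdeg m < r)%N -> mcoeff m p = 0.

Lemma vanishesD r p q : vanishes r p -> vanishes r q -> vanishes r (p + q).
Proof. by move=> hp hq m mr; rewrite mcoeffD hp // hq // addr0. Qed.

Lemma vanishesZ r c p : vanishes r p -> vanishes r (c *: p).
Proof. by move=> hp m mr; rewrite mcoeffZ hp // mulr0. Qed.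

Lemma vanishesN r p : vanishes r p -> vanishes r (- p).
Proof. by rewrite -scaleN1r; exact: vanishesZ. Qed.

Lemma vanishes_sum r I (s : seq I) (P : pred I) (F : I -> M) :
  (forall i, P i -> vanishes r (F i)) -> vanishes r (\sum_(i <- s | P i) F i).
Proof.
move=> h; elim/big_ind: _ => //; first by move=> m _; rewrite mcoeff0.
by move=> p q; exact: vanishesD.
Qed.

Lemma vanishes_mono r s p : (r <= s)%N -> vanishes s p -> vanishes r p.
Proof. by move=> rs h m mr; apply: h; exact: leq_trans mr rs. Qed.

Lemma vanishes_deriv r i p : vanishes r.+1 p -> vanishes r (mderiv i p).
Proof.
move=> h m mr; rewrite mcoeff_mderiv h ?mul0rn //.
by rewrite mdegD mdeg1 addn1.
Qed.

Lemma vanishesX r (j : 'I_n) p : vanishes r p -> vanishes r.+1 (Xv j * p).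
Proof.
move=> h m mr; have [jm|jm] := boolP (lem (mnm1 j) m).
  rewrite mulrC -(submK jm) addmC mcoeffMX; apply: h.
  have := mdegD (mnm_sub m (mnm1 j)) (mnm1 j); rewrite submK // mdeg1 addn1 => e.
  by rewrite -ltnS -e.
rewrite mulrC; apply/eqP; rewrite mcoeff_eq0 (perm_mem (msuppMX _ _)).
apply/mapP => -[m' _ e].
by move: jm; rewrite e /= lem_addr.
Qed.

(** At the identity jet the vector field [jet_field i] is minus the [i]-th
    partial derivative; elsewhere its coefficients have an extra linear factor,
    which restores the order lost by differentiating. *)
Lemma jet_field_vanishes r (i : 'I_n) p : vanishes r.+1 p ->
  vanishes r.+1 (jet_field i p + mderiv i p).
Proof.
move=> h; rewrite /jet_field /vfield (bigD1 i) //= addrAC.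
have jetE (m : 'I_n) : (i <= m)%N -> jet_coef i m = - ((m - i).+1%:R *:
   ((m == i)%:R + (if insub (m - i)%N is Some j' then Xv j' else 0))).
  by move=> im; rewrite /jet_coef im /jet subn_eq0 -val_eqE eqn_leq im andbT.
have vX (c : k) j q : vanishes r q ->
    vanishes r.+1 (- (c *: (if insub j is Some j' then Xv j' else 0)) * q).
  move=> hq; rewrite mulNr -scalerAl; apply/vanishesN/vanishesZ.
  case: insubP => [j' _ _|_]; first exact: vanishesX.
  by rewrite mul0r => m _; rewrite mcoeff0.
apply: vanishesD; last first.
  apply: vanishes_sum => m mi.
  have [im|mi'] := leqP i m; last first.
    by rewrite /jet_coef leqNgt mi' mul0r => e _; rewrite mcoeff0.
  by rewrite jetE // (negPf mi) add0r; apply/vX/vanishes_deriv.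
rewrite jetE // eqxx subnn scale1r opprD mulrDl mulN1r addrAC addNr add0r.
by rewrite -[X in - X]scale1r; apply/vX/vanishes_deriv.
Qed.

Lemma jet_fields_vanish (s : seq 'I_n) r p : vanishes (size s + r) p ->
  vanishes r (foldr (fun i : 'I_n => jet_field i) p s) /\
  vanishes r.+1 (foldr (fun i : 'I_n => jet_field i) p s -
                 (-1) ^+ size s *: foldr (fun i => mderiv i) p s).
Proof.
elim: s r => [|i s IH] r h /=.
  by rewrite scale1r subrr; split=> // m _; rewrite mcoeff0.
have [|h1 h2] := IH r.+1; first by rewrite addnS.
set q := foldr _ p s in h1 h2 *; set q' := foldr _ p s in h2 *.
have h3 := jet_field_vanishes i h1.
split.
  rewrite -[jet_field i q](addrK (mderiv i q)); apply: vanishesD.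
    exact: vanishes_mono h3.
  exact/vanishesN/vanishes_deriv.
have -> : jet_field i q - (-1) ^+ (size s).+1 *: mderiv i q' =
    (jet_field i q + mderiv i q) - mderiv i (q - (-1) ^+ size s *: q').
  rewrite mderivB mderivZ exprS mulN1r scaleNr opprK opprB addrA.
  by rewrite addrAC addrK.
by apply: vanishesD => //; exact/vanishesN/vanishes_deriv.
Qed.

(** Independence of ordered monomials in the [jet_field i] becomes visible at
    the identity jet, where they act on monomials of at least the same degree
    through products of partial derivatives. *)
Lemma jet_fields_const (b a : multinom n) : (mdeg a <= mdeg b)%N ->
  mcoeff (@mnm0 n) (foldr (fun i : 'I_n => jet_field i) (mpolyX k b) (mnm_seq a)) =
  if a == b then (-1) ^+ mdeg a * (\prod_(i < n) (a i)`!)%:R else 0.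
Proof.
move=> ab; have Xb : vanishes (mdeg b) (mpolyX k b).
  by move=> m mb; rewrite mcoeffX; case: eqP => // e; rewrite e ltnn in mb.
have [|h1 h2] := @jet_fields_vanish (mnm_seq a) (mdeg b - mdeg a)%N (mpolyX k b).
  by rewrite size_mnm_seq subnKC.
have [lt_ab|ge_ab] := ltnP (mdeg a) (mdeg b).
  rewrite h1 ?mdeg0 ?subn_gt0 //; case: eqP => // e.
  by rewrite e ltnn in lt_ab.
have := h2 (@mnm0 n); rewrite mdeg0 => /(_ isT); rewrite mcoeffB => /eqP.
rewrite subr_eq0 => /eqP ->; rewrite size_mnm_seq mcoeffZ.
rewrite /mnm_seq -mderivm_foldr mcoeff_mderivm mcoeffX addm0 eq_sym.
case: eqP => [->|_]; last by rewrite mul0rn mulr0.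
congr (_ * _%:R); apply: eq_bigr => i _.
by rewrite ffactnn.
Qed.

End JetAction.

(** * A PBW basis of the orbit target *)

Section OrbitTarget.
Variables (k : fieldType) (n : nat).
Local Notation T := (orbit_target k n).

Definition tpoly (p : {poly k}) : T := ten (weyl_poly p) 1.
Definition td : T := ten (weyl_d k) 1.
Definition tv (i : nat) : T := ten 1 (env_in (gn_v k n i)).

Definition tgen (i : 'I_n.+2) : T :=
  match nat_of_ord i with 0 => tpoly 'X | 1 => td | j.+2 => tv j end.

Lemma weyl_polyX : weyl_poly ('X : {poly k}) = weyl_t k.
Proof. by rewrite /weyl_poly horner_algX. Qed.

Lemma ten_linearl (b : env (gn k n)) : linear (fun a : weyl k => ten a b : T).
Proof. exact: (ten_bilinear _ _).1. Qed.
Lemma ten_linearr (a : weyl k) : linear (fun b : env (gn k n) => ten a b : T).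
Proof. exact: (ten_bilinear _ _).2. Qed.

Lemma tpoly_linear : linear tpoly.
Proof. by move=> c p q; rewrite /tpoly linearP ten_linearl. Qed.
HB.instance Definition _ := GRing.isLinear.Build k {poly k} T _ tpoly tpoly_linear.

Lemma tpolyM p q : tpoly (p * q) = tpoly p * tpoly q.
Proof. by rewrite /tpoly tenM mul1r rmorphM. Qed.

Lemma tpoly1 : tpoly 1 = 1.
Proof. by rewrite /tpoly rmorph1. Qed.

Lemma td_tpoly p : td * tpoly p = tpoly p * td + tpoly p^`().
Proof.
rewrite /td /tpoly !tenM !mul1r weyl_d_poly.
by have := ten_linearl 1 1 (weyl_poly p * weyl_d k) (weyl_poly p^`()); rewrite !scale1r.
Qed.

Lemma tpoly_tv p i : tpoly p * tv i = tv i * tpoly p.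
Proof. by rewrite /tpoly /tv !tenM !mul1r !mulr1. Qed.

Lemma td_tv i : td * tv i = tv i * td.
Proof. by rewrite /td /tv !tenM !mul1r !mulr1. Qed.

Lemma tv0 i : (n <= i)%N -> tv i = 0.
Proof.
move=> ni; rewrite /tv gn_v0 //.
have -> : env_in (0 : gn k n) = 0.
  by have := @env_in_linear _ (gn k n) (-1) 0 0; rewrite !scaleN1r oppr0 addr0 addNr.
exact: bilin0r (ten_bilinear _ _) _.
Qed.

Lemma tv_lie i j : tv i * tv j - tv j * tv i = (j%:R - i%:R) *: tv (i + j).
Proof.
have inZ c (x : gn k n) : env_in (c *: x) = c *: env_in x.
  have in0 : env_in (0 : gn k n) = 0.
    by have := @env_in_linear _ (gn k n) (-1) 0 0; rewrite !scaleN1r oppr0 addr0 addNr.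
  by have := env_in_linear c x 0; rewrite in0 !addr0.
have tZ c b : ten (1 : weyl k) (c *: b) = c *: (ten 1 b : T).
  exact: bilinZr (ten_bilinear _ _) _ _ _.
have tD b c : ten (1 : weyl k) (b + c) = (ten 1 b : T) + ten 1 c.
  exact: bilinDr (ten_bilinear _ _) _ _ _.
rewrite /tv !tenM mul1r -scaleN1r -tZ -tD scaleN1r -env_in_lie gn_vlie.
by rewrite inZ tZ.
Qed.

Lemma orbit_target_ind (S : T -> Prop) :
  S (tpoly 'X) -> S td -> (forall i, (i < n)%N -> S (tv i)) ->
  (forall c, S c%:A) -> (forall x y, S x -> S y -> S (x + y)) ->
  (forall x y, S x -> S y -> S (x * y)) -> forall x, S x.
Proof.
move=> St Sd Sv Sc SD SM.
have tenc c : ten (c%:A : weyl k) 1 = c%:A :> T.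
  have := bilinZl (ten_bilinear (weyl k) (env (gn k n))) c 1 1.
  by rewrite ten1.
have tenc' c : ten 1 (c%:A : env (gn k n)) = c%:A :> T.
  have := bilinZr (ten_bilinear (weyl k) (env (gn k n))) c 1 1.
  by rewrite ten1.
have Sl (a : weyl k) : S (ten a 1).
  elim/(@palg_ind _ _ (weyl_pres k)): a => [[]|c|a b Sa Sb|a b Sa Sb].
  - by move: St; rewrite /tpoly weyl_polyX.
  - exact: Sd.
  - by rewrite tenc.
  - rewrite [ten _ _](bilinDl (ten_bilinear (weyl k) (env (gn k n)))).
    exact: SD.
  - by have := SM _ _ Sa Sb; rewrite tenM mul1r.
have Sr (b : env (gn k n)) : S (ten 1 b).
  elim/(@palg_ind _ _ (env_pres (gn k n))): b => [x|c|a b Sa Sb|a b Sa Sb].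
  - rewrite -/(env_in x) (gn_decomp x).
    have S0 : S 0 by rewrite -(scale0r 1).
    elim/big_rec: _ => [|i y _ Sy].
      by rewrite -(gn_v0 k (leqnn n)) -/(tv n) tv0.
    rewrite env_in_linear ten_linearr; apply: SD => //.
    by rewrite -mulr_algl; apply: SM => //; exact: Sv.
  - by rewrite tenc'.
  - rewrite [ten _ _](bilinDr (ten_bilinear (weyl k) (env (gn k n)))).
    exact: SD.
  - by have := SM _ _ Sa Sb; rewrite tenM mul1r.
move=> x; have [s ->] := tens_span x.
elim/big_ind: _ => //; first by rewrite -(scale0r 1).
by move=> p _; have := SM _ _ (Sl p.1) (Sr p.2); rewrite tenM mulr1 mul1r.
Qed.


Lemma tgen_td : tgen (inord 1) = td.
Proof. by rewrite /tgen inordK. Qed.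
Lemma tgen_tv i : (i < n)%N -> tgen (inord i.+2) = tv i.
Proof. by move=> ni; rewrite /tgen inordK. Qed.

Lemma tgen_generate x : exists d, filt tgen d x.
Proof.
elim/orbit_target_ind: x => [||i ni|c|x y [d dx] [e ey]|x y [d dx] [e ey]].
- by exists 2; exact: (filt_gen tgen ord0).
- by exists 2; rewrite -tgen_td; exact: filt_gen.
- by exists 2; rewrite -tgen_tv //; exact: filt_gen.
- by exists 1%N; apply/lin_spanZ/filt1.
- exists (maxn d e); apply: lin_spanD.
    by apply: filt_mono dx; exact: leq_maxl.
  by apply: filt_mono ey; exact: leq_maxr.
- exists (d + e)%N; apply: filtM ey; exact: filt_mono (leqnSn _) _ dx.
Qed.

Lemma tgen_comm i j : filt tgen 2 (tgen i * tgen j - tgen j * tgen i).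
Proof.
have F0 : filt tgen 2 0 by exact: lin_span0.
have F1 : filt tgen 2 1 by exact: filt1.
have tdX : td * tpoly 'X = tpoly 'X * td + 1 by rewrite td_tpoly derivX tpoly1.
case: i j => [[|[|i]] ilt] [[|[|j]] jlt]; rewrite /tgen /= ?subrr //.
- by rewrite tdX opprD addNKr -scaleN1r; exact: lin_spanZ.
- by rewrite tpoly_tv subrr.
- by rewrite tdX addrC addKr.
- by rewrite td_tv subrr.
- by rewrite -tpoly_tv subrr.
- by rewrite -td_tv subrr.
rewrite tv_lie; apply: lin_spanZ.
have [nij|nij] := leqP n (i + j); first by rewrite tv0.
by rewrite -tgen_tv //; exact: filt_gen.
Qed.

Lemma ordered_tgen p : ordered tgen p = \sum_(m <- msupp p) mcoeff m p *:
  (ten (weyl_t k ^+ m ord0 * weyl_d k ^+ m (lift ord0 ord0))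
       (\prod_(i < n) env_in (gn_v k n i) ^+ m (lift ord0 (lift ord0 i))) : T).
Proof.
rewrite /ordered /mmap; apply: eq_bigr => m _.
rewrite /= mulr_algl; congr (_ *: _).
rewrite /mmap1 big_ord_recl big_ord_recl mulrA.
have tenX (a : weyl k) e : (ten a 1 : T) ^+ e = ten (a ^+ e) 1.
  elim: e => [|e IH]; first by rewrite !expr0.
  by rewrite !exprS IH tenM mul1r.
have tenXr (b : env (gn k n)) e : (ten 1 b : T) ^+ e = ten 1 (b ^+ e).
  elim: e => [|e IH]; first by rewrite !expr0.
  by rewrite !exprS IH tenM mul1r.
rewrite /tgen /= /tpoly /td /tv !tenX weyl_polyX tenM mul1r.
have -> : \prod_(i < n) (ten 1 (env_in (gn_v k n i)) : T) ^+ m (lift ord0 (lift ord0 i)) =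
   ten 1 (\prod_(i < n) env_in (gn_v k n i) ^+ m (lift ord0 (lift ord0 i))).
  rewrite (big_morph (fun b => ten 1 b : T) (id1 := 1) (op1 := *%R)) //.
    by apply: eq_bigr => i _; rewrite tenXr.
  by move=> a b; rewrite tenM mul1r.
by rewrite tenM mulr1 mul1r.
Qed.

End OrbitTarget.

Section OrbitPBW.
Variables (k : fieldType) (n : nat).
Hypothesis char0 : [pchar k] =i pred0.

Let nat_neq0 m : (0 < m)%N -> m%:R != 0 :> k.
Proof. by move: m => [|m] // _; move/pcharf0P: char0 => ->. Qed.


Lemma mulX_linear : linear (fun p : {poly k} => 'X * p).
Proof. by move=> a p q; rewrite mulrDr scalerAr. Qed.
Lemma deriv_linear : linear (fun p : {poly k} => p^`()).
Proof. by move=> a p q; rewrite linearP. Qed.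

Local Notation E1 := (endo (oner_neq0 {poly k})).
Let mulX : E1 := EndoMap mulX_linear.
Let ddX : E1 := EndoMap deriv_linear.

Let weyl_rel1 : ddX * mulX - mulX * ddX = 1.
Proof.
apply: endo_ext => p; rewrite /= derivM derivX mul1r addrK.
by [].
Qed.

Let rho1 : {lrmorphism weyl k -> E1} := weyl_hom weyl_rel1.

Let evX (V : lmodType k) (v0 : V) (h : v0 != 0) (f : endo h) e v :
  ev v (f ^+ e) = iter e (fun w => ev w f) v.
Proof. by elim: e => [|e IH]; rewrite ?expr0 // exprS evM IH. Qed.

Definition weyl_form (c b : nat) (x : weyl k) : k := (ev 'X^b (rho1 x) : {poly k})`_c.

Lemma weyl_form_linear c b : linear (weyl_form c b : weyl k -> k^o).
Proof. by move=> a x y; rewrite /weyl_form !linearP coefD coefZ. Qed.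

Lemma weyl_formE c b a e : weyl_form c b (weyl_t k ^+ a * weyl_d k ^+ e) =
  (('X^a * 'X^(b - e) : {poly k})`_c) *+ b ^_ e.
Proof.
have rE : rho1 (weyl_t k ^+ a * weyl_d k ^+ e) = mulX ^+ a * ddX ^+ e.
  by rewrite rmorphM !rmorphXn /= weyl_hom_t weyl_hom_d.
rewrite /weyl_form rE evM !evX.
rewrite -/(derivn e 'X^b) derivnXn.
rewrite (_ : iter a _ _ = 'X^a * ('X^(b - e) *+ b ^_ e)).
  by rewrite mulrnAr coefMn.
by elim: {rE} a => [|a IH] /=; rewrite ?expr0 ?mul1r // IH exprS mulrA.
Qed.

Local Notation E2 := (endo (oner_neq0 (mpoly n k))).
Let jetE (i : nat) : E2 := EndoMap (vfield_linear (@jet_coef k n i)).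

Let jetE0 i : (n <= i)%N -> jetE i = 0.
Proof. by move=> ni; apply: endo_ext => p; exact: jet_field0. Qed.
Let jetED i j : (i < n)%N -> (j < n)%N ->
  jetE i * jetE j - jetE j * jetE i = (j%:R - i%:R) *: jetE (i + j)%N.
Proof. by move=> _ _; apply: endo_ext => p; exact: jet_field_lie. Qed.

Let rho2 : {lrmorphism env (gn k n) -> E2} := gn_hom jetE0 jetED.

Definition jet_form (b : multinom n) (x : env (gn k n)) : k :=
  mcoeff (@mnm0 n) (ev (mpolyX k b) (rho2 x)).

Lemma jet_form_linear b : linear (jet_form b : env (gn k n) -> k^o).
Proof. by move=> a x y; rewrite /jet_form !linearP. Qed.

Lemma jet_formE (b a : multinom n) : (mdeg a <= mdeg b)%N ->
  jet_form b (\prod_(i < n) env_in (gn_v k n i) ^+ a i) =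
  if a == b then (-1) ^+ mdeg a * (\prod_(i < n) (a i)`!)%:R else 0.
Proof.
move=> ab; rewrite -jet_fields_const // /jet_form rmorph_prod.
congr mcoeff; pose D (i : 'I_n) := jetE i.
have -> : \prod_(i < n) rho2 (env_in (gn_v k n i) ^+ a i) = word D (mnm_seq a).
  rewrite -(ordered_mpolyX D) /ordered mmapX /mmap1; apply: eq_bigr => i _.
  by rewrite rmorphXn /= gn_hom_v.
elim: (mnm_seq a) => [|i s IH]; first by rewrite /word big_nil ev1.
by rewrite /word big_cons evM -/(word D s) IH.
Qed.

(** A bilinear form on the two tensor factors isolates the coefficient of one
    well-chosen monomial. *)
Lemma tgen_pbw (p : mpoly n.+2 k) : ordered (@tgen k n) p = 0 -> p = 0.
Proof.
move=> p0; apply/eqP; apply: contraT => pN0.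
pose tl (m : multinom n.+2) := Multinom [tuple m (lift ord0 (lift ord0 i)) | i < n].
have tlE m i : tl m i = m (lift ord0 (lift ord0 i)) by rewrite mnmE.
pose w (m : multinom n.+2) := m (lift ord0 ord0).
(* The monomial m0 has the largest total degree in the v_i, and among those
   the smallest degree in d. *)
have [m0 [m0p m0max m0min]] : exists m0, [/\ m0 \in msupp p,
    forall m, m \in msupp p -> (mdeg (tl m) <= mdeg (tl m0))%N &
    forall m, m \in msupp p -> mdeg (tl m) = mdeg (tl m0) -> (w m0 <= w m)%N].
  have ex1 : exists d, has (fun m => mdeg (tl m) == d) (msupp p).
    have := mlead_supp pN0 => lp; exists (mdeg (tl (mlead p))).
    by apply/hasP; exists (mlead p).
  have bd d : has (fun m => mdeg (tl m) == d) (msupp p) ->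
      (d <= \max_(m <- msupp p) mdeg (tl m))%N.
    by move=> /hasP[m mp /eqP<-]; apply: leq_bigmax_seq.
  case: (ex_maxnP ex1 bd) => d /hasP[m1 m1p /eqP m1d] dmax.
  have ex2 : exists e, has (fun m => (mdeg (tl m) == d) && (w m == e)) (msupp p).
    by exists (w m1); apply/hasP; exists m1; rewrite // m1d !eqxx.
  case: (ex_minnP ex2) => e /hasP[m0 m0p /andP[/eqP m0d /eqP m0e]] emin.
  exists m0; split=> // [m mp|m mp md].
    by rewrite m0d dmax //; apply/hasP; exists m.
  by rewrite m0e emin //; apply/hasP; exists m; rewrite // md m0d !eqxx.
pose L (x : weyl k) (y : env (gn k n)) : k^o :=
  weyl_form (m0 ord0) (w m0) x * jet_form (tl m0) y.
have LE x (m : multinom n.+2) :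
    L x (\prod_(i < n) env_in (gn_v k n i) ^+ m (lift ord0 (lift ord0 i))) =
    weyl_form (m0 ord0) (w m0) x *
    jet_form (tl m0) (\prod_(i < n) env_in (gn_v k n i) ^+ tl m i).
  by rewrite /L; congr (_ * jet_form _ _); apply: eq_bigr => i _; rewrite tlE.
have Lbil : is_bilinear L.
  split=> [y|x] a u v; rewrite /L ?weyl_form_linear ?jet_form_linear.
    by rewrite mulrDl scalerAl.
  by rewrite mulrDr scalerAr.
have := congr1 (tens_lift L) p0; have ll := tens_lift_linear Lbil.
have l0 : tens_lift L 0 = 0.
  by have := ll (-1) 0 0; rewrite !scaleN1r oppr0 addr0 addNr.
have lZ c x : tens_lift L (c *: x) = c * tens_lift L x.
  by have := ll c x 0; rewrite l0 !addr0.
rewrite l0 ordered_tgen (big_morph (tens_lift L) (id1 := 0) (op1 := +%R)) //; last first.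
  by move=> x y; have := ll 1 x y; rewrite !scale1r.
under eq_bigr => m _ do rewrite lZ tens_liftE //.
rewrite (bigD1_seq m0 m0p (msupp_uniq _)) /=.
rewrite [X in _ + X]big_seq_cond [X in _ + X]big1 ?addr0; last first.
  move=> m /andP[mp mm0]; rewrite LE.
  rewrite jet_formE ?m0max //; case: eqP => [tlm|]; last by rewrite !mulr0.
  rewrite weyl_formE; have wm : (w m0 <= w m)%N by apply: m0min => //; rewrite tlm.
  have [wlt|wge] := ltnP (w m0) (w m).
    by rewrite ffact_small // mulr0n mul0r mulr0.
  have wE : w m = w m0 by apply/eqP; rewrite eqn_leq wge wm.
  rewrite -/(w m) wE subnn expr0 mulr1 coefXn.
  case: eqP => [e0|]; last by rewrite mul0rn mul0r mulr0.
  case/eqP: mm0; apply/mnmP => i.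
  case: (unliftP ord0 i) => [i' ->|->]; last by rewrite e0.
  case: i' => -[|i'] ilt.
    by rewrite -[Ordinal ilt](_ : ord0 = _) //; apply: val_inj.
  have i'n : (i' < n)%N by [].
  rewrite (_ : Ordinal ilt = lift ord0 (Ordinal i'n)); last exact: val_inj.
  by rewrite -!tlE tlm.
rewrite LE jet_formE // eqxx weyl_formE -/(w m0) subnn expr0 mulr1 coefXn eqxx.
rewrite ffactnn => /eqP; rewrite !mulf_eq0 signr_eq0 /=.
have /negPf-> : mcoeff m0 p != 0 by rewrite -mcoeff_msupp.
have /negPf-> := nat_neq0 (fact_gt0 (w m0)).
have /negPf-> // : (\prod_(i < n) (tl m0 i)`!)%:R != 0 :> k.
by apply/nat_neq0/prodn_gt0 => i; exact: fact_gt0.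
Qed.

End OrbitPBW.

(** * Polarized products of vector fields *)

Section DiagonalDifference.
Variable k : fieldType.
Implicit Types f g : {poly k}.

(** Precomposition of a bilinear map on k[x] (x) k[y] with multiplication by
    x - y. *)
Definition diagdiff (V : zmodType) (F : {poly k} -> {poly k} -> V) f g : V :=
  F ('X * f) g - F f ('X * g).

Definition taylor_pair (a b : nat) f g : {poly k} := f^`N(a) * g^`N(b).

Lemma iter_diagdiff (V : zmodType) (F : {poly k} -> {poly k} -> V) N f g :
  iter N.+1 (@diagdiff V) F f g =
  iter N (@diagdiff V) F ('X * f) g - iter N (@diagdiff V) F f ('X * g).
Proof. by []. Qed.

Lemma iter_diagdiff_sum (V W : zmodType) I (s : seq I)
    (F : I -> {poly k} -> {poly k} -> V) (h : I -> V -> W) N f g :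
  (forall i, {morph h i : x y / x - y}) ->
  iter N (@diagdiff W) (fun f g => \sum_(i <- s) h i (F i f g)) f g =
  \sum_(i <- s) h i (iter N (@diagdiff V) (F i) f g).
Proof.
move=> hB; elim: N f g => [|N IH] f g //; rewrite iter_diagdiff !IH -sumrB.
by apply: eq_bigr => i _; rewrite iter_diagdiff hB.
Qed.

(** Leibniz rule: on the diagonal, x - y vanishes and its derivatives are 1
    and -1. *)
Lemma taylor_pairS a b : diagdiff (taylor_pair a b) = fun f g =>
  (if a is a'.+1 then taylor_pair a' b f g else 0) -
  (if b is b'.+1 then taylor_pair a b' f g else 0).
Proof.
apply/funext => f; apply/funext => g; rewrite /diagdiff /taylor_pair.
rewrite ![in LHS](mulrC 'X).
case: a b => [|a] [|b]; rewrite ?nderivn0 ?nderivnMX ?nderivn0; ring.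
Qed.

(** The coefficient is that of the product of the a-th power of e and the b-th
    power of e' in the Taylor expansion (e - e')^N of (x - y)^N. *)
Lemma iter_taylor_pair N a b f g : (a + b <= N)%N ->
  iter N (@diagdiff _) (taylor_pair a b) f g =
  (if N == (a + b)%N then (-1) ^+ b * 'C(a + b, b)%:R else 0) * (f * g).
Proof.
elim: N a b => [|N IH] a b.
  by case: a b => [|a] [|b] //= _; rewrite /taylor_pair !nderivn0 bin0 expr0 !mul1r.
rewrite iterSr taylor_pairS.
have split2 (F G : {poly k} -> {poly k} -> {poly k}) :
   iter N (@diagdiff _) (fun f g => F f g - G f g) f g =
   iter N (@diagdiff _) F f g - iter N (@diagdiff _) G f g.
  elim: N f g {IH} => // N IH f g; rewrite !iter_diagdiff !IH; ring.
have zero : iter N (@diagdiff _) (fun _ _ => 0 : {poly k}) f g = 0.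
  by elim: N f g {IH split2} => // N IH f g; rewrite iter_diagdiff !IH subrr.
rewrite split2; case: a b => [|a] [|b] abN.
- by rewrite zero subrr mul0r.
- rewrite zero IH // eqSS add0n; case: eqP => _; last by rewrite !mul0r subrr.
  by rewrite !binn exprS; ring.
- have aN : (a + 0 <= N)%N by [].
  by rewrite zero IH // subr0 addSn eqSS !addn0 !bin0.
- have aN : (a + b.+1 <= N)%N by [].
  have bN : (a.+1 + b <= N)%N by rewrite addSnnS.
  rewrite !IH // !addSn !addnS eqSS; case: (N == _); last by rewrite !mul0r subrr.
  by rewrite [in RHS]binS natrD exprS; ring.
Qed.

End DiagonalDifference.

Section OrbitImage.
Variables (k : fieldType) (n : nat).
Local Notation T := (orbit_target k n).
Local Notation B := (orbit_image k n).
Local Notation j := (image_incl (orbit_hom k n)).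
Implicit Types f g : {poly k}.

Definition Psi f : T := orbit_hom k n (env_in (f : witt k)).

Lemma PsiE f : Psi f = tpoly n f * td k n + \sum_(i < n) tpoly n f^`N(i.+1) * tv k n i.
Proof.
rewrite /Psi orbit_homE /orbit_fun /tpoly /td /tv tenM mul1r; congr (_ + _).
by apply: eq_bigr => i _; rewrite tenM mul1r mulr1.
Qed.

Lemma Psi1 : Psi 1 = td k n.
Proof.
rewrite PsiE tpoly1 mul1r big1 ?addr0 // => i _.
by rewrite -polyC1 nderivnC /= linear0 mul0r.
Qed.

Lemma image_inj : injective j. Proof. exact: val_inj. Qed.

Lemma image_mem x : exists y : B, j y = orbit_hom k n x.
Proof.
have xB : in_image (orbit_hom k n) (orbit_hom k n x) by apply/asboolP; exists x.
by exists (exist (fun y => is_true (in_image (orbit_hom k n) y)) _ xB).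
Qed.

Lemma image_memP (y : B) : exists x, orbit_hom k n x = j y.
Proof. exact/asboolP/(valP y). Qed.

(** Once the coordinate is inverted, the generators [tv i] are recovered from
    the images of the vector fields by triangularity. *)
Lemma image_generates (S : T -> Prop) :
  (forall y : B, S (j y)) -> S (tpoly n 'X) ->
  (forall x y, S x -> S y -> S (x + y)) ->
  (forall x y, S x -> S y -> S (x * y)) -> forall x, S x.
Proof.
move=> Sj SX SD SM.
have Spsi f : S (Psi f).
  by rewrite /Psi; have [y <-] := image_mem (env_in (f : witt k)).
have Sc c : S c%:A by rewrite -(rmorph_alg j); exact: Sj.
have S0 : S 0 by rewrite -(scale0r 1).
have SZ c x : S x -> S (c *: x) by move=> Sx; rewrite -mulr_algl; exact: SM.
have SXn i : S (tpoly n 'X^i).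
  elim: i => [|i IH]; last by rewrite exprS tpolyM; exact: SM.
  by rewrite expr0 tpoly1 -(scale1r 1); exact: Sc.
have Sd : S (td k n) by rewrite -Psi1.
elim/orbit_target_ind => // i.
elim/ltn_ind: i => i IH ni.
(* Isolate the term of index i in [PsiE]; the terms of index above i vanish. *)
have : tv k n i = Psi 'X^(i.+1) + (-1) *: (tpoly n 'X^(i.+1) * td k n) +
    \sum_(l < n | l != Ordinal ni)
      (- 'C(i.+1, l.+1)%:R) *: (tpoly n 'X^(i - l) * tv k n l).
  rewrite PsiE scaleN1r (addrC (tpoly n _ * td k n)) addrK.
  rewrite (bigD1 (Ordinal ni)) //= -addrA.
  rewrite nderivnXn subnn expr0 binn mulr1n tpoly1 mul1r -big_split big1 ?addr0 //=.
  move=> l _; rewrite nderivnXn subSS scaleNr -scaler_nat linearZ -scalerAl.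
  exact: subrr.
move=> ->; apply: (SD); first by apply: (SD) => //; apply/SZ/SM.
elim/big_ind: _ => // l li; have [il|] := leqP i l; last first.
  by move=> lti; apply/SZ/SM => //; exact: IH.
rewrite bin_small ?oppr0 ?scale0r // ltnS ltn_neqAle il andbT.
by rewrite eq_sym; move: li; rewrite -val_eqE.
Qed.

Lemma Psi_diagdiff_mem N f g :
  exists y : B, j y = iter N (@diagdiff k T) (fun f g => Psi f * Psi g) f g.
Proof.
elim: N f g => [|N IH] f g.
  have [x xE] := image_mem (env_in (f : witt k)).
  have [y yE] := image_mem (env_in (g : witt k)).
  exists (x * y); rewrite [RHS]/(Psi f * Psi g) /Psi -xE -yE.
  exact: (rmorphM j).
have [x xE] := IH ('X * f) g; have [y yE] := IH f ('X * g).
exists (x - y); rewrite iter_diagdiff -xE -yE; exact: (rmorphB j).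
Qed.

(** The terms of Psi f * Psi g: an entry (a, b, c) stands for
    f^`N(a) g^`N(b) c. *)
Definition Psi_terms : seq (nat * nat * T) :=
  [:: (0, 0, td k n * td k n); (0, 1, td k n)] ++
  [seq (0, i.+1, td k n * tv k n i) | i <- iota 0 n] ++
  [seq (0, i.+2, i.+2%:R *: tv k n i) | i <- iota 0 n] ++
  [seq (i.+1, 0, tv k n i * td k n) | i <- iota 0 n] ++
  [seq (i.+1, l.+1, tv k n i * tv k n l) | i <- iota 0 n, l <- iota 0 n].

Lemma Psi_termsE f g : Psi f * Psi g =
  \sum_(e <- Psi_terms) tpoly n (taylor_pair e.1.1 e.1.2 f g) * e.2.
Proof.
have sumE (F : nat -> T) : \sum_(i <- iota 0 n) F i = \sum_(i < n) F i.
  by rewrite -(big_mkord xpredT) /index_iota subn0.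
rewrite /Psi_terms !big_cons !big_cat !big_map big_allpairs_dep /=.
rewrite !sumE /taylor_pair !nderivn0 !poly.nderivn1 !PsiE mulrDl !mulrDr.
have -> : tpoly n f * td k n * (tpoly n g * td k n) =
    tpoly n (f * g) * (td k n * td k n) + tpoly n (f * g^`()) * td k n.
  by rewrite -mulrA (mulrA (td k n)) td_tpoly mulrDl mulrDr !tpolyM !mulrA.
have -> : tpoly n f * td k n * (\sum_(i < n) tpoly n g^`N(i.+1) * tv k n i) =
    \sum_(i < n) tpoly n (f * g^`N(i.+1)) * (td k n * tv k n i) +
    \sum_(i < n) tpoly n (f * g^`N(i.+2)) * (i.+2%:R *: tv k n i).
  rewrite mulr_sumr -big_split; apply: eq_bigr => i _ /=.
  rewrite -mulrA (mulrA (td k n)) td_tpoly mulrDl mulrDr !tpolyM !mulrA.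
  congr (_ + _); rewrite deriv_nderivn -scaler_nat linearZ /=.
  by rewrite -scalerAr -!scalerAl -scalerAr.
have -> : (\sum_(i < n) tpoly n f^`N(i.+1) * tv k n i) * (tpoly n g * td k n) =
    \sum_(i < n) tpoly n (f^`N(i.+1) * g) * (tv k n i * td k n).
  rewrite mulr_suml; apply: eq_bigr => i _.
  by rewrite tpolyM -!mulrA; congr (_ * _); rewrite !mulrA tpoly_tv.
rewrite -!addrA; do 5! congr (_ + _).
rewrite mulr_suml; apply: eq_bigr => i _.
rewrite mulr_sumr [in RHS]sumE; apply: eq_bigr => l _.
by rewrite tpolyM -!mulrA; congr (_ * _); rewrite !mulrA tpoly_tv.
Qed.

Lemma iter_Psi_terms N f g : (forall e, e \in Psi_terms -> (e.1.1 + e.1.2 <= N)%N) ->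
  iter N (@diagdiff k T) (fun f g => Psi f * Psi g) f g =
  tpoly n (f * g) * \sum_(e <- Psi_terms)
    (if N == (e.1.1 + e.1.2)%N then (-1) ^+ e.1.2 * 'C(N, e.1.2)%:R else 0) *: e.2.
Proof.
move=> eN.
have -> : (fun f g => Psi f * Psi g) = (fun f g => \sum_(e <- Psi_terms)
   (fun e p => tpoly n p * e.2) e (taylor_pair e.1.1 e.1.2 f g)).
  by apply/funext => f'; apply/funext => g'; rewrite Psi_termsE.
rewrite (iter_diagdiff_sum (h := fun e p => tpoly n p * e.2) _
  (fun e => taylor_pair e.1.1 e.1.2)); last first.
  by move=> e p q; rewrite linearB mulrBl.
rewrite mulr_sumr big_seq [RHS]big_seq; apply: eq_bigr => e ein.
rewrite iter_taylor_pair ?eN //; case: eqP => [->|_]; last first.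
  by rewrite mul0r linear0 mul0r scale0r mulr0.
have -> : (-1) ^+ e.1.2 * 'C(e.1.1 + e.1.2, e.1.2)%:R * (f * g) =
   ((-1) ^+ e.1.2 * 'C(e.1.1 + e.1.2, e.1.2)%:R : k) *: (f * g).
  by rewrite -mul_polyC rmorphM rmorphXn rmorphN rmorph1 rmorph_nat.
by rewrite linearZ /= -scalerAl -scalerAr.
Qed.

End OrbitImage.

(** * A denominator in the image *)

Section Denominator.
Variables (k : fieldType) (n : nat).
Hypothesis char0 : [pchar k] =i pred0.
Hypothesis n_ge1 : (1 <= n)%N.
Local Notation T := (orbit_target k n).
Local Notation B := (orbit_image k n).
Local Notation j := (image_incl (orbit_hom k n)).

Let N := (n + n)%N.
Let c : k := (-1) ^+ n * 'C(N, n)%:R.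

Lemma Psi_terms_order e : e \in Psi_terms k n -> (e.1.1 + e.1.2 <= N)%N.
Proof.
rewrite /Psi_terms /N !inE !mem_cat => /or3P[/eqP->|/eqP->|] /=; try lia.
case/or4P => [/mapP[i]|/mapP[i]|/mapP[i]|/allpairsP[[i l] /= []]];
  rewrite !mem_iota => /andP[_ ilt].
- by move=> -> /=; lia.
- by move=> -> /=; lia.
- by move=> -> /=; lia.
by move=> /andP[_ llt] -> /=; lia.
Qed.

(** In top order 2n there is the square of the last generator and, for n = 1
    only, the term where d has differentiated g.  The unspecified [gamma]
    covers both cases: it only matters that this term is
    linear in the generators. *)
Lemma denominator_ex : exists gamma : nat -> k,
  \sum_(e <- Psi_terms k n)
    (if N == (e.1.1 + e.1.2)%N then (-1) ^+ e.1.2 * 'C(N, e.1.2)%:R else 0) *: e.2 =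
  c *: (tv k n n.-1 * tv k n n.-1) + \sum_(i < n) gamma i *: tv k n i.
Proof.
exists (fun i => (if N == i.+2 then (-1) ^+ i.+2 * 'C(N, i.+2)%:R else 0) * i.+2%:R).
have sumE (F : nat -> T) : \sum_(i <- iota 0 n) F i = \sum_(i < n) F i.
  by rewrite -(big_mkord xpredT) /index_iota subn0.
have neq a : (a <= n)%N -> (N == a) = false.
  by move=> an; apply/negP => /eqP; rewrite /N; lia.
rewrite /Psi_terms !big_cons !big_cat !big_map big_allpairs_dep /= !sumE.
rewrite !neq // !scale0r !add0r.
rewrite big1 ?add0r => [|i _]; last first.
  by rewrite neq ?scale0r //; exact: ltn_ord.
rewrite addrC.
rewrite [X in X + _ = _](_ : _ = c *: (tv k n n.-1 * tv k n n.-1)).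
  by congr (_ + _); apply: eq_bigr => i _; rewrite scalerA.
rewrite [X in X + _]big1 ?add0r => [|i _]; last first.
  by rewrite addn0 neq ?scale0r //; exact: ltn_ord.
have nlt : (n.-1 < n)%N by rewrite prednK.
rewrite (bigD1 (Ordinal nlt)) //= sumE (bigD1 (Ordinal nlt)) //= prednK //.
rewrite eqxx -/c big1 ?addr0 => [|l ln]; last first.
  case: eqP => [|_]; last by rewrite scale0r.
  move: ln; rewrite -val_eqE /= /N; have := ltn_ord l; lia.
rewrite big1 ?addr0 // => i ni; rewrite sumE big1 // => l _.
case: eqP => [|_]; last by rewrite scale0r.
by move: ni; rewrite -val_eqE /= /N; have := ltn_ord l; have := ltn_ord i; lia.
Qed.

(** [z] is nonzero because its symbol is: the middle binomial coefficient does
    not vanish in characteristic zero. *)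
Lemma denominator : exists z : T, [/\ z != 0,
  exists y : B, j y = z, exists y : B, j y = tpoly n 'X * z &
  tpoly n 'X * z = z * tpoly n 'X].
Proof.
have [gamma zE] := denominator_ex; set z := _ + _ in zE; exists z.
have memz f : exists y : B, j y = tpoly n f * z.
  have [y yE] := @Psi_diagdiff_mem k n N f 1; exists y.
  by rewrite yE (iter_Psi_terms _ _ Psi_terms_order) zE mulr1.
split=> //.
- have c0 : c != 0.
    rewrite mulf_eq0 signr_eq0 /=; have := bin_gt0 N n; rewrite leq_addr.
    by case: 'C(N, n) => // a _; move/pcharf0P: char0 => ->.
  pose i : 'I_n.+2 := inord n.-1.+2.
  have iE : tgen k i = tv k n n.-1 by apply: tgen_tv; rewrite prednK.
  pose X : mpoly n.+2 k := mpolyX k (mnm1 i).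
  have sX : symbol (@tgen k n) 1 (tgen k i) X.
    have -> : tgen k i = ordered (@tgen k n) X by rewrite /ordered mmapX mmap1U.
    by apply: symbol_ordered; rewrite msizeX mdeg1.
  have sXX := symbolM (@tgen_comm k n) sX sX.
  have szX : msize (c *: (X * X)) = 3.
    by rewrite /X -mpolyXD msizeZ_proper ?mleadXm ?mcoeffX ?eqxx ?mulr1 //
      msizeX mdegD !mdeg1.
  apply: (symbol_neq0 (@tgen_comm k n) (@tgen_pbw k n char0) _ szX).
  split; first by rewrite szX.
  rewrite linearZ /= /z addrAC -iE -scalerBr; apply: lin_spanD.
    exact/lin_spanZ/sXX.2.
  apply: lin_span_sum => l _; apply: lin_spanZ.
  by rewrite -tgen_tv //; exact: filt_gen.
- by have [y yE] := memz 1; exists y; rewrite yE tpoly1 mul1r.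
- rewrite /z mulrDr mulrDl mulr_sumr mulr_suml; congr (_ + _).
    by rewrite -scalerAr -scalerAl mulrA tpoly_tv -mulrA tpoly_tv mulrA.
  by apply: eq_bigr => i _; rewrite -scalerAr -scalerAl tpoly_tv.
Qed.

End Denominator.

(** * Failure of the ascending chain condition *)

Section NonNoetherian.
Variables (k : fieldType) (n : nat).
Hypothesis char0 : [pchar k] =i pred0.
Hypothesis n_ge1 : (1 <= n)%N.
Local Notation T := (orbit_target k n).
Local Notation B := (orbit_image k n).
Local Notation j := (image_incl (orbit_hom k n)).
Local Notation V := ({poly k} * {poly k})%type.

Lemma dual_neq0 : ((1, 0) : V) != 0.
Proof. by apply/eqP => -[/eqP]; rewrite oner_eq0. Qed.
Local Notation E := (endo dual_neq0).

Lemma dual_mulX_linear : linear (fun v : V => ('X * v.1, 'X * v.2) : V).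
Proof. by move=> a u v; congr pair; rewrite /= mulrDr scalerAr. Qed.
Lemma dual_deriv_linear : linear (fun v : V => (v.1^`(), v.2^`()) : V).
Proof. by move=> a u v; congr pair; rewrite /= linearP. Qed.
Lemma dual_eps_linear : linear (fun v : V => (0, v.1) : V).
Proof. by move=> a u v; congr pair; rewrite /= scaler0 addr0. Qed.

Let mulX : E := EndoMap dual_mulX_linear.
Let ddX : E := EndoMap dual_deriv_linear.
Let eps : E := EndoMap dual_eps_linear.
Let epsi (i : nat) : E := if i is 0 then eps else 0.

Let dual_weyl : ddX * mulX - mulX * ddX = 1.
Proof.
apply: endo_ext => -[p q]; congr pair; rewrite /= derivM derivX mul1r addrK //.
Qed.

Let epsi0 i : (n <= i)%N -> epsi i = 0.
Proof. by case: i => //; rewrite leqNgt n_ge1. Qed.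

Let epsi_lie i l : (i < n)%N -> (l < n)%N ->
  epsi i * epsi l - epsi l * epsi i = (l%:R - i%:R) *: epsi (i + l)%N.
Proof.
by case: i l => [|i] [|l] _ _; rewrite /= ?mul0r ?mulr0 ?subrr ?scale0r ?scaler0.
Qed.

Let rho1 : {lrmorphism weyl k -> E} := weyl_hom dual_weyl.
Let rho2 : {lrmorphism env (gn k n) -> E} := gn_hom epsi0 epsi_lie.

Let rho_comm a b : rho1 a * rho2 b = rho2 b * rho1 a.
Proof.
have eps_comm a' i : GRing.comm (rho1 a') (epsi i).
  case: i => [|i]; last exact: commr0.
  elim/(@palg_ind _ _ (weyl_pres k)): a' => [[]|e|x y hx hy|x y hx hy].
  - by rewrite [rho1 _](weyl_hom_t dual_weyl); apply: endo_ext => v;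
      congr pair; rewrite /= mulr0.
  - by rewrite [rho1 _](weyl_hom_d dual_weyl); apply: endo_ext => v;
      congr pair; rewrite /= deriv0.
  - by rewrite linearZ rmorph1 /GRing.comm -scalerAl -scalerAr mul1r mulr1.
  - by rewrite linearD; apply/commr_sym/commrD; exact/commr_sym.
  - by rewrite rmorphM; apply/commr_sym/commrM; exact/commr_sym.
elim/(@palg_ind _ _ (env_pres (gn k n))): b => [x|e|x y hx hy|x y hx hy].
- rewrite [rho2 _](env_liftE (gn_map_linear epsi)).
  rewrite /gn_map mulr_sumr mulr_suml; apply: eq_bigr => i _.
  by rewrite -scalerAl -scalerAr eps_comm.
- by rewrite linearZ rmorph1 -scalerAl -scalerAr mul1r mulr1.
- by rewrite linearD mulrDl mulrDr hx hy.
- by rewrite rmorphM /= mulrA hx -!mulrA; congr (_ * _).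
Qed.

(** The pair (p, q) stands for p + q eps in k[t] (x) k[eps]/(eps^2). *)
Definition dual_rep : {lrmorphism T -> E} := tens_hom rho_comm.

Lemma dual_rep_poly f v : ev v (dual_rep (tpoly n f)) = (f * v.1, f * v.2).
Proof.
have -> : dual_rep (tpoly n f) = horner_alg mulX f.
  by rewrite [LHS]tens_hom_ten rmorph1 mulr1 [LHS]weyl_hom_poly.
elim/poly_ind: f v => [|f c IH] v; first by rewrite rmorph0 !mul0r.
have -> : horner_alg mulX (f * 'X + c%:P) = horner_alg mulX f * mulX + c%:A.
  by rewrite rmorphD rmorphM /= horner_algX horner_algC.
rewrite [ev _ _](_ : _ = ev (ev v mulX) (horner_alg mulX f) + c *: v) //.
by rewrite IH; congr pair; rewrite /= mulrDl mul_polyC mulrA.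
Qed.

Lemma dual_rep_d v : ev v (dual_rep (td k n)) = (v.1^`(), v.2^`()).
Proof. by rewrite [dual_rep _]tens_hom_ten rmorph1 mulr1 [rho1 _]weyl_hom_d. Qed.

Lemma dual_rep_v i : dual_rep (tv k n i) = epsi i.
Proof. by rewrite [LHS]tens_hom_ten rmorph1 mul1r [LHS]gn_hom_v. Qed.

Lemma dual_rep_Psi f v :
  ev v (dual_rep (Psi n f)) = (f * v.1^`(), f * v.2^`() + f^`() * v.1).
Proof.
have -> : dual_rep (Psi n f) = dual_rep (tpoly n f) * dual_rep (td k n) +
    dual_rep (tpoly n f^`()) * eps.
  rewrite PsiE [LHS]rmorphD [X in X + _]rmorphM rmorph_sum; congr (_ + _).
  rewrite (bigD1 (Ordinal n_ge1)) // big1 => [|[[|i] ilt] // _].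
    rewrite [LHS]addr0 [LHS]rmorphM; congr (_ * _); last exact: (dual_rep_v 0).
    by rewrite -[in RHS]poly.nderivn1.
  rewrite [LHS]rmorphM [X in _ * X](_ : _ = 0); first exact: mulr0.
  exact: (dual_rep_v i.+1).
rewrite [LHS](_ : _ = ev (ev v (dual_rep (td k n))) (dual_rep (tpoly n f)) +
   ev (ev v eps) (dual_rep (tpoly n f^`()))) //.
by rewrite !dual_rep_poly dual_rep_d; congr pair; rewrite /= mulr0 addr0.
Qed.

(** Modulo eps the generators [Psi n f] act as f d/dt, which kills constants;
    multiplication by t does not have this property. *)
Lemma dual_rep_image (y : B) :
  (forall q : {poly k}, (ev (0, q) (dual_rep (j y))).1 = 0) /\
  (forall p q : {poly k}, (size p <= 1)%N ->
     (size (ev (p, q) (dual_rep (j y))).1 <= 1)%N).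
Proof.
have [x <-] := image_memP y.
elim/(@palg_ind _ _ (env_pres (witt k))): x =>
  [f|c|x y' [x1 x2] [y1 y2]|x y' [x1 x2] [y1 y2]].
- rewrite -[orbit_hom k n _]/(Psi n (f : {poly k})); split=> [q|p q p1];
    rewrite dual_rep_Psi /=.
    by rewrite deriv0 mulr0.
  by rewrite (size1_polyC p1) derivC mulr0 size_poly0.
- rewrite !rmorph_alg; split=> [q|p q p1].
    by rewrite [ev _ _](_ : _ = c *: ((0, q) : V)) //= scaler0.
  rewrite [ev _ _](_ : _ = c *: ((p, q) : V)) //=.
  exact: leq_trans (size_scale_leq _ _) p1.
- rewrite !rmorphD; split=> [q|p q p1].
    by rewrite [LHS](_ : _ = (ev (0, q) (dual_rep (orbit_hom k n x))).1 +
      (ev (0, q) (dual_rep (orbit_hom k n y'))).1) // x1 y1 addr0.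
  rewrite (leq_trans (size_polyD _ _)) // geq_max.
  by apply/andP; split; [exact: x2|exact: y2].
rewrite !rmorphM; split=> [q|p q p1]; rewrite evM.
  by have := y1 q; case: (ev _ _) => p' q' /= ->.
by have := y2 p q p1; case: (ev _ _) => p' q' /=; exact: x2.
Qed.

(** Elements acting as eps times an operator on k[t], with a bound on the
    value of that operator at 1. *)
Definition eps_ideal (m : nat) : set B := fun y =>
  [/\ forall v, (ev v (dual_rep (j y))).1 = 0,
      forall q : {poly k}, ev (0, q) (dual_rep (j y)) = 0 &
      (size (ev ((1, 0)%R : V) (dual_rep (j y))).2 <= m)%N].

(** A right factor from the image replaces 1 by a constant modulo eps, and so
    only rescales the value at 1. *)
Lemma eps_ideal_right m : is_right_ideal (eps_ideal m).
Proof.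
have r0 : dual_rep (j 0) = 0 by rewrite [j 0]rmorph0 rmorph0.
have rD x y : dual_rep (j (x + y)) = dual_rep (j x) + dual_rep (j y).
  by rewrite [j _]rmorphD rmorphD.
have rM x y : dual_rep (j (x * y)) = dual_rep (j x) * dual_rep (j y).
  by rewrite [j _]rmorphM rmorphM.
split.
- by split=> [v|q|]; rewrite r0 //= size_poly0.
- move=> x y [x1 x2 x3] [y1 y2 y3]; split=> [v|q|]; rewrite rD.
  + rewrite [LHS](_ : _ = (ev v (dual_rep (j x))).1 + (ev v (dual_rep (j y))).1) //.
    by rewrite x1 y1 addr0.
  + rewrite [LHS](_ : _ = ev (0, q) (dual_rep (j x)) + ev (0, q) (dual_rep (j y))) //.
    by rewrite x2 y2 addr0.
  + by rewrite (leq_trans (size_polyD _ _)) // geq_max x3 y3.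
move=> a x [x1 x2 x3]; have [a1 a2] := dual_rep_image a.
split=> [v|q|]; rewrite rM evM; first exact: x1.
  by have := a1 q; case: (ev _ _) => p' q' /= ->.
have := a2 1 0; rewrite size_poly1 => /(_ isT); case: (ev _ _) => p q /= p1.
have -> : ev (p, q) (dual_rep (j x)) =
    p`_0 *: ev (1, 0) (dual_rep (j x)) + ev (0, q) (dual_rep (j x)).
  rewrite -ev_linearr; congr ev; congr pair; last by rewrite /= scaler0 add0r.
  by rewrite /= addr0 {1}(size1_polyC p1) alg_polyC.
by rewrite x2 addr0; apply: leq_trans (size_scale_leq _ _) x3.
Qed.

(** The only second order term of Psi f * Psi g is f g'' eps, so two
    multiplications by x - y leave the operator 2 u eps. *)
Lemma eps_ideal_strict m : exists2 y, eps_ideal m.+1 y & ~ eps_ideal m y.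
Proof.
pose u : {poly k} := 'X^m.
have [y yE] := @Psi_diagdiff_mem k n 2 u 1.
have act v : ev v (dual_rep (j y)) = (0, 2%:R * (u * v.1)).
  rewrite yE !iter_diagdiff /=.
  rewrite !(rmorphB dual_rep) !(rmorphM dual_rep).
  rewrite [LHS](_ : _ =
    ev (ev v (dual_rep (Psi n 1))) (dual_rep (Psi n ('X * ('X * u)))) -
    ev (ev v (dual_rep (Psi n ('X * 1)))) (dual_rep (Psi n ('X * u))) -
    (ev (ev v (dual_rep (Psi n ('X * 1)))) (dual_rep (Psi n ('X * u))) -
     ev (ev v (dual_rep (Psi n ('X * ('X * 1))))) (dual_rep (Psi n u)))) //.
  rewrite !dual_rep_Psi /= !mulr1 !(derivM, derivD, derivX) -polyC1 !derivC polyC1.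
  by congr pair; rewrite /=; ring.
have size2 : size (2%:R * (u * 1)) = m.+1.
  rewrite mulr1 -(rmorph_nat polyC) mul_polyC size_scale ?size_polyXn //.
  by move/pcharf0P: char0 => ->.
exists y.
  split=> [v|q|]; rewrite act //=; first by rewrite mulr0 mulr0.
  by rewrite size2.
by case=> _ _; rewrite act /= size2 ltnn.
Qed.

Lemma image_not_noetherian : ~ noetherian B.
Proof.
case=> _ /(_ eps_ideal eps_ideal_right)[m|N NP].
  by move=> y [y1 y2 y3]; split=> //; exact: leqW.
have [y yN yN'] := eps_ideal_strict N.
by apply: yN'; rewrite -(NP N.+1 (leqnSn N)).
Qed.

End NonNoetherian.

(** * The orbit image *)

Theorem corollary1p2 (R : realType) (k : fieldType) (n : nat)
    (char0 : [pchar k] =i pred0) (n_ge1 : (1 <= n)%N) :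
  [/\ ~ noetherian (orbit_image k n),
      GKdim R (orbit_image k n) = ((n + 2)%:R : R)%:E &
      birational (image_incl (orbit_hom k n))].
Proof.
have gcomm := @tgen_comm k n; have ggen := @tgen_generate k n.
have pbw := @tgen_pbw k n char0; have jinj := @image_inj k n.
set j := image_incl (orbit_hom k n) in jinj *.
have oreB : ore_domain (orbit_image k n) := sub_ore_domain gcomm ggen pbw jinj.
have oreT : ore_domain (orbit_target k n).
  by apply: (sub_ore_domain (j := idfun) gcomm ggen pbw).
have [domT _ _] := oreT; have [domB orB _] := oreB.
have [z [z0 [b bz] [c cz] zX]] := denominator char0 n_ge1.
have b0 : b != 0 by rewrite -(inj_eq jinj) bz rmorph0.
have fracR x : right_fraction j x.
  apply: (image_generates (S := right_fraction j)) => [y||u v|u v].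
  - exact: (right_fraction_sub (rmorph1 j)).
  - by exists b, c; rewrite bz cz.
  - exact: (right_fractionD (rmorphD j) (rmorphM j) orB).
  - exact: (right_fractionM (rmorphD j) (rmorphM j) domB orB).
have fracL x : left_fraction j x.
  apply: (image_generates (S := left_fraction j)) => [y||u v|u v].
  - exact: left_fraction_sub.
  - exists b, c; split=> //; change (j b * tpoly n 'X = j c).
    by rewrite bz cz zX.
  - exact: left_fractionD.
  - exact: left_fractionM.
split.
- exact: image_not_noetherian.
- (* A common left denominator of the generators bounds the dimension below. *)
  have [d d0 dP] := left_fraction_common oreB (l := codom (@tgen k n))
    (fun x _ => fracL x).
  have /choice[e eE] i : exists e, j e = j d * tgen k i.
    by have [e eE] := dP _ (codom_f _ i); exists e.
  apply/eqP; rewrite eq_le addn2; apply/andP; split.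
    exact: (GKdim_le R gcomm ggen jinj).
  exact: (GKdim_ge R _ gcomm ggen pbw jinj d0 eE).
- split=> // Q i; exact: (fractions_quotients jinj domT oreB fracR fracL).
Qed.
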